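(* Let $z\in\mathbb C^n\setminus\Delta$ and let $p_1,\dots,p_d$ be a list of all distinct isolated critical points of the master function $\Phi(z,\cdot)$ on $U(\mathcal A(z))$. Then the sum of the Milnor numbers of the critical points $p_1,\dots,p_d$ is not greater than the rank of the contravariant form $S^{(a)}|_{\operatorname{Sing}W}$.
   Context: Let $0<k<n$ be integers and $J=\{1,\dots,n\}$. Fix nonzero linear functions $g_j=b_j^1t_1+\dots+b_j^kt_k$, $j\in J$, on $\mathbb C^k$ ($b_j^i\in\mathbb C$) spanning the dual space of $\mathbb C^k$, and nonzero complex weights $a=(a_j)_{j\in J}$. For $z\in\mathbb C^n$ put $f_j(z,t)=z_j+g_j(t)$, $H_j(z)=\{t\in\mathbb C^k: f_j(z,t)=0\}$; $\mathcal A(z)=(H_j(z))_{j\in J}$ is an arrangement in $\mathbb C^k$ with complement $U(\mathcal A(z))=\mathbb C^k\setminus\bigcup_jH_j(z)$. The (multivalued) master function is $\Phi(z,t)=\sum_ja_j\log f_j(z,t)$; its critical points in $t$ are the points of $U(\mathcal A(z))$ where all $\partial\Phi/\partial t_i$ vanish. The Milnor number of an isolated critical point $p$ is the dimension of the quotient of the algebra of germs at $p$ of holomorphic functions by the ideal generated by the $\partial\Phi/\partial t_i$, $i=1,\dots,k$. A circuit is a subset $C\subset J$ such that $(g_i)_{i\in C}$ is linearly dependent while every proper subset is linearly independent. For each circuit $C$ fix numbers $(\lambda^C_i)_{i\in C}$, not all zero, with $\sum_{i\in C}\lambda_i^Cg_i=0$; put $f_C(z)=\sum_{i\in C}\lambda_i^Cz_i$;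 $\Delta\subset\mathbb C^n$ is the union of the hyperplanes $\{f_C=0\}$ over all circuits. For $z\in\mathbb C^n$ let $\omega_j(z)=dg_j/f_j(z,\cdot)$, a form on $U(\mathcal A(z))$; $\mathrm{OS}^p(z)$ is the complex span of all $\omega_{j_1}(z)\wedge\dots\wedge\omega_{j_p}(z)$ ($\mathrm{OS}^0=\mathbb C$), $\mathcal F^k(z)=\mathrm{OS}^k(z)^*$, and $\operatorname{Sing}\mathcal F^k(z)$ is the annihilator of $\nu\wedge\mathrm{OS}^{k-1}(z)$, where $\nu=\sum_ja_j\omega_j(z)$. Call $\{j_1,\dots,j_k\}\subset J$ independent if $g_{j_1},\dots,g_{j_k}$ are linearly independent. For $z\in\mathbb C^n\setminus\Delta$ the forms $\omega_{j_1}(z)\wedge\dots\wedge\omega_{j_k}(z)$ over independent $\{j_1<\dots<j_k\}$ form a basis of $\mathrm{OS}^k(z)$; this identifies all $\mathrm{OS}^k(z)$, $z\notin\Delta$, with one space $V^*$. Its dual $V=\mathcal F^k(z)$ has the dual basis $F(H_{j_1},\dots,H_{j_k})$, and $\operatorname{Sing}V=\operatorname{Sing}\mathcal F^k(z)\subset V$ does not depend on $z\notin\Delta$. The contravariant form $S^{(a)}$ on $V$ is the symmetric bilinear form for which this basis is orthogonal and $S^{(a)}(F(H_{j_1},\dots,H_{j_k}),F(H_{j_1},\dots,H_{j_k}))=a_{j_1}\cdots a_{j_k}$. $W\subset V^*$ and $\operatorname{Sing}W\subset W$ are the images of $V$ and $\operatorname{Sing}V$ under $V\to V^*$, $x\mapsto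 S^{(a)}(x,\cdot)$; the induced form on $W$ is also denoted $S^{(a)}$. *)

(* Defs.v *)
From HB Require Import structures.
From mathcomp Require Import all_boot all_order all_algebra complex.
From mathcomp Require Import all_classical all_reals all_analysis.

Set Implicit Arguments.
Unset Strict Implicit.
Unset Printing Implicit Defensive.

Import Order.TTheory GRing.Theory Num.Theory.
Import numFieldNormedType.Exports.

Local Open Scope classical_set_scope.
Local Open Scope ring_scope.

(* Everything is written over a numFieldType K and used for K := R[i] with
   R : realType; [differentiable], whose scalars are K, is then complex
   differentiability. *)

Section LinearAlgebra.
Variables (K : fieldType) (vT : vectType K).

(* The subspace with the given set of elements; meaningful only when A is a
   linear subspace, see [mem_vspace_of]. *)
Definition vspace_of (A : set vT) : {vspace vT} :=
  xget 0%VS [set U : {vspace vT} | forall x, x \in U <-> A x].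

Lemma mem_vspace_of (A : set vT) :
    A 0 -> (forall c x y, A x -> A y -> A (c *: x + y)) ->
  forall x, x \in vspace_of A <-> A x.
Proof.
move=> A0 Alin; rewrite /vspace_of; case: xgetP => [U _ //|noU].
pose P d := `[< exists2 U : {vspace vT}, \dim U = d & forall x, x \in U -> A x >].
have exP : exists d, P d.
  exists 0%N; apply/asboolP; exists 0%VS; first by rewrite dimv0.
  by move=> x; rewrite memv0 => /eqP->.
have bP d : P d -> (d <= \dim {:vT})%N.
  by move=> /asboolP[U <- _]; exact/dimvS/subvf.
case: (ex_maxnP exP bP) => d /asboolP[U dU UA] maxd.
exfalso; apply: (noU U) => x; split; first exact: UA.
move=> Ax; have /maxd : P (\dim (<[x]> + U)%VS).
  apply/asboolP; exists (<[x]> + U)%VS => // y /memv_addP[u /vlineP[c ->]].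
  by move=> [v vU ->]; apply: Alin => //; exact: UA.
rewrite -dU => dle; have : (U == <[x]> + U)%VS.
  by rewrite eqEdim dle andbT addvSr.
by move=> /eqP ->; apply: subvP (addvSl _ _) _ (memv_line x).
Qed.

Definition form_rank (B : vT -> vT -> K) (U : {vspace vT}) : nat :=
  \rank (\matrix_(i < \dim U, j < \dim U) B (vbasis U)`_i (vbasis U)`_j).

End LinearAlgebra.

(* The quotient of the space E of K-valued functions by its subspace I has
   dimension d. *)
Definition has_quotient_dim (K : fieldType) (T : Type)
    (E I : set (T -> K)) (d : nat) : Prop :=
  exists2 e : 'I_d -> T -> K, forall i, E (e i) &
    forall h, E h ->
      exists! c : 'rV[K]_d, I (fun t => h t - \sum_(i < d) c 0 i * e i t).

Section Arrangement.
Variables (K : numFieldType) (n k : nat).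
(* b j i is the coefficient of t_i in g_j *)
Variables (b : 'M[K]_(n, k)) (a : 'I_n -> K).

Implicit Types z : 'rV[K]_n.

Definition glin (j : 'I_n) (t : 'rV[K]_k) : K := \sum_(i < k) b j i * t 0 i.

Definition faff (j : 'I_n) (z : 'rV[K]_n) (t : 'rV[K]_k) : K := z 0 j + glin j t.

Definition in_complement z (t : 'rV[K]_k) : bool := [forall j, faff j z t != 0].

(* The family (g_j), j in s, is linearly independent; linear functions are
   represented by their coefficients. *)
Definition indep_family (s : seq 'I_n) : bool := free [seq row j b | j <- s].

Definition is_circuit (C : {set 'I_n}) : bool :=
  ~~ indep_family (enum C) &&
  [forall D : {set 'I_n}, (D \proper C) ==> indep_family (enum D)].

Definition circuit_relations (lam : {set 'I_n} -> 'I_n -> K) : Prop :=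
  forall C : {set 'I_n}, is_circuit C ->
    (exists2 i, i \in C & lam C i != 0) /\
    (forall t, \sum_(i in C) lam C i * glin i t = 0).

Definition discriminant (lam : {set 'I_n} -> 'I_n -> K) : set 'rV[K]_n :=
  [set z | exists2 C : {set 'I_n}, is_circuit C &
             \sum_(i in C) lam C i * z 0 i = 0].

(* The partial derivative in t_i of every local branch of the multivalued
   master function sum_j a_j log f_j(z, t), computed with
   d(log f_j) = d f_j / f_j. *)
Definition dmaster z (i : 'I_k) (t : 'rV[K]_k) : K :=
  \sum_(j < n) a j * ('D_(delta_mx 0 i) (faff j z) t / faff j z t).

Definition critical z (t : 'rV[K]_k) : Prop :=
  in_complement z t /\ forall i, dmaster z i t = 0.

Definition isolated_critical z (p : 'rV[K]_k) : Prop :=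
  critical z p /\ \forall t \near p, critical z t -> t = p.

(* Representatives of the germs at p of holomorphic functions. *)
Definition holomorphic_at (p : 'rV[K]_k) : set ('rV[K]_k -> K) :=
  [set h | \forall t \near p, differentiable h t].

(* Representatives of the germs in the ideal generated by the partial
   derivatives; as the equality is only required near p, representatives of
   the zero germ belong to it. *)
Definition critical_ideal z (p : 'rV[K]_k) : set ('rV[K]_k -> K) :=
  [set h | exists2 u : 'I_k -> 'rV[K]_k -> K, forall i, holomorphic_at p (u i) &
             \forall t \near p, h t = \sum_(i < k) u i t * dmaster z i t].

Definition has_milnor_number z (p : 'rV[K]_k) (mu : nat) : Prop :=
  has_quotient_dim (holomorphic_at p) (critical_ideal z p) mu.

(* p-forms on the complement: values at a point and p vectors, the rows of a
   p x k matrix. *)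
Definition form z (p : nat) : Type :=
  {t : 'rV[K]_k | in_complement z t} -> 'M[K]_(p, k) -> K.

(* Exterior product of a 1-form and a (p - 1)-form, for p > 0. *)
Definition wedge1 z (p : nat) (al : form z 1) (be : form z p.-1) : form z p :=
  fun t v => \sum_(i < p) (-1) ^+ i * al t (row i v) * be t (row' i v).

Fixpoint wedge z (p : nat) : ('I_p -> form z 1) -> form z p :=
  match p with
  | 0 => fun _ _ _ => 1
  | p'.+1 => fun w => @wedge1 z p'.+1 (w ord0) (wedge (fun i : 'I_p' => w (lift ord0 i)))
  end.

(* dg_j is the constant 1-form v |-> g_j(v) *)
Definition omega z (j : 'I_n) : form z 1 := fun t v => glin j v / faff j z (val t).

Arguments omega : clear implicits.

Definition omega_wedge z (p : nat) (s : p.-tuple 'I_n) : form z p :=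
  wedge (fun i => omega z (tnth s i)).

Definition OS z (p : nat) : set (form z p) :=
  [set w : form z p | exists c : p.-tuple 'I_n -> K,
             w = fun t v => \sum_s c s * omega_wedge s t v].

Arguments OS : clear implicits.

Definition nu z : form z 1 := fun t v => \sum_(j < n) a j * omega z j t v.

Arguments nu : clear implicits.

Definition is_indep (s : k.-tuple 'I_n) : bool :=
  sorted ltn [seq val j | j <- s] && indep_family s.

(* The independent k-subsets {j_1 < ... < j_k}, listed increasingly. *)
Definition indep_set : Type := {s : k.-tuple 'I_n | is_indep s}.

(* V in the basis F(H_{j_1}, ..., H_{j_k}): x I is the coordinate of x on the
   basis vector of I. *)
Definition spaceV : vectType K := {ffun indep_set -> K^o}.

Definition dualV : vectType K := 'Hom(spaceV, K^o).

(* The annihilator in V of nu /\ OS^{k-1}(z), where sum_I c_I omega_I(z) in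
   OS^k(z) pairs with x to sum_I c_I x_I. *)
Definition sing_set z : set spaceV :=
  [set x : spaceV | forall eta, OS z k.-1 eta ->
           forall c : indep_set -> K,
             wedge1 (nu z) eta =
               (fun t v => \sum_(I : indep_set) c I * omega_wedge (val I) t v) ->
             \sum_(I : indep_set) c I * x I = 0].

Definition SingV z : {vspace spaceV} := vspace_of (sing_set z).

Lemma mem_SingV z x : x \in SingV z <-> sing_set z x.
Proof.
apply: mem_vspace_of => [eta _ c _|c0 u v Su Sv eta He c Hc].
  by rewrite big1 // => I _; rewrite ffunE mulr0.
transitivity (c0 * (\sum_I c I * u I) + \sum_I c I * v I); last first.
  by rewrite (Su _ He _ Hc) (Sv _ He _ Hc) mulr0 addr0.
rewrite mulr_sumr -big_split/=; apply: eq_bigr => I _.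
by rewrite !ffunE /GRing.scale/= mulrDr mulrCA.
Qed.

Definition contravariant (x y : spaceV) : K :=
  \sum_(I : indep_set) (\prod_(i < k) a (tnth (val I) i)) * (x I * y I).

Definition flat (x : spaceV) : dualV := linfun (contravariant x : spaceV -> K^o).

Lemma contravariantC x y : contravariant x y = contravariant y x.
Proof. by apply: eq_bigr => I _; rewrite (mulrC (x I)). Qed.

Lemma contravariant_linear x : linear (contravariant x : spaceV -> K^o).
Proof.
move=> c y z; rewrite /contravariant /GRing.scale/= mulr_sumr -big_split/=.
apply: eq_bigr => I _; rewrite !ffunE /GRing.scale/=.
by rewrite !mulrDr (mulrCA (x I)) (mulrCA _ c).
Qed.

Lemma flatE x y : flat x y = contravariant x y.
Proof.
pose h := GRing.isLinear.Build _ _ _ _ _ (contravariant_linear x).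
pose L : {linear spaceV -> K^o} := HB.pack (contravariant x : spaceV -> K^o) h.
exact: (lfunE L y).
Qed.

Lemma flat_linear : linear flat.
Proof.
move=> c x y; apply/lfunP => v; rewrite add_lfunE scale_lfunE !flatE.
by rewrite !(contravariantC _ v) contravariant_linear.
Qed.

Definition flat_lin : 'Hom(spaceV, dualV) := linfun flat.

Lemma flat_linE x : flat_lin x = flat x.
Proof.
pose h := GRing.isLinear.Build _ _ _ _ _ flat_linear.
pose L : {linear spaceV -> dualV} := HB.pack flat h.
exact: (lfunE L x).
Qed.

Definition spaceW : {vspace dualV} := limg flat_lin.

Definition SingW z : {vspace dualV} := (flat_lin @: SingV z)%VS.

(* The form induced on W, see [contravariantWE]. *)
Definition contravariantW (phi psi : dualV) : K :=
  contravariant ((flat_lin^-1)%VF phi) ((flat_lin^-1)%VF psi).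

Lemma contravariantWE x y :
  contravariantW (flat_lin x) (flat_lin y) = contravariant x y.
Proof.
have E u v : contravariant ((flat_lin^-1)%VF (flat_lin u)) v = contravariant u v.
  by rewrite -!flatE -!flat_linE limg_lfunVK// memv_img ?memvf.
by rewrite /contravariantW E contravariantC E contravariantC.
Qed.

End Arrangement.

Arguments omega {K n k} b z j _ _.
Arguments OS {K n k} b z p _.
Arguments nu {K n k} b a z _ _.
Arguments indep_set {K n k} b.
Arguments sing_set {K n k} b a z _.
Arguments SingV {K n k} b a z.
Arguments SingW {K n k} b a z.
Arguments contravariant {K n k} b a x y.
Arguments contravariantW {K n k} b a phi psi.

(* Main.v *)
From HB Require Import structures.
Require Import Defs.
From mathcomp Require Import all_boot all_order all_algebra complex.
From mathcomp Require Import all_classical all_reals all_analysis.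
From mathcomp Require Import perm.
From mathcomp Require Import ring lra.

Set Implicit Arguments.
Unset Strict Implicit.
Unset Printing Implicit Defensive.

Import Order.TTheory GRing.Theory Num.Theory.
Import numFieldNormedType.Exports.
Local Open Scope classical_set_scope.
Local Open Scope ring_scope.
Local Open Scope complex_scope.

(** The inequality expresses a duality for the algebras of functions on the
critical points.

Write y_j = 1 / f_j, let phi_i be the partial derivatives of the master
function, and for an independent k-subset I let eps_I be det(b_I) times the
product of the y_j, j in I, so that omega_I = eps_I dt_1 ... dt_k. Since nu is
the sum of the phi_i dt_i, every form in nu /\ OS^(k-1) is a combination of the
phi_i times dt_1 ... dt_k. So a linear functional ell on the quotient O_p / J_p
of the germs at a critical point p by the ideal of the phi_i defines the vector
(ell(eps_I))_I of Sing V ([functional_Sing]). The coordinate functionals of all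
these quotients give as many vectors as the sum of the Milnor numbers. The rank
of the form on Sing W bounds the rank of every Gram matrix of vectors of Sing V
([contravariant_gram_rank]), so it is enough that the Gram matrix of these
vectors is invertible.

The form is encoded by B(s, t), the sum of a_I eps_I(s) eps_I(t): the product of
the vectors of ell and ell' is ell' applied to t |-> ell(B(., t)). By the formula
of Cauchy and Binet ([cauchy_binet_gram]) B(s, t) is the determinant of the matrix
M(s, t) with entries the sums over m of a_m b_mj b_ml y_m(s) y_m(t), and
phi_j(s) - phi_j(t) is the sum over l of M_jl(s, t) (t_l - s_l)
([bez_diff]). By Cramer's rule (s_l - t_l) B(s, t) is in the ideal of the phi_j(s)
and the phi_j(t). Let ell be a nonzero sum of functionals at the critical points
whose vector is orthogonal to all these vectors; then t |-> ell(B(., t)) is in J at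
every critical point, and therefore so is t |-> ell(h B(., t)) for every
polynomial h ([bez_linprod]). For a suitable h, a cutoff times a generator of a
socle, ell(h .) is a nonzero multiple of the evaluation at one critical point p
([socle_product], [cutoff]), so that det M(p, .) is in J_p. But -M(p, .)
is a matrix that expresses the phi_j through the coordinates at p, and when J_p
contains a power of the maximal ideal the determinant of such a matrix is not in
J_p ([transition_det_notin]).

That J_p contains a power of the maximal ideal ([max_ideal_pow]), hence also that
the Milnor numbers exist, holds because modulo J_p the products of the y_j over
the bases of linear forms span a space that is stable under multiplication by
each y_j. This is where z is required to avoid the discriminant.

All of this takes place in rings of germs of functions that are assumed to be
complex differentiable near a point. What is needed about them is the division of
h(t) - h(t with t_i replaced by p_i) by t_i - p_i with a holomorphic quotient
([divide_coord]), which comes from Cauchy's formula. In the proof of that formula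
integrals over segments and circles are Banach limits of finite sums:
Goursat's subdivision of triangles gives primitives, and telescoping sums over
roots of unity show that derivatives have mean 0 on circles. *)

(** * Absolute values and Banach limits *)

Import ComplexField.Normc.

Section ComplexNorm.
Variable R : realType.
Local Notation C := R[i].
Implicit Types (x y z : C) (e : R).

(** The norm of R[i] takes its values in R[i]; this is the same norm with values
in R, for estimates in an archimedean totally ordered field. *)
Definition nm (z : C) : R := normc z.

Lemma nmE z : `|z| = (nm z)%:C. Proof. by []. Qed.

Lemma nm_ge0 z : 0 <= nm z. Proof. by case: z => a c; rewrite /nm sqrtr_ge0. Qed.

Lemma nm0 : nm 0 = 0. Proof. exact: normc0. Qed.
Lemma nm1 : nm 1 = 1. Proof. exact: normc1. Qed.
Lemma nmM x y : nm (x * y) = nm x * nm y. Proof. exact: normcM. Qed.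
Lemma nmN x : nm (- x) = nm x. Proof. exact: normcN. Qed.
Lemma nmV x : nm x^-1 = (nm x)^-1. Proof. exact: normcV. Qed.
Lemma nmD x y : nm (x + y) <= nm x + nm y. Proof. exact: le_normcD. Qed.
Lemma nmB x y : nm (x - y) <= nm x + nm y.
Proof. by rewrite -(nmN y); exact: nmD. Qed.
Lemma nmBC x y : nm (x - y) = nm (y - x).
Proof. by rewrite -nmN opprB. Qed.

Lemma nmX x n : nm (x ^+ n) = nm x ^+ n.
Proof. by elim: n => [|n IH]; rewrite ?expr0 ?nm1// !exprS nmM IH. Qed.

Lemma nm_eq0 x : (nm x == 0) = (x == 0).
Proof. by apply/eqP/eqP => [/eq0_normc|->]; rewrite ?nm0. Qed.

Lemma nm_gt0 x : (0 < nm x) = (x != 0).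
Proof. by rewrite lt_def nm_ge0 andbT nm_eq0. Qed.

Lemma nm_real (r : R) : nm r%:C = `|r|.
Proof. by rewrite /nm/= expr0n/= addr0 sqrtr_sqr. Qed.

Lemma nm_nat n : nm n%:R = n%:R.
Proof.
by rewrite (_ : n%:R = (n%:R : R)%:C) ?nm_real ?ger0_norm ?rmorph_nat.
Qed.

Lemma nm_sum (I : Type) (r : seq I) (P : pred I) (F : I -> C) :
  nm (\sum_(i <- r | P i) F i) <= \sum_(i <- r | P i) nm (F i).
Proof.
elim/big_rec2: _ => [|i u v _ h]; first by rewrite nm0.
by apply: (le_trans (nmD _ _)); rewrite lerD2l.
Qed.

Lemma nm_le0 z : nm z <= 0 -> z = 0.
Proof. by move=> h; apply/eqP; rewrite -nm_eq0 eq_le h nm_ge0. Qed.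

Lemma nm_small z : (forall e, 0 < e -> nm z <= e) -> z = 0.
Proof.
move=> h; apply: nm_le0; apply/ler_addgt0Pr => e e0; rewrite add0r; exact: h.
Qed.

Lemma ReE_le z : `|complex.Re z| <= nm z.
Proof. by rewrite -lecR; exact: normc_ge_Re. Qed.

Lemma ImE_le z : `|complex.Im z| <= nm z.
Proof.
by case: z => a c; rewrite /nm/= -sqrtr_sqr ler_wsqrtr// lerDr sqr_ge0.
Qed.

End ComplexNorm.

Section BanachLimit.
Variable R : realType.
Local Notation C := R[i].

Definition bounded_seq (u : nat -> C) := exists B : R, forall n, nm (u n) <= B.

(** The limit along an ultrafilter finer than the filter of cofinite sets: a
bounded sequence lives in a compact segment, so this limit always exists, and
it is linear and monotone. *)
Lemma real_blim_exists : exists L : (nat -> R) -> R,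
  (forall u v c, (exists B : R, forall n, `|u n| <= B) ->
     (exists B : R, forall n, `|v n| <= B) ->
     L (fun n => u n + c * v n) = L u + c * L v) /\
  (forall u B, (exists A : R, forall n, `|u n| <= A) ->
     (exists N, forall n, (N <= n)%N -> u n <= B) -> L u <= B).
Proof.
have [G [GU sG]] := ultraFilterLemma (@eventually_filter : ProperFilter \oo).
have cvgG (u : nat -> R) : (exists B : R, forall n, `|u n| <= B) -> cvg (u @ G).
  move=> [B hB]; have := @segment_compact R (- B) B; rewrite compact_ultra.
  move=> /(_ (u @ G) _ _)[||x [_ ux]]; last by apply/cvg_ex; exists x.
    apply: Build_UltraFilter => H PH sGH; rewrite predeqE => A; split=> [HA|]; last exact: sGH.
    have [//|nA] := in_ultra_setVsetC (u @^-1` A) GU.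
    have [x [Ax]] := filter_ex (filterI HA (sGH _ (nA : (u @ G) (~` A)))).
    by move/(_ Ax).
  by apply: (@filterS _ G _ setT) => [n _ /=|]; [rewrite in_itv/= -ler_norml; exact: hB|exact: filterT].
exists (fun u => lim (u @ G)); split => [u v c /cvgG bu /cvgG bv|u B /cvgG bu [N hN]].
  apply: cvg_lim => //; apply: cvgD => //; exact: cvgMr.
apply: limr_le => //; apply: sG; exists N => // n /= Nn; exact: hN.
Qed.

End BanachLimit.

Lemma blim_exists (R : realType) : exists L : (nat -> R[i]) -> R[i],
  [/\ forall u v c, bounded_seq u -> bounded_seq v ->
        L (fun n => u n + c * v n) = L u + c * L v,
      forall u B, bounded_seq u ->
        (exists N, forall n, (N <= n)%N -> nm (u n) <= B) -> nm (L u) <= B &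
      L (fun=> 1) = 1].
Proof.
have [L [Llin Lle]] := real_blim_exists R.
have bre u : bounded_seq u -> exists B : R, forall n, `|complex.Re (u n)| <= B.
  by move=> [B hB]; exists B => n; apply: le_trans (ReE_le _) (hB n).
have bim u : bounded_seq u -> exists B : R, forall n, `|complex.Im (u n)| <= B.
  by move=> [B hB]; exists B => n; apply: le_trans (ImE_le _) (hB n).
have bdd0 : exists B : R, forall n : nat, `|0 : R| <= B by exists 0 => n; rewrite normr0.
have L0 : L (fun=> 0) = 0.
  have := Llin (fun=> 0) (fun=> 0) (-1) bdd0 bdd0.
  by rewrite !mulN1r !subrr.
have bdd1 : exists B : R, forall n : nat, `|1 : R| <= B by exists 1 => n; rewrite normr1.
have L1 : L (fun=> 1) = 1.
  apply/eqP; rewrite eq_le; apply/andP; split; first by apply: Lle => //; exists 0%N.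
  have : L (fun=> 0 + (-1) * 1) <= -1.
    apply: Lle; last by exists 0%N => n _; rewrite add0r mulN1r.
    by exists 1 => n; rewrite add0r mulN1r normrN1.
  by rewrite Llin// L0 add0r mulN1r lerN2.
have bscale u c : (exists B : R, forall n, `|u n| <= B) ->
   (exists B : R, forall n, `|c * u n| <= B).
  by move=> [B hB]; exists (`|c| * B) => n; rewrite normrM ler_wpM2l.
have badd (u v : nat -> R) c : (exists B : R, forall n, `|u n| <= B) ->
   (exists B : R, forall n, `|v n| <= B) -> exists B : R, forall n, `|u n + c * v n| <= B.
  move=> [B1 h1] /(bscale _ _ c)[B2 h2]; exists (B1 + B2) => n.
  by apply: (le_trans (ler_normD _ _)); rewrite lerD.
pose LC (u : nat -> R[i]) := (L (fun n => complex.Re (u n)) +i* L (fun n => complex.Im (u n)))%C.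
have LClin u v c : bounded_seq u -> bounded_seq v ->
        LC (fun n => u n + c * v n) = LC u + c * LC v.
  move=> bu bv; case: c => c1 c2; rewrite /LC/=; simpc; congr (_ +i* _)%C.
    transitivity (L (fun n => (complex.Re (u n) + c1 * complex.Re (v n)) + (- c2) * complex.Im (v n))).
      congr L; apply/funext => n; case: (u n) (v n) => [x y] [x' y']/=; ring.
    rewrite Llin; [|exact: badd (bre _ bu) (bre _ bv)|exact: bim].
    rewrite Llin; [|exact: bre|exact: bre]; ring.
  transitivity (L (fun n => (complex.Im (u n) + c1 * complex.Im (v n)) + c2 * complex.Re (v n))).
    congr L; apply/funext => n; case: (u n) (v n) => [x y] [x' y']/=; ring.
  rewrite Llin; [|exact: badd (bim _ bu) (bim _ bv)|exact: bre].
  rewrite Llin; [|exact: bim|exact: bim]; ring.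
exists LC; split => //; last by rewrite /LC/= L0 L1.
move=> u B bu [N hN].
have hRe v D : bounded_seq v -> (exists N, forall n, (N <= n)%N -> nm (v n) <= D) ->
    complex.Re (LC v) <= D.
  move=> bv [N' hN']; apply: Lle; first exact: bre.
  by exists N' => n Nn; apply: le_trans (hN' n Nn); apply: le_trans (ReE_le _); exact: ler_norm.
case: (eqVneq (LC u) 0) => [->|Lu0].
  by rewrite nm0; apply: le_trans (nm_ge0 _) (hN N (leqnn N)).
(* rotate the limit onto the positive real axis *)
pose w := (LC u)^-1 * (nm (LC u))%:C.
have b0 : bounded_seq (fun=> 0 : R[i]) by exists 0 => n; rewrite nm0.
have nw : nm w = 1.
  by rewrite nmM nmV nm_real ger0_norm ?nm_ge0// mulVf// nm_eq0.
have LC0 : LC (fun=> 0) = 0 by rewrite /LC/= L0.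
have Lw : LC (fun n => 0 + w * u n) = (nm (LC u))%:C.
  by rewrite LClin// LC0 add0r /w -mulrA mulrC -mulrA divff// mulr1.
have := hRe (fun n => 0 + w * u n) B; rewrite Lw/=; apply.
  by case: bu => D hD; exists D => n; rewrite add0r nmM nw mul1r.
by exists N => n Nn; rewrite add0r nmM nw mul1r; exact: hN.
Qed.

Section BanachLimitTheory.
Variable R : realType.
Local Notation C := R[i].
Implicit Types (u v : nat -> C).

(** A generalized limit that needs no convergence proof. It plays the role of
integration: integrals are the Banach limits of their Riemann sums. *)
Definition blim u : C := sval (cid (blim_exists R)) u.

Lemma blim_lin u v c : bounded_seq u -> bounded_seq v ->
  blim (fun n => u n + c * v n) = blim u + c * blim v.
Proof. by have [h _ _] := svalP (cid (blim_exists R)) => bu bv; exact: h. Qed.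

Lemma blim_le u B : bounded_seq u ->
  (exists N, forall n, (N <= n)%N -> nm (u n) <= B) -> nm (blim u) <= B.
Proof. by have [_ h _] := svalP (cid (blim_exists R)) => bu; exact: h. Qed.

Lemma bounded_cst (c : C) : bounded_seq (fun=> c).
Proof. by exists (nm c). Qed.

Lemma bounded_lin u v c : bounded_seq u -> bounded_seq v ->
  bounded_seq (fun n => u n + c * v n).
Proof.
move=> [B hB] [D hD]; exists (B + nm c * D) => n.
by apply: (le_trans (nmD _ _)); rewrite lerD// nmM ler_wpM2l ?nm_ge0.
Qed.

Lemma blim_cst (c : C) : blim (fun=> c) = c.
Proof.
have b0 := blim_lin (-1) (bounded_cst 0) (bounded_cst 0).
have z0 : blim (fun=> 0) = 0 by move: b0; rewrite !mulN1r !subrr.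
have := blim_lin c (bounded_cst 0) (bounded_cst 1).
rewrite add0r mulr1 z0 add0r => ->.
by have [_ _ h1] := svalP (cid (blim_exists R)); rewrite /blim h1 mulr1.
Qed.

Lemma blimB u v : bounded_seq u -> bounded_seq v ->
  blim (fun n => u n - v n) = blim u - blim v.
Proof.
move=> bu bv; rewrite -mulN1r -blim_lin//; congr blim.
by apply/funext => n; rewrite mulN1r.
Qed.

Lemma blim_near u c B : bounded_seq u ->
  (exists N, forall n, (N <= n)%N -> nm (u n - c) <= B) -> nm (blim u - c) <= B.
Proof.
move=> bu h; rewrite -{1}(blim_cst c) -blimB//; last exact: bounded_cst.
apply: blim_le => //; have := bounded_lin (-1) bu (bounded_cst c).
by under eq_fun do rewrite mulN1r.
Qed.

Lemma blim_eq u c :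
  bounded_seq u -> (forall e, 0 < e -> exists N, forall n, (N <= n)%N -> nm (u n - c) <= e) ->
  blim u = c.
Proof.
move=> bu h; apply/eqP; rewrite -subr_eq0; apply/eqP/nm_small => e e0.
by apply: blim_near => //; exact: h.
Qed.

End BanachLimitTheory.

(** * Goursat's theorem and primitives *)

Section Goursat.
Variable R : realType.
Local Notation C := R[i].
Implicit Types (f g : C -> C) (a b c z w : C) (e r rho M : R).

Definition hasder f z c := forall e, 0 < e -> exists2 d : R, 0 < d &
  forall w, nm (w - z) <= d -> nm (f w - f z - c * (w - z)) <= e * nm (w - z).

Definition mid a b : C := (a + b) / 2%:R.

(** Midpoint sums over the segment from a to b cut in 2 ^ n pieces. Splitting
at the midpoint first makes the sums over a triangle additive for the
subdivision of [tsumS]. *)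
Fixpoint rsum f n a b : C :=
  if n is n'.+1 then rsum f n' a (mid a b) + rsum f n' (mid a b) b
  else (b - a) * f (mid a b).

Lemma midC a b : mid a b = mid b a. Proof. by rewrite /mid addrC. Qed.

Lemma rsum_anti f n a b : rsum f n b a = - rsum f n a b.
Proof.
elim: n a b => [|n IH] a b /=; first by rewrite midC -mulNr opprB.
by rewrite (midC b a) (IH (mid a b) b) (IH a (mid a b)) opprD addrC.
Qed.

Lemma rsumB f g n a b : rsum (fun z => f z - g z) n a b = rsum f n a b - rsum g n a b.
Proof. by elim: n a b => [|n IH] a b /=; rewrite ?mulrBr// !IH; ring. Qed.

(** The midpoint rule is exact on affine functions, without any limit. *)
Lemma rsum_affine n a b c0 c1 :
  rsum (fun z => c0 + c1 * z) n a b = c0 * (b - a) + c1 * (b ^+ 2 - a ^+ 2) / 2%:R.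
Proof.
elim: n a b => [|n IH] a b /=; rewrite ?IH /mid.
  by field.
by field.
Qed.

Lemma mid_sub a b w : mid a b - w = mid (a - w) (b - w).
Proof. by rewrite /mid; field. Qed.

Lemma nm_half z : nm (z / 2%:R) = nm z / 2.
Proof. by rewrite nmM nmV nm_nat. Qed.

Lemma nm_mid a b r : nm a <= r -> nm b <= r -> nm (mid a b) <= r.
Proof. by rewrite /mid nm_half => ha hb; have := nmD a b; lra. Qed.

Lemma nm_mid_lt a b r : nm a < r -> nm b < r -> nm (mid a b) < r.
Proof. by rewrite /mid nm_half => ha hb; have := nmD a b; lra. Qed.

Definition midconvex (P : C -> Prop) := forall x y, P x -> P y -> P (mid x y).

Lemma midconvex_disc w r : midconvex (fun z => nm (z - w) <= r).
Proof. by move=> x y hx hy; rewrite mid_sub nm_mid. Qed.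

Lemma rsum_bound (P : C -> Prop) f n a b (B : R) : midconvex P ->
  (forall z, P z -> nm (f z) <= B) -> P a -> P b -> nm (rsum f n a b) <= B * nm (b - a).
Proof.
move=> cP hf; elim: n a b => [|n IH] a b Pa Pb /=.
  by rewrite nmM mulrC ler_wpM2r ?nm_ge0// hf//; exact: cP.
have Pc := cP _ _ Pa Pb.
apply: (le_trans (nmD _ _)); apply: (le_trans (lerD (IH _ _ Pa Pc) (IH _ _ Pc Pb))).
have -> : mid a b - a = (b - a) / 2%:R by rewrite /mid; field.
have -> : b - mid a b = (b - a) / 2%:R by rewrite /mid; field.
rewrite nm_half; lra.
Qed.

Definition tsum f n a b c := rsum f n a b + rsum f n b c + rsum f n c a.

(** The subdivision by the midpoints of the edges: the sums along the inner
edges cancel. *)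
Lemma tsumS f n a b c : tsum f n.+1 a b c =
  tsum f n a (mid a b) (mid c a) + tsum f n (mid a b) b (mid b c) +
  tsum f n (mid c a) (mid b c) c + tsum f n (mid b c) (mid c a) (mid a b).
Proof.
rewrite /tsum /=.
rewrite (rsum_anti f n (mid a b) (mid c a)) (rsum_anti f n (mid b c) (mid a b)).
rewrite (rsum_anti f n (mid c a) (mid b c)); ring.
Qed.

Lemma tsum_affine f n a b c c0 c1 :
  tsum f n a b c = tsum (fun z => f z - (c0 + c1 * z)) n a b c.
Proof. rewrite /tsum !rsumB !rsum_affine; ring. Qed.

Lemma tsum_bound (P : C -> Prop) f n a b c (B : R) : midconvex P ->
  (forall z, P z -> nm (f z) <= B) -> P a -> P b -> P c ->
  nm (tsum f n a b c) <= B * (nm (b - a) + nm (c - b) + nm (a - c)).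
Proof.
move=> cP hf Pa Pb Pc; apply: (le_trans (nmD _ _)).
rewrite mulrDr; apply: lerD; last exact: (rsum_bound n cP).
apply: (le_trans (nmD _ _)); rewrite mulrDr.
by apply: lerD; exact: (rsum_bound n cP).
Qed.

(** Sums are only asked to be eventually small, as no limit of them is
known to exist. *)
Definition small f a b c e :=
  exists N, forall n, (N <= n)%N -> nm (tsum f n a b c) <= e.

Definition triangle_in rho s a b c := [/\ nm a <= rho, nm b <= rho & nm c <= rho] /\
  [/\ nm (b - a) <= s, nm (c - b) <= s & nm (a - c) <= s].

(** If the sums over all four pieces were eventually at most e / 4, then the
ones over the whole triangle would be eventually at most e, by [tsumS]. *)
Lemma goursat_step f rho s e a b c :
  triangle_in rho s a b c -> ~ small f a b c e ->
  exists x : C * C * C, [/\ triangle_in rho (s / 2) x.1.1 x.1.2 x.2,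
    ~ small f x.1.1 x.1.2 x.2 (e / 4) & nm (x.1.1 - a) <= s].
Proof.
move=> [[ha hb hc] [hab hbc hca]] ns; apply: contrapT => nex.
have mab : nm (mid a b) <= rho by exact: nm_mid.
have mbc : nm (mid b c) <= rho by exact: nm_mid.
have mca : nm (mid c a) <= rho by exact: nm_mid.
have s0 : 0 <= s by apply: le_trans hab; exact: nm_ge0.
have E1 : mid a b - a = (b - a) / 2%:R by rewrite /mid; field.
have E2 : mid c a - mid a b = (c - b) / 2%:R by rewrite /mid; field.
have E3 : a - mid c a = (a - c) / 2%:R by rewrite /mid; field.
have E4 : b - mid a b = (b - a) / 2%:R by rewrite /mid; field.
have E5 : mid b c - b = (c - b) / 2%:R by rewrite /mid; field.
have E6 : mid a b - mid b c = (a - c) / 2%:R by rewrite /mid; field.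
have E7 : mid b c - mid c a = (b - a) / 2%:R by rewrite /mid; field.
have E8 : c - mid b c = (c - b) / 2%:R by rewrite /mid; field.
have E9 : mid c a - c = (a - c) / 2%:R by rewrite /mid; field.
have N7 : nm (mid c a - mid b c) <= s / 2 by rewrite nmBC E7 nm_half; lra.
have N2 : nm (mid a b - mid c a) <= s / 2 by rewrite nmBC E2 nm_half; lra.
have N6 : nm (mid b c - mid a b) <= s / 2 by rewrite nmBC E6 nm_half; lra.
have sub x y z : [/\ nm x <= rho, nm y <= rho & nm z <= rho] ->
    [/\ nm (y - x) <= s / 2, nm (z - y) <= s / 2 & nm (x - z) <= s / 2] ->
    nm (x - a) <= s -> small f x y z (e / 4).
  by move=> h1 h2 h3; apply: contrapT => h4; apply: nex; exists (x, y, z).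
have [|||N1 h1] := sub a (mid a b) (mid c a) _ _ _.
- by split.
- by rewrite E1 E2 E3 !nm_half; split; lra.
- by rewrite subrr nm0.
have [|||N2' h2] := sub (mid a b) b (mid b c) _ _ _.
- by split.
- by rewrite E4 E5 E6 !nm_half; split; lra.
- by rewrite E1 nm_half; lra.
have [|||N3 h3] := sub (mid c a) (mid b c) c _ _ _.
- by split.
- by rewrite E7 E8 E9 !nm_half; split; lra.
- by rewrite nmBC E3 nm_half; lra.
have [|||N4 h4] := sub (mid b c) (mid c a) (mid a b) _ _ _.
- by split.
- by split.
- have -> : mid b c - a = (mid b c - mid a b) + (mid a b - a) by ring.
  by apply: (le_trans (nmD _ _)); rewrite E1 nm_half; lra.
apply: ns; exists (maxn (maxn N1 N2') (maxn N3 N4)).+1 => -[//|n].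
rewrite ltnS !geq_max => /andP[/andP[n1 n2] /andP[n3 n4]].
rewrite tsumS; have := h1 _ n1; have := h2 _ n2; have := h3 _ n3; have := h4 _ n4.
set t1 := tsum _ _ _ _ _; set t2 := tsum _ _ _ _ _.
set t3 := tsum _ _ _ _ _; set t4 := tsum _ _ _ _ _ => b1 b2 b3 b4.
apply: (le_trans (nmD _ _)); have := nmD (t4 + t3) t2; have := nmD t4 t3.
lra.
Qed.

Lemma half_pow_lt (x : R) : 0 < x -> exists j, (2^-1) ^+ j < x.
Proof.
move=> x0; exists (Num.bound x^-1); rewrite exprVn -[ltRHS]invrK ltf_pV2 ?posrE ?invr_gt0 ?exprn_gt0//.
exact: upper_nthrootP.
Qed.

(** Iterating [goursat_step] gives triangles that shrink to a point z. Near z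
the function is affine up to an error that is small compared with the size of
the triangle, affine functions contribute 0, and the sums are small compared
with the square of the size, a contradiction. The point z is the Banach limit
of the vertices. *)
Lemma goursat f rho a b c : (forall z, nm z <= rho -> exists c', hasder f z c') ->
  nm a <= rho -> nm b <= rho -> nm c <= rho -> forall e, 0 < e -> small f a b c e.
Proof.
move=> hf ha hb hc e e0; apply: contrapT => ns.
pose s := nm (b - a) + nm (c - b) + nm (a - c) + 1.
have p1 := nm_ge0 (b - a); have p2 := nm_ge0 (c - b); have p3 := nm_ge0 (a - c).
have s0 : 0 < s by rewrite /s; lra.
(* the sizes of the triangles decrease like q j, their sums like q j ^+ 2 *)
pose q j : R := (2^-1) ^+ j.
have q0 j : 0 < q j by rewrite exprn_gt0// invr_gt0.
have qS j : q j.+1 = q j / 2 by rewrite /q exprSr.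
pose P j (x : C * C * C) := triangle_in rho (s * q j) x.1.1 x.1.2 x.2 /\
  ~ small f x.1.1 x.1.2 x.2 (e * q j ^+ 2).
have /choice[nxt hnxt] : forall jx : nat * (C * C * C), exists y,
    P jx.1 jx.2 -> P jx.1.+1 y /\ nm (y.1.1 - jx.2.1.1) <= s * q jx.1.
  move=> [j x]/=; case: (pselect (P j x)) => [[h1 h2]|nP]; last by exists x.
  have [y [y1 y2 y3]] := goursat_step h1 h2; exists y => _; split=> //; split.
    by rewrite qS mulrA.
  by rewrite qS (_ : e * _ = e * q j ^+ 2 / 4)//; field.
pose D := fix D j := if j is j'.+1 then nxt (j', D j') else (a, b, c).
have DP j : P j (D j).
  elim: j => [|j IH]; last by have [] := hnxt (j, D j) IH.
  by split=> /=; rewrite /q expr0 ?expr1n !mulr1//; split; rewrite // /s; split; lra.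
have Dn j : nm ((D j.+1).1.1 - (D j).1.1) <= s * q j.
  by have [] := hnxt (j, D j) (DP j).
pose A j := (D j).1.1.
have Acauchy m i : nm (A (m + i)%N - A m) <= 2 * s * (q m - q (m + i)%N).
  elim: i => [|i IH]; first by rewrite addn0 !subrr nm0 mulr0.
  rewrite addnS (_ : A _ - A m = (A (m + i).+1 - A (m + i)%N) + (A (m + i)%N - A m)); last by ring.
  apply: (le_trans (nmD _ _)); have := Dn (m + i)%N; rewrite -/(A _) -/(A _) qS.
  by move: IH; lra.
have bA : bounded_seq A by exists rho => j; have [[[]]] := DP j.
pose z := blim A.
have zA m : nm (z - A m) <= 2 * s * q m.
  apply: blim_near => //; exists m => n mn; rewrite -(subnKC mn).
  apply: (le_trans (Acauchy _ _)); rewrite ler_wpM2l ?mulr_ge0 ?ltW//.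
  by move: (q0 n); rewrite subnKC//; lra.
have hz : nm z <= rho by apply: blim_le => //; exists 0%N => j _; have [[[]]] := DP j.
have [c' hc'] := hf z hz.
have [d d0 hd] := hc' (e / (9 * s ^+ 2)) (divr_gt0 e0 (mulr_gt0 (ltr0Sn R 8) (exprn_gt0 2 s0))).
have [j hj] := half_pow_lt (divr_gt0 d0 (mulr_gt0 (ltr0Sn R 2) s0)).
have hj' : 3 * s * q j <= d.
  by move: hj; rewrite ltr_pdivlMr ?mulr_gt0// => /ltW; rewrite mulrC.
have [[_ [t1 t2 t3]] nsj] := DP j; apply: nsj; exists 0%N => n _.
rewrite (tsum_affine _ _ _ _ _ (f z - c' * z) c').
have sq : 0 < s * q j by rewrite mulr_gt0.
have zA1 : nm ((D j).1.1 - z) <= 2 * s * q j by rewrite nmBC; exact: zA.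
apply: (le_trans (@tsum_bound (fun w => nm (w - z) <= 3 * s * q j) _ _ _ _ _
   (e / (9 * s ^+ 2) * (3 * s * q j)) (@midconvex_disc _ _) _ _ _ _)).
- move=> w hw; rewrite (_ : f w - _ = f w - f z - c' * (w - z)); last by ring.
  apply: (le_trans (hd w (le_trans hw hj'))); rewrite ler_wpM2l//.
  by rewrite ltW// divr_gt0// mulr_gt0// exprn_gt0.
- by move: zA1 sq; lra.
- rewrite (_ : _ - z = ((D j).1.2 - (D j).1.1) + ((D j).1.1 - z)); last by ring.
  by apply: (le_trans (nmD _ _)); move: zA1 sq t1; lra.
- rewrite (_ : _ - z = - ((D j).1.1 - (D j).2) + ((D j).1.1 - z)); last by ring.
  by apply: (le_trans (nmD _ _)); rewrite nmN; move: zA1 sq t3; lra.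
apply: (@le_trans _ _ (e / (9 * s ^+ 2) * (3 * s * q j) * (3 * s * q j))).
  rewrite ler_wpM2l//; last by move: t1 t2 t3; lra.
  by rewrite ltW// !mulr_gt0// invr_gt0 mulr_gt0// exprn_gt0.
by rewrite le_eqVlt; apply/orP; left; apply/eqP; field; rewrite gt_eqF.
Qed.

Lemma hasder_continuous f z c : hasder f z c ->
  forall e, 0 < e -> exists2 d : R, 0 < d & forall w, nm (w - z) <= d -> nm (f w - f z) <= e.
Proof.
move=> h e e0; have [d d0 hd] := h 1 ltr01.
have k0 : 0 < 1 + nm c by have := nm_ge0 c; lra.
exists (Num.min d (e / (1 + nm c))); first by rewrite lt_min d0 divr_gt0.
move=> w; rewrite le_min => /andP[w1 w2].
rewrite (_ : f w - f z = (f w - f z - c * (w - z)) + c * (w - z)); last by ring.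
apply: (le_trans (nmD _ _)); apply: (le_trans (lerD (hd w w1) (lexx _))).
by rewrite nmM -mulrDl mulrC -ler_pdivlMr.
Qed.

(** F z is the generalized integral of f from 0 to z. By [goursat] its increment
from z to z' is the integral over that segment. The first three conclusions are
quantitative: they allow applying the construction to F again, with a quadratic
remainder. *)
Lemma primitive f rho M : (forall z, nm z < rho -> exists c, hasder f z c) ->
  (forall z, nm z < rho -> nm (f z) <= M) ->
  exists F : C -> C,
  [/\ forall z z' e, nm z < rho -> nm z' < rho ->
        (forall w, nm (w - z) <= nm (z' - z) -> nm w < rho -> nm (f w - f z) <= e) ->
        nm (F z' - F z - f z * (z' - z)) <= e * nm (z' - z),
      forall z z', nm z < rho -> nm z' < rho -> nm (F z' - F z) <= M * nm (z' - z),
      forall z, nm z < rho -> nm (F z) <= M * nm z &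
      forall z, nm z < rho -> hasder F z (f z)].
Proof.
move=> hf hM; pose F z := blim (fun n => rsum f n 0 z).
have cd : midconvex (fun z => nm z < rho) by move=> x y; exact: nm_mid_lt.
have rb n a b : nm a < rho -> nm b < rho -> nm (rsum f n a b) <= M * nm (b - a).
  by move=> ha hb; exact: (rsum_bound n cd hM).
have bd a b : nm a < rho -> nm b < rho -> bounded_seq (fun n => rsum f n a b).
  by move=> ha hb; exists (M * nm (b - a)) => n; exact: rb.
have FB z z' : nm z < rho -> nm z' < rho -> F z' - F z = blim (fun n => rsum f n z z').
  move=> hz hz'; have h0 : nm (0 : C) < rho by rewrite nm0 (le_lt_trans (nm_ge0 z)).
  rewrite /F -blimB; [|exact: bd|exact: bd].
  apply/eqP; rewrite -subr_eq0 -blimB; last 2 first.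
  - have := bounded_lin (-1) (bd _ _ h0 hz') (bd _ _ h0 hz).
    by under eq_fun do rewrite mulN1r.
  - exact: bd.
  apply/eqP/blim_eq.
    have := bounded_lin (-1) (bounded_lin (-1) (bd _ _ h0 hz') (bd _ _ h0 hz)) (bd _ _ hz hz').
    by under eq_fun do rewrite !mulN1r.
  move=> e e0; have [||||N hN] := @goursat f (Num.max (nm z) (nm z')) 0 z z' _ _ _ _ e e0.
  - by move=> w hw; apply: hf; apply: le_lt_trans hw _; rewrite gt_max hz hz'.
  - by rewrite nm0 le_max nm_ge0.
  - by rewrite le_max lexx.
  - by rewrite le_max lexx orbT.
  exists N => n Nn; rewrite subr0 -nmN; have := hN n Nn; rewrite /tsum (rsum_anti f n 0 z').
  by congr (nm _ <= _); ring.
have H1 z z' e : nm z < rho -> nm z' < rho ->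
    (forall w, nm (w - z) <= nm (z' - z) -> nm w < rho -> nm (f w - f z) <= e) ->
    nm (F z' - F z - f z * (z' - z)) <= e * nm (z' - z).
  move=> hz hz' he; rewrite FB//; apply: blim_near; first exact: bd.
  exists 0%N => n _.
  have -> : f z * (z' - z) = rsum (fun w => f z + 0 * w) n z z' by rewrite rsum_affine; ring.
  rewrite -rsumB; apply: (@rsum_bound (fun w => nm (w - z) <= nm (z' - z) /\ nm w < rho)).
  - by move=> x y [x1 x2] [y1 y2]; split; [exact: midconvex_disc|exact: cd].
  - by move=> w [w1 w2]; rewrite mul0r addr0; exact: he.
  - by rewrite subrr nm0 nm_ge0.
  - by [].
exists F; split=> //.
- by move=> z z' hz hz'; rewrite FB//; apply: blim_le; [exact: bd|exists 0%N => n _; exact: rb].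
- move=> z hz; apply: blim_le; [apply: bd => //|exists 0%N => n _].
    by rewrite nm0 (le_lt_trans (nm_ge0 z)).
  by rewrite -{2}(subr0 z); apply: rb => //; rewrite nm0 (le_lt_trans (nm_ge0 z)).
move=> z hz e e0; have [c hc] := hf z hz; have [d d0 hd] := hasder_continuous hc e0.
exists (Num.min d ((rho - nm z) / 2)).
  by rewrite lt_min d0/= divr_gt0// subr_gt0.
move=> w; rewrite le_min => /andP[w1 w2]; apply: H1 => //.
  by have := nmD (w - z) z; rewrite subrK; move: w2 hz; lra.
by move=> w' hw' _; apply: hd; exact: le_trans w1.
Qed.

End Goursat.

(** * Mean values over the unit circle *)

Section CircleMean.
Variable R : realType.
Local Notation C := R[i].
Implicit Types (g h : C -> C) (z w : C) (e r M B : R).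

Lemma nm_sq z : nm z ^+ 2 = complex.Re z ^+ 2 + complex.Im z ^+ 2.
Proof. by case: z => a b; rewrite /nm/= sqr_sqrtr// addr_ge0// sqr_ge0. Qed.

Definition angle n : R := (pi *+ 2) / n.+2%:R.

Definition omega_ n : C := (cos (angle n) +i* sin (angle n))%C.

Lemma nm_omega n : nm (omega_ n) = 1.
Proof. by rewrite /nm/= cos2Dsin2 sqrtr1. Qed.

Lemma omega_pow n m :
  omega_ n ^+ m = (cos (m%:R * angle n) +i* sin (m%:R * angle n))%C.
Proof.
elim: m => [|m IH]; first by rewrite expr0 mul0r cos0 sin0.
rewrite exprS IH /omega_ -[in RHS]addn1 natrD mulrDl mul1r cosD sinD; simpc.
by congr (_ +i* _)%C; ring.
Qed.

Lemma nm_omega_pow n m : nm (omega_ n ^+ m) = 1.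
Proof. by rewrite nmX nm_omega expr1n. Qed.

Lemma omega_unity n : omega_ n ^+ n.+2 = 1.
Proof. by rewrite omega_pow /angle mulrC divfK ?pnatr_eq0// cos2pi sin2pi. Qed.

Lemma omega_neq1 n : omega_ n != 1.
Proof.
apply/eqP => /(congr1 (@complex.Re R))/=; apply/eqP; rewrite lt_eqF// -cos0.
have p0 := pi_gt0 R; have n2 : 2 <= n.+2%:R :> R by rewrite ler_nat.
have n0 : 0 < n.+2%:R :> R by rewrite ltr0n.
have a0 : 0 < angle n by rewrite divr_gt0// mulrn_wgt0.
rewrite ltr_cos// in_itv/= ?lexx ?(ltW p0)// (ltW a0)/= /angle ler_pdivrMr//.
by rewrite mulr2n; nra.
Qed.

(** The squared distance of a point of the circle to 1 is 2 - 2 cos, so the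
continuity of the cosine is enough. *)
Lemma omega_cvg e : 0 < e -> exists N, forall n, (N <= n)%N -> nm (omega_ n - 1) <= e.
Proof.
move=> e0; have /cvgrPdist_le := @continuous_cos R 0; rewrite cos0.
move=> /(_ (e ^+ 2 / 2) (divr_gt0 (exprn_gt0 2 e0) (ltr0Sn R 1))).
move=> /nbhs_ballP[d /= d0 hd].
exists (Num.bound (pi *+ 2 / d)) => n hn.
have p0 := pi_gt0 R.
have a0 : 0 < angle n by rewrite divr_gt0// mulrn_wgt0.
have ad : angle n < d.
  rewrite /angle ltr_pdivrMr// mulrC -ltr_pdivrMr//.
  have h1 := @archi_boundP R (pi *+ 2 / d) _.
  apply: (lt_le_trans (h1 _)); first by rewrite divr_ge0 ?(ltW d0)// mulrn_wge0// ltW.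
  by rewrite ler_nat (leq_trans hn)// -addn2 leq_addr.
have /hd : ball (0 : R) d (angle n).
  by rewrite -ball_normE/= sub0r normrN gtr0_norm.
move=> h; have {}h : `|1 - cos (angle n)| <= e ^+ 2 / 2 := h.
rewrite -[leLHS]/(nm (omega_ n - 1)).
rewrite -(@ler_pXn2r _ 2)// ?nnegrE ?nm_ge0 ?(ltW e0)// nm_sq/= subr0.
have c2 := cos2Dsin2 (angle n).
have := le_trans (ler_norm _) h.
nra.
Qed.

Definition cbdd g := exists B, forall z, nm z = 1 -> nm (g z) <= B.

Definition cavg g n : C := (\sum_(m < n.+2) g (omega_ n ^+ m)) / n.+2%:R.

(** The integral over the unit circle for the measure of mass 1, as the Banach
limit of the averages over the roots of unity of order n + 2. The shift avoids
the trivial root of unity. *)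
Definition cmean g : C := blim (cavg g).

Lemma cavg_le g B n : (forall z, nm z = 1 -> nm (g z) <= B) -> nm (cavg g n) <= B.
Proof.
move=> h; rewrite /cavg nmM nmV nm_nat ler_pdivrMr//.
apply: (le_trans (nm_sum _ _ _)).
apply: (@le_trans _ _ (\sum_(m < n.+2) B)).
  by apply: ler_sum => m _; apply: h; exact: nm_omega_pow.
by rewrite sumr_const card_ord mulr_natr.
Qed.

Lemma cavg_bdd g : cbdd g -> bounded_seq (cavg g).
Proof. by move=> [B hB]; exists B => n; exact: cavg_le. Qed.

Lemma cmean_lin g h c : cbdd g -> cbdd h ->
  cmean (fun z => g z + c * h z) = cmean g + c * cmean h.
Proof.
move=> /cavg_bdd bg /cavg_bdd bh; rewrite /cmean -blim_lin//; congr blim.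
by apply/funext => n; rewrite /cavg big_split/= -mulr_sumr mulrDl mulrA.
Qed.

Lemma cbdd_lin g h c : cbdd g -> cbdd h -> cbdd (fun z => g z + c * h z).
Proof.
move=> [B hB] [D hD]; exists (B + nm c * D) => z z1.
by apply: (le_trans (nmD _ _)); rewrite lerD ?nmM ?ler_wpM2l ?nm_ge0 ?hB ?hD.
Qed.

Lemma cmean_ext g h : (forall z, nm z = 1 -> g z = h z) -> cmean g = cmean h.
Proof.
move=> gh; congr blim; apply/funext => n; congr (_ / _); apply: eq_bigr => m _.
by apply: gh; exact: nm_omega_pow.
Qed.

Lemma cmean_le g B : (forall z, nm z = 1 -> nm (g z) <= B) -> nm (cmean g) <= B.
Proof.
move=> h; apply: blim_le; first by apply: cavg_bdd; exists B.
by exists 0%N => n _; exact: cavg_le.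
Qed.

Lemma cbdd_cst c : cbdd (fun=> c). Proof. by exists (nm c). Qed.

Lemma cmean_cst c : cmean (fun=> c) = c.
Proof.
rewrite -[RHS](blim_cst c); congr blim; apply/funext => n.
by rewrite /cavg sumr_const card_ord -[c *+ _]mulr_natr mulfK ?pnatr_eq0.
Qed.

Lemma cmean_scale g c : cbdd g -> cmean (fun z => c * g z) = c * cmean g.
Proof.
move=> bg; have := cmean_lin c (cbdd_cst 0) bg; rewrite cmean_cst add0r => <-.
by apply: cmean_ext => z _; rewrite add0r.
Qed.

Lemma cmeanB g h : cbdd g -> cbdd h -> cmean (fun z => g z - h z) = cmean g - cmean h.
Proof.
move=> bg bh; rewrite -mulN1r -cmean_lin//.
by apply: cmean_ext => z _; rewrite mulN1r.
Qed.

(** The mean of h(z) z is the integral of h(z) dz up to a factor, and it vanishes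
when h has a primitive g with a quadratic remainder: the increments of g along
the roots of unity telescope to 0, and differ from h(z) (w - 1) z by a multiple
of |w - 1| ^ 2, which is small even after division by w - 1. *)
Lemma cmean_exact g h M : 0 <= M -> cbdd h ->
  (forall z w, nm z = 1 -> nm w = 1 ->
     nm (g (w * z) - g z - h z * ((w - 1) * z)) <= M * nm (w - 1) ^+ 2) ->
  cmean (fun z => h z * z) = 0.
Proof.
move=> M0 bh hq; have bhz : cbdd (fun z => h z * z).
  by have [B hB] := bh; exists B => z z1; rewrite nmM z1 mulr1 hB.
apply: blim_eq; first exact: cavg_bdd.
move=> e e0.
have [N hN] := omega_cvg (divr_gt0 e0 (ltr_wpDl M0 ltr01)).
exists N => n Nn; rewrite subr0.
have w1 : omega_ n - 1 != 0 by rewrite subr_eq0 omega_neq1.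
have tele : \sum_(m < n.+2) (g (omega_ n * omega_ n ^+ m) - g (omega_ n ^+ m)) = 0.
  have := @telescope_sumr _ 0 n.+2 (fun m => g (omega_ n ^+ m)) (leq0n _).
  rewrite omega_unity expr0 subrr big_mkord => tl; rewrite -[RHS]tl.
  by apply: eq_bigr => m _; rewrite exprS.
have E : cavg (fun z => h z * z) n = - ((\sum_(m < n.+2) (g (omega_ n * omega_ n ^+ m) -
    g (omega_ n ^+ m) - h (omega_ n ^+ m) * ((omega_ n - 1) * omega_ n ^+ m))) / n.+2%:R / (omega_ n - 1)).
  rewrite sumrB tele sub0r !mulNr opprK /cavg mulrAC; congr (_ / _).
  by rewrite mulr_suml; apply: eq_bigr => m _; field.
have wp : 0 < nm (omega_ n - 1) by rewrite nm_gt0.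
rewrite E nmN 2!nmM !nmV nm_nat ler_pdivrMr// ler_pdivrMr//.
apply: (le_trans (nm_sum _ _ _)).
apply: (@le_trans _ _ (\sum_(m < n.+2) (M * nm (omega_ n - 1) ^+ 2))).
  by apply: ler_sum => m _; apply: hq; [exact: nm_omega_pow|exact: nm_omega].
rewrite sumr_const card_ord -[leLHS]mulr_natr ler_wpM2r// expr2 mulrA ler_wpM2r ?nm_ge0//.
have := hN n Nn; rewrite ler_pdivlMr; last by lra.
by move=> hh; apply: le_trans hh; rewrite mulrDr mulr1 mulrC lerDl nm_ge0.
Qed.

(** In N equal steps the total increment is at most N * (M / N ^ 2). *)
Lemma quad_cst (H : R -> C) M : (forall s t, 0 <= s <= 1 -> 0 <= t <= 1 ->
    nm (H t - H s) <= M * (t - s) ^+ 2) -> H 1 = H 0.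
Proof.
move=> hH; apply/eqP; rewrite -subr_eq0; apply/eqP/nm_small => e e0.
have M0 : 0 <= M.
  have := hH 0 1; rewrite subr0 expr1n mulr1 !lexx ler01 => /(_ isT isT).
  exact: le_trans (nm_ge0 _).
pose n := Num.bound (M / e).
have n0 : 0 < n.+1%:R :> R by rewrite ltr0n.
have hn : M / e < n.+1%:R.
  have h1 := @archi_boundP R (M / e) _.
  apply: (lt_le_trans (h1 _)); first by rewrite divr_ge0// ltW.
  by rewrite ler_nat.
have := @telescope_sumr _ 0 n.+1 (fun m => H (m%:R / n.+1%:R)) (leq0n _).
rewrite mul0r divff ?gt_eqF// => <-; rewrite big_mkord.
apply: (le_trans (nm_sum _ _ _)).
apply: (@le_trans _ _ (\sum_(m < n.+1) (M * (n.+1%:R)^-1 ^+ 2))).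
  apply: ler_sum => m _.
  have mb (j : nat) : (j <= n.+1)%N -> 0 <= (j%:R : R) / n.+1%:R <= 1.
    by move=> jn; rewrite divr_ge0//= ler_pdivrMr// mul1r ler_nat.
  apply: (le_trans (hH _ _ (mb _ (ltnW (ltn_ord m))) (mb _ (ltn_ord m)))).
  by rewrite -mulrBl -natrB// subSnn mul1r.
rewrite sumr_const card_ord -[leLHS]mulr_natr expr2 -!mulrA mulVf ?gt_eqF// mulr1.
by rewrite ler_pdivrMr// mulrC -ler_pdivrMr// ltW.
Qed.

End CircleMean.

(** * Cauchy's formula *)

Section Cauchy.
Variable R : realType.
Local Notation C := R[i].
Implicit Types (f g F G : C -> C) (z w c : C) (e r rho M B : R).

(** A uniform form of the equation G' = F. It is stable under taking means over
the circle, which pointwise differentiability is not. *)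
Definition quad G F M rho := forall z z', nm z < rho -> nm z' < rho ->
  nm (G z' - G z - F z * (z' - z)) <= M * nm (z' - z) ^+ 2.

Lemma nm_inv_le z e : 0 < e -> e <= nm z -> nm z^-1 <= e^-1.
Proof. by move=> e0 ez; rewrite nmV lef_pV2// posrE (lt_le_trans e0). Qed.

Lemma sqr_mul_le (a b B : R) : 0 <= a -> 0 <= b -> a <= B -> b <= B ->
  a ^+ 2 * b <= B ^+ 3.
Proof.
move=> a0 b0 aB bB; rewrite [leRHS]exprSr; apply: ler_pM; rewrite ?exprn_ge0//.
by rewrite ler_pXn2r ?nnegrE// (le_trans a0).
Qed.

Lemma nmB_ge z w : nm z - nm w <= nm (z - w).
Proof. by have := nmD (z - w) w; rewrite subrK lerBlDr. Qed.

Lemma nm_circle r z c : 0 < r -> nm z = 1 -> r - nm c <= nm (r%:C * z - c).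
Proof.
move=> r0 z1; apply: le_trans (nmB_ge _ _).
by rewrite nmM z1 nm_real gtr0_norm// mulr1.
Qed.

Lemma circle_neq0 r z c : nm c < r -> nm z = 1 -> r%:C * z - c != 0.
Proof.
move=> cr z1; have r0 : 0 < r by exact: le_lt_trans (nm_ge0 c) cr.
by rewrite -nm_gt0 (lt_le_trans _ (nm_circle c r0 z1))// subr_gt0.
Qed.

Lemma cmean_id : cmean (fun z : C => z) = 0.
Proof.
rewrite -[RHS](@cmean_exact R (fun z => z) (fun=> 1) 0 (lexx _) (cbdd_cst _)).
  by apply: cmean_ext => z _; rewrite mul1r.
by move=> z w _ _; rewrite mul0r (_ : _ - _ = 0) ?nm0//; ring.
Qed.

(** The double pole has the primitive - 1 / (r (r z - c)), and [cmean_exact]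
applies. *)
Lemma cmean_double_pole r c : nm c < r ->
  cmean (fun z => (r%:C * z - c) ^- 2 * z) = 0.
Proof.
move=> cr; have r0 : 0 < r by exact: le_lt_trans (nm_ge0 c) cr.
have d0 : 0 < r - nm c by rewrite subr_gt0.
have rC : r%:C != 0 :> C by rewrite -nm_gt0 nm_real gtr0_norm.
have hI z : nm z = 1 -> nm (r%:C * z - c)^-1 <= (r - nm c)^-1.
  by move=> z1; apply: nm_inv_le => //; exact: nm_circle.
apply: (@cmean_exact R (fun z => - (r%:C)^-1 * (r%:C * z - c)^-1) _ (r * (r - nm c)^-1 ^+ 3)).
- by rewrite mulr_ge0 ?exprn_ge0 ?invr_ge0 ?ltW.
- exists ((r - nm c)^-1 ^+ 2) => z z1; rewrite -exprVn nmX.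
  by rewrite ler_pXn2r ?nnegrE ?nm_ge0 ?invr_ge0 ?(ltW d0)// hI.
move=> z w z1 w1.
have n1 := circle_neq0 cr z1.
have wz : nm (w * z) = 1 by rewrite nmM w1 z1 mulr1.
have n2 := circle_neq0 cr wz.
rewrite (_ : _ - _ = - (r%:C * (w - 1) ^+ 2 * z ^+ 2 *
    ((r%:C * z - c)^-1 ^+ 2 * (r%:C * (w * z) - c)^-1))); last first.
  by field; rewrite n1 n2 rC.
rewrite nmN 3!nmM [nm (_ / _)]nmM !nmX z1 expr1n mulr1 nm_real gtr0_norm//.
have hXY : nm (r%:C * z - c)^-1 ^+ 2 * nm (r%:C * (w * z) - c)^-1 <= (r - nm c)^-1 ^+ 3.
  by apply: sqr_mul_le; rewrite ?nm_ge0 ?hI.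
by rewrite [leRHS]mulrAC ler_wpM2l// mulr_ge0 ?(ltW r0)// exprn_ge0// nm_ge0.
Qed.

(** Move the pole from w to 0 along s w. The derivative in s is a mean of a
double pole, hence 0, so that the mean is constant by [quad_cst]; for s = 0 the
function is 1. *)
Lemma kernel_mean r w : nm w < r -> cmean (fun z => r%:C * z / (r%:C * z - w)) = 1.
Proof.
move=> wr; have r0 : 0 < r by exact: le_lt_trans (nm_ge0 w) wr.
have d0 : 0 < r - nm w by rewrite subr_gt0.
pose H (s : R) := cmean (fun z => r%:C * z / (r%:C * z - s%:C * w)).
have sw (s : R) : 0 <= s <= 1 -> nm (s%:C * w) <= nm w.
  by move=> /andP[s0 s1]; rewrite nmM nm_real ger0_norm// ler_piMl ?nm_ge0.
have hI s z : 0 <= s <= 1 -> nm z = 1 -> nm (r%:C * z - s%:C * w)^-1 <= (r - nm w)^-1.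
  move=> s01 z1; apply: nm_inv_le => //; apply: le_trans (nm_circle _ r0 z1).
  by rewrite lerB// sw.
have swr s : 0 <= s <= 1 -> nm (s%:C * w) < r by move=> s01; exact: le_lt_trans (sw s s01) wr.
have bH s : 0 <= s <= 1 -> cbdd (fun z => r%:C * z / (r%:C * z - s%:C * w)).
  move=> s01; exists (r * (r - nm w)^-1) => z z1.
  by rewrite !nmM z1 mulr1 nm_real gtr0_norm// ler_wpM2l ?(ltW r0)// hI.
have H1 : H 1 = cmean (fun z => r%:C * z / (r%:C * z - w)).
  by apply: cmean_ext => z _; rewrite mul1r.
have H0 : H 0 = 1.
  rewrite -[RHS](cmean_cst 1); apply: cmean_ext => z z1.
  by rewrite mul0r subr0 divff// mulf_neq0// -nm_gt0 ?z1// nm_real gtr0_norm.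
rewrite -H1 -H0; apply: (@quad_cst R H (r * nm w ^+ 2 * (r - nm w)^-1 ^+ 3)) => s t s01 t01.
have E : H t - H s = cmean (fun z => r%:C * z * (((t - s)%:C * w) ^+ 2) *
   ((r%:C * z - s%:C * w)^-1 ^+ 2 * (r%:C * z - t%:C * w)^-1)).
  have bP : cbdd (fun z => (r%:C * z - s%:C * w) ^- 2 * z).
    exists ((r - nm w)^-1 ^+ 2) => z z1; rewrite nmM z1 mulr1 -exprVn nmX.
    by rewrite ler_pXn2r ?nnegrE ?nm_ge0 ?invr_ge0 ?(ltW d0)// hI.
  rewrite /H -cmeanB; [|exact: bH|exact: bH].
  rewrite -[LHS]subr0 -(mulr0 ((t - s)%:C * w * r%:C)) -(cmean_double_pole (swr _ s01)).
  rewrite -cmean_scale// -cmeanB; last 2 first.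
  - have := cbdd_lin (-1) (bH _ t01) (bH _ s01).
    by under eq_fun do rewrite mulN1r.
  - have := cbdd_lin ((t - s)%:C * w * r%:C) (cbdd_cst 0) bP.
    by under eq_fun do rewrite add0r.
  apply: cmean_ext => z z1.
  have n1 := circle_neq0 (swr _ s01) z1; have n2 := circle_neq0 (swr _ t01) z1.
  by rewrite rmorphB/=; field; rewrite n1 n2.
rewrite E; apply: cmean_le => z z1.
rewrite 3!nmM [nm (_ / _)]nmM !nmX nmM z1 mulr1 !nm_real (gtr0_norm r0).
have hXY : nm (r%:C * z - s%:C * w)^-1 ^+ 2 * nm (r%:C * z - t%:C * w)^-1 <= (r - nm w)^-1 ^+ 3.
  by apply: sqr_mul_le; rewrite ?nm_ge0 ?hI.
have p0 : 0 <= r * (`|t - s| * nm w) ^+ 2.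
  by rewrite mulr_ge0 ?(ltW r0)// exprn_ge0// mulr_ge0// nm_ge0.
apply: (le_trans (ler_wpM2l p0 hXY)); rewrite exprMn real_normK ?num_real//.
by rewrite le_eqVlt; apply/orP; left; apply/eqP; ring.
Qed.

(** Contract the circle to w along w + s (r z - w). The derivative in s of the
mean is, up to a factor, the mean of F(w + s (r z - w)) z, which is 0 by
[cmean_exact] because G is a primitive of F. At s = 0 only the mean of the
kernel remains. *)
Lemma cauchy_quad G F M rho r w : 0 <= M -> quad G F M rho ->
  (forall z, nm z < rho -> nm (G z) <= M) -> (forall z, nm z < rho -> nm (F z) <= M) ->
  r < rho -> nm w < r -> cmean (fun z => G (r%:C * z) * (r%:C * z / (r%:C * z - w))) = G w.
Proof.
move=> M0 hq hG hF rrho wr; have r0 : 0 < r by exact: le_lt_trans (nm_ge0 w) wr.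
have d0 : 0 < r - nm w by rewrite subr_gt0.
pose u (s : R) z := w + s%:C * (r%:C * z - w).
pose kp z := r%:C * z / (r%:C * z - w).
pose H (s : R) := cmean (fun z => G (u s z) * kp z).
have hu s z : 0 <= s <= 1 -> nm z = 1 -> nm (u s z) < rho.
  move=> /andP[s0 s1] z1; apply: le_lt_trans rrho.
  rewrite (_ : u s z = (1 - s)%:C * w + s%:C * (r%:C * z)); last first.
    by rewrite /u rmorphB rmorph1; ring.
  apply: (le_trans (nmD _ _)); rewrite !nmM z1 mulr1 !nm_real (gtr0_norm r0) !ger0_norm ?subr_ge0//.
  have : (1 - s) * nm w <= (1 - s) * r by rewrite ler_wpM2l ?subr_ge0// ltW.
  by lra.
have hk z : nm z = 1 -> nm (kp z) <= r * (r - nm w)^-1.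
  move=> z1; rewrite !nmM z1 mulr1 nm_real gtr0_norm// ler_wpM2l ?(ltW r0)//.
  by apply: nm_inv_le => //; exact: nm_circle.
have k0 : 0 <= r * (r - nm w)^-1 by rewrite mulr_ge0 ?invr_ge0 ?ltW.
have bH s : 0 <= s <= 1 -> cbdd (fun z => G (u s z) * kp z).
  move=> s01; exists (M * (r * (r - nm w)^-1)) => z z1.
  by rewrite nmM; apply: ler_pM; rewrite ?nm_ge0 ?hk ?hG ?hu.
have H1 : H 1 = cmean (fun z => G (r%:C * z) * kp z).
  by apply: cmean_ext => z _; congr (G _ * _); rewrite /u mul1r; ring.
have H0 : H 0 = G w.
  rewrite -[RHS]mulr1 -(kernel_mean wr) -cmean_scale; last by exists (r * (r - nm w)^-1).
  by apply: cmean_ext => z z1; rewrite /u mul0r addr0.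
rewrite -/kp -H1 -H0.
apply: (@quad_cst R H (M * (2 * r) ^+ 2 * (r * (r - nm w)^-1))) => s t s01 t01.
have bF : cbdd (fun z => F (u s z)) by exists M => z z1; rewrite hF// hu.
have bFz : cbdd (fun z => F (u s z) * z).
  by exists M => z z1; rewrite nmM z1 mulr1 hF// hu.
have F0 : cmean (fun z => F (u s z) * z) = 0.
  have [s0|sn0] := eqVneq s 0.
    rewrite -[RHS](mulr0 (F w)) -cmean_id -cmean_scale; last by exists 1 => z ->.
    by apply: cmean_ext => z z1; rewrite /u s0 mul0r addr0.
  have sp : 0 < s by rewrite lt_def sn0; case/andP: s01.
  have sC : s%:C != 0 :> C by rewrite -nm_gt0 nm_real gtr0_norm.
  have rC : r%:C != 0 :> C by rewrite -nm_gt0 nm_real gtr0_norm.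
  apply: (@cmean_exact R (fun z => (s%:C * r%:C)^-1 * G (u s z)) _ (M * (s * r))) => //.
    by rewrite mulr_ge0// ltW// mulr_gt0.
  move=> z v z1 v1; have vz : nm (v * z) = 1 by rewrite nmM v1 z1 mulr1.
  have := hq _ _ (hu s z s01 z1) (hu s (v * z) s01 vz).
  have -> : u s (v * z) - u s z = s%:C * r%:C * (v - 1) * z by rewrite /u; ring.
  move=> hh; rewrite (_ : _ - _ - _ = (s%:C * r%:C)^-1 * (G (u s (v * z)) - G (u s z) -
      F (u s z) * (s%:C * r%:C * (v - 1) * z))); last by field; rewrite sC rC.
  rewrite nmM nmV nmM !nm_real !gtr0_norm// mulrC ler_pdivrMr ?mulr_gt0//.
  apply: (le_trans hh); rewrite !nmM z1 mulr1 !nm_real !gtr0_norm//.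
  by rewrite le_eqVlt; apply/orP; left; apply/eqP; ring.
have E : H t - H s = cmean (fun z => (G (u t z) - G (u s z) - F (u s z) * (u t z - u s z)) * kp z).
  rewrite /H -cmeanB; [|exact: bH|exact: bH].
  rewrite -[LHS]subr0 -(mulr0 ((t - s)%:C * r%:C)) -F0.
  rewrite -cmean_scale// -cmeanB; last 2 first.
  - have := cbdd_lin (-1) (bH _ t01) (bH _ s01).
    by under eq_fun do rewrite mulN1r.
  - have := cbdd_lin ((t - s)%:C * r%:C) (cbdd_cst 0) bFz.
    by under eq_fun do rewrite add0r.
  apply: cmean_ext => z z1; have n1 := circle_neq0 wr z1.
  by rewrite /kp /u rmorphB/=; field.
rewrite E; apply: cmean_le => z z1; rewrite nmM.
apply: (le_trans (ler_pM (nm_ge0 _) (nm_ge0 _) (hq _ _ (hu s z s01 z1) (hu t z t01 z1)) (hk z z1))).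
have -> : u t z - u s z = (t - s)%:C * (r%:C * z - w) by rewrite /u rmorphB; ring.
rewrite nmM nm_real exprMn real_normK ?num_real//.
have hr : nm (r%:C * z - w) ^+ 2 <= (2 * r) ^+ 2; last first.
  have p0 : 0 <= M * (t - s) ^+ 2 * (r * (r - nm w)^-1) by rewrite mulr_ge0// mulr_ge0// sqr_ge0.
  have := ler_wpM2l p0 hr; congr (_ <= _); ring.
rewrite ler_pXn2r ?nnegrE ?nm_ge0 ?mulr_ge0 ?(ltW r0)//.
apply: (le_trans (nmB _ _)); rewrite nmM z1 nm_real gtr0_norm//.
by move: (ltW wr); lra.
Qed.

Lemma quad_hasder G F M rho z : 0 <= M -> quad G F M rho -> nm z < rho -> hasder G z (F z).
Proof.
move=> M0 hq zr e e0; exists (Num.min ((rho - nm z) / 2) (e / (M + 1))).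
  by rewrite lt_min !divr_gt0 ?subr_gt0//; lra.
move=> w; rewrite le_min => /andP[w1 w2].
have wr : nm w < rho by have := nmD (w - z) z; rewrite subrK; lra.
apply: (le_trans (hq z w zr wr)); rewrite expr2 mulrA ler_wpM2r ?nm_ge0//.
move: w2; rewrite ler_pdivlMr; last by lra.
by have := nm_ge0 (w - z); lra.
Qed.

Lemma hasder_uniq f z c c' : hasder f z c -> hasder f z c' -> c = c'.
Proof.
move=> h h'; apply/eqP; rewrite -subr_eq0; apply/eqP/nm_small => e e0.
have e2 : 0 < e / 2 by rewrite divr_gt0.
have [d d0 hd] := h _ e2; have [d' d0' hd'] := h' _ e2.
pose t : R := Num.min d d'; have t0 : 0 < t by rewrite lt_min d0.
have nt : nm (z + t%:C - z) = t by rewrite addrAC subrr add0r nm_real gtr0_norm.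
have := hd (z + t%:C); have := hd' (z + t%:C); rewrite nt !ge_min !lexx orbT.
move=> /(_ isT) h1 /(_ isT) h2.
have : nm ((c - c') * t%:C) <= e * t.
  rewrite (_ : (c - c') * t%:C = (f (z + t%:C) - f z - c' * (z + t%:C - z)) -
      (f (z + t%:C) - f z - c * (z + t%:C - z))); last by ring.
  by apply: (le_trans (nmB _ _)); move: h1 h2; lra.
by rewrite nmM nm_real gtr0_norm// ler_pM2r.
Qed.

Lemma hasder_ext f g rho z c : (forall w, nm w < rho -> f w = g w) -> nm z < rho ->
  hasder f z c -> hasder g z c.
Proof.
move=> fg zr h e e0; have [d d0 hd] := h e e0.
exists (Num.min d ((rho - nm z) / 2)); first by rewrite lt_min d0 divr_gt0 ?subr_gt0.
move=> w; rewrite le_min => /andP[w1 w2].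
have wr : nm w < rho by have := nmD (w - z) z; rewrite subrK; lra.
by rewrite -!fg//; exact: hd.
Qed.

End Cauchy.

(** * Holomorphic functions of one variable have quadratic Taylor estimates *)

Section Taylor.
Variable R : realType.
Local Notation C := R[i].
Implicit Types (f g F G : C -> C) (z w c : C) (e r rho M B D : R).

(** Some absolute constant: the point of the estimates below is that the bound
depends on the function only through M. *)
Definition tayK : R := 200 * 4 ^+ 3.

Lemma tayK_ge1 : 1 <= tayK.
Proof. by rewrite /tayK mulr_ege1 ?exprn_ege1 ?ler1n. Qed.

Lemma tayK_ge0 : 0 <= tayK. Proof. exact: le_trans ler01 tayK_ge1. Qed.

(** The Cauchy kernel of the circle of radius 1 / 2, to the power m. *)
Definition kern m (z w : C) : C := ((2^-1 : R)%:C * z - w)^-1 ^+ m.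

Lemma kern_bound m z w : nm z = 1 -> nm w < 4^-1 -> nm (kern m z w) <= 4 ^+ m.
Proof.
move=> z1 w1; rewrite nmX lerXn2r ?nnegrE ?nm_ge0//.
rewrite -[leRHS]invrK; apply: nm_inv_le; first by rewrite invr_gt0.
have h2 : 0 < 2^-1 :> R by rewrite invr_gt0.
by apply: le_trans (nm_circle w h2 z1); lra.
Qed.

Lemma quad_sum_bound (h P : C) (B : R) : 0 <= B ->
  nm P <= B -> nm (h ^+ 2 * P) <= B * nm h ^+ 2.
Proof. by move=> B0 PB; rewrite nmM nmX mulrC ler_wpM2r ?exprn_ge0 ?nm_ge0. Qed.

Lemma nm_mono_bound (a b : nat) (X Y : C) : nm X <= 4 -> nm Y <= 4 ->
  nm (X ^+ a * Y ^+ b) <= 4 ^+ (a + b).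
Proof.
move=> hX hY; rewrite nmM !nmX exprD.
by apply: ler_pM; rewrite ?exprn_ge0 ?nm_ge0// lerXn2r ?nnegrE ?nm_ge0.
Qed.

(** The derivative of the m-th kernel in w is m times the next one, with a
remainder that is uniform in z, from an identity of rational functions for each
of m = 1, 2, 3. *)
Lemma kern_quad m z w w' : (0 < m <= 3)%N -> nm z = 1 -> nm w < 4^-1 -> nm w' < 4^-1 ->
  nm (kern m z w' - kern m z w - m%:R * kern m.+1 z w * (w' - w)) <= 96 * 4 ^+ 3 * nm (w' - w) ^+ 2.
Proof.
move=> hm z1 w1 w1'.
have r2 : nm w < 2^-1 by lra.
have r2' : nm w' < 2^-1 by lra.
have n1 := circle_neq0 r2 z1; have n2 := circle_neq0 r2' z1.
have := kern_bound 1 z1 w1; have := kern_bound 1 z1 w1'.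
rewrite /kern; set x := _ - w in n1 *; set y := _ - w' in n2 *.
have -> : w' - w = x - y by rewrite /x /y; ring.
rewrite !expr1 => hY hX; clearbody x y.
have h21 := nm_mono_bound 2 1 hX hY; have h22 := nm_mono_bound 2 2 hX hY.
have h31 := nm_mono_bound 3 1 hX hY; have h23 := nm_mono_bound 2 3 hX hY.
have h32 := nm_mono_bound 3 2 hX hY; have h41 := nm_mono_bound 4 1 hX hY.
have q0 : 0 <= 4 ^+ 3 :> R by exact: exprn_ge0.
have e4 : 4 ^+ 4 = 4 * 4 ^+ 3 :> R by rewrite exprS.
have e5 : 4 ^+ 5 = 16 * 4 ^+ 3 :> R by rewrite 2!exprS mulrA; congr (_ * _); ring.
rewrite /= in h21 h22 h31 h23 h32 h41.
rewrite !e4 in h22 h31; rewrite !e5 in h23 h32 h41.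
move: h21 h22 h31 h23 h32 h41 q0; move: (4 ^+ 3 : R) => q {e4 e5} h21 h22 h31 h23 h32 h41 q0.
have c0 : 0 <= 96 * q by rewrite mulr_ge0.
case: m hm => [//|[|[|[|//]]]] _.
- rewrite (_ : _ - _ = (x - y) ^+ 2 * (x^-1 ^+ 2 * y^-1 ^+ 1)); last by field; rewrite n1 n2.
  by apply: quad_sum_bound => //; lra.
- rewrite (_ : _ - _ = (x - y) ^+ 2 * (x^-1 ^+ 2 * y^-1 ^+ 2 +
     2%:R * (x^-1 ^+ 3 * y^-1 ^+ 1))); last by field; rewrite n1 n2.
  apply: quad_sum_bound => //; apply: (le_trans (nmD _ _)).
  by rewrite [nm (2%:R * _)]nmM nm_nat; lra.
- rewrite (_ : _ - _ = (x - y) ^+ 2 * (x^-1 ^+ 2 * y^-1 ^+ 3 + 2%:R * (x^-1 ^+ 3 * y^-1 ^+ 2) +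
     3%:R * (x^-1 ^+ 4 * y^-1 ^+ 1))); last by field; rewrite n1 n2.
  apply: quad_sum_bound => //; apply: (le_trans (nmD _ _)).
  have := nmD (x^-1 ^+ 2 * y^-1 ^+ 3) (2%:R * (x^-1 ^+ 3 * y^-1 ^+ 2)).
  by rewrite [nm (2%:R * _)]nmM [nm (3%:R * _)]nmM !nm_nat; lra.
Qed.

Definition ktrans g m w := cmean (fun z => g z * kern m z w).

Lemma ktrans_bdd g m w M : 0 <= M -> (forall z, nm z = 1 -> nm (g z) <= M) -> nm w < 4^-1 ->
  cbdd (fun z => g z * kern m z w).
Proof.
move=> M0 hg w1; exists (M * 4 ^+ m) => z z1; rewrite nmM.
by apply: ler_pM; rewrite ?nm_ge0 ?hg ?kern_bound.
Qed.

Lemma ktrans_le g m w M : 0 <= M -> (forall z, nm z = 1 -> nm (g z) <= M) -> nm w < 4^-1 ->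
  nm (ktrans g m w) <= M * 4 ^+ m.
Proof.
move=> M0 hg w1; apply: cmean_le => z z1; rewrite nmM.
by apply: ler_pM; rewrite ?nm_ge0 ?hg ?kern_bound.
Qed.

Lemma ktrans_quad g m M : (0 < m <= 3)%N -> 0 <= M -> (forall z, nm z = 1 -> nm (g z) <= M) ->
  quad (ktrans g m) (fun w => m%:R * ktrans g m.+1 w) (96 * 4 ^+ 3 * M) 4^-1.
Proof.
move=> hm M0 hg w w' w1 w1'.
have b k v : nm v < 4^-1 -> cbdd (fun z => g z * kern k z v) by exact: (@ktrans_bdd _ _ _ M).
rewrite /ktrans -cmeanB; [|exact: b|exact: b].
rewrite mulrC mulrA -cmean_scale; last exact: b.
rewrite -cmeanB; last 2 first.
- have := cbdd_lin (-1) (b m w' w1') (b m w w1).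
  by under eq_fun do rewrite mulN1r.
- have := cbdd_lin ((w' - w) * m%:R) (cbdd_cst 0) (b m.+1 w w1).
  by under eq_fun do rewrite add0r.
apply: cmean_le => z z1.
rewrite (_ : _ - _ = g z * (kern m z w' - kern m z w - m%:R * kern m.+1 z w * (w' - w))); last by ring.
rewrite nmM; apply: (le_trans (ler_pM (nm_ge0 _) (nm_ge0 _) (hg z z1) (kern_quad hm z1 w1 w1'))).
by rewrite mulrCA mulrA.
Qed.

(** Derivatives are unique, so an integral formula for F gives one for the
derivative of F. *)
Lemma quad_deriv_eq f F G M M' rho z : 0 <= M -> quad F G M rho ->
  (forall w, nm w < rho -> f w = F w) -> nm z < rho -> forall c, hasder f z c -> c = G z.
Proof.
move=> M0 hq fF zr c hc; apply: (hasder_uniq hc).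
by apply: (hasder_ext _ zr (quad_hasder M0 hq zr)) => w /fF.
Qed.

Lemma quad_ext f F g G M rho : (forall w, nm w < rho -> f w = F w) ->
  (forall w, nm w < rho -> g w = G w) -> quad F G M rho -> quad f g M rho.
Proof. by move=> fF gG hq z z' zr zr'; rewrite !fF// gG//; exact: hq. Qed.

Lemma quadZ F G M rho (k : nat) : quad F G M rho ->
  quad (fun w => k%:R * F w) (fun w => k%:R * G w) (k%:R * M) rho.
Proof.
move=> hq z z' zr zr'; rewrite -mulrA -!mulrBr nmM nm_nat -mulrA.
by rewrite ler_wpM2l//; exact: hq.
Qed.

(** The derivative of f is not known to be bounded, so Cauchy's formula is not
available for f. It holds for a second primitive G, as G' = F is Lipschitz.
Differentiating under the mean twice gives a formula for f with the third power
of the kernel, and once more the estimate. *)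
Lemma unit_disc_taylor f M : (forall z, nm z < 1 -> exists c, hasder f z c) ->
  (forall z, nm z < 1 -> nm (f z) <= M) ->
  exists f1, quad f f1 (tayK * M) 4^-1 /\ forall z, nm z < 4^-1 -> nm (f1 z) <= tayK * M.
Proof.
move=> hf fM; have M0 : 0 <= M by apply: le_trans (nm_ge0 _) (fM 0 _); rewrite nm0.
have [F [_ FL FM Fd]] := primitive hf fM.
have F1 z : nm z < 1 -> nm (F z) <= M.
  by move=> z1; apply: (le_trans (FM z z1)); rewrite ler_piMr// ltW.
have [|G [GF _ GM Gd]] := @primitive R F 1 M _ F1; first by move=> z z1; exists (f z); exact: Fd.
have hq : quad G F M 1.
  move=> z z' z1 z1'; rewrite expr2 mulrA; apply: GF => // w wz w1.
  by apply: (le_trans (FL _ _ z1 w1)); rewrite ler_wpM2l.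
have G1 z : nm z < 1 -> nm (G z) <= M.
  by move=> z1; apply: (le_trans (GM z z1)); rewrite ler_piMr// ltW.
pose h2 : R := 2^-1.
pose g z := G (h2%:C * z) * (h2%:C * z).
have nh z : nm z = 1 -> nm (h2%:C * z) = 2^-1.
  by move=> z1; rewrite nmM z1 mulr1 nm_real ger0_norm// invr_ge0.
have gM z : nm z = 1 -> nm (g z) <= M.
  move=> z1; rewrite nmM nh//.
  have : nm (G (h2%:C * z)) <= M by apply: G1; rewrite nh//; lra.
  by have := nm_ge0 (G (h2%:C * z)); lra.
have q0 : (0 : R) <= 4^-1 by rewrite invr_ge0.
have GE w : nm w < 4^-1 -> G w = ktrans g 1 w.
  move=> w1; have wh : nm w < h2 by rewrite /h2; lra.
  have h1 : h2 < 1 by rewrite /h2; lra.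
  by rewrite -(cauchy_quad M0 hq G1 F1 h1 wh); apply: cmean_ext => z _; rewrite /g /kern expr1 mulrA.
have M6 : 0 <= 96 * 4 ^+ 3 * M by rewrite !mulr_ge0// exprn_ge0.
have FE w : nm w < 4^-1 -> F w = ktrans g 2 w.
  move=> w1; rewrite -[RHS]mul1r.
  apply: (quad_deriv_eq 0 M6 (ktrans_quad (isT : (0 < 1 <= 3)%N) M0 gM) GE w1).
  by apply: Gd; lra.
have fE w : nm w < 4^-1 -> f w = 2%:R * ktrans g 3 w.
  move=> w1; apply: (quad_deriv_eq 0 M6 (ktrans_quad (isT : (0 < 2 <= 3)%N) M0 gM) FE w1).
  by apply: Fd; lra.
exists (fun w => 2%:R * (3%:R * ktrans g 4 w)); split.
  have h3 := quadZ 2 (ktrans_quad (isT : (0 < 3 <= 3)%N) M0 gM).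
  have : quad f (fun w => 2%:R * (3%:R * ktrans g 4 w)) (2%:R * (96 * 4 ^+ 3 * M)) 4^-1.
    by apply: quad_ext h3.
  move=> hh z z' zr zr'; apply: (le_trans (hh z z' zr zr')); rewrite ler_wpM2r ?sqr_ge0//.
  have : 0 <= 4 ^+ 3 * M by rewrite mulr_ge0// exprn_ge0.
  by rewrite /tayK -!mulrA; move: (4 ^+ 3 * M) => q; lra.
move=> z z1; rewrite !nmM !nm_nat; have := @ktrans_le g 4 z M M0 gM z1.
have : 0 <= 4 ^+ 3 * M by rewrite mulr_ge0// exprn_ge0.
rewrite exprS /tayK -mulrA mulrCA [M * _]mulrC.
by move: (4 ^+ 3 * M) => q; lra.
Qed.

Lemma hasder_scale f (s c z : C) : s != 0 -> hasder f (s * z) c ->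
  hasder (fun w => f (s * w)) z (s * c).
Proof.
move=> s0 h e e0; have sp : 0 < nm s by rewrite nm_gt0.
have [d d0 hd] := h (e / nm s) (divr_gt0 e0 sp).
exists (d / nm s); first by rewrite divr_gt0.
move=> w; rewrite ler_pdivlMr// mulrC -nmM mulrBr => /hd.
rewrite -mulrBr nmM mulrA divfK ?gt_eqF// => hh.
by rewrite (_ : s * c * (w - z) = c * (s * (w - z)))//; ring.
Qed.

Lemma disc_taylor f rho M : 0 < rho -> (forall z, nm z < rho -> exists c, hasder f z c) ->
  (forall z, nm z < rho -> nm (f z) <= M) ->
  forall c, hasder f 0 c -> nm c <= tayK * M / rho /\
    forall s, nm s < rho / 4 -> nm (f s - f 0 - c * s) <= tayK * M / rho ^+ 2 * nm s ^+ 2.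
Proof.
move=> r0 hf fM c hc.
have rC : rho%:C != 0 :> C by rewrite -nm_gt0 nm_real gtr0_norm.
have nr : nm (rho%:C : C) = rho by rewrite nm_real gtr0_norm.
pose g z := f (rho%:C * z).
have gd z : nm z < 1 -> exists c', hasder g z c'.
  move=> z1; have [|c' hc'] := hf (rho%:C * z).
    by rewrite nmM nr gtr_pMr.
  by exists (rho%:C * c'); exact: hasder_scale.
have gM z : nm z < 1 -> nm (g z) <= M by move=> z1; apply: fM; rewrite nmM nr gtr_pMr.
have M0 : 0 <= M by apply: le_trans (nm_ge0 _) (fM 0 _); rewrite nm0.
have [f1 [hq h1]] := unit_disc_taylor gd gM.
have q0 : nm (0 : C) < 4^-1 by rewrite nm0 invr_gt0.
have cE : rho%:C * c = f1 0.
  apply: (@hasder_uniq _ g 0); last by apply: (quad_hasder _ hq) => //; rewrite mulr_ge0 ?tayK_ge0.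
  by apply: hasder_scale => //; rewrite mulr0.
split.
  by have := h1 0 q0; rewrite -cE nmM nr ler_pdivlMr// mulrC.
move=> s sr; pose t := s / rho%:C.
have st : s = rho%:C * t by rewrite /t mulrC divfK.
have t1 : nm t < 4^-1 by rewrite nmM nmV nr ltr_pdivrMr// mulrC.
have := hq 0 t q0 t1; rewrite /g mulr0 subr0 -cE -st -mulrA [c * t]mulrC mulrA -st [s * c]mulrC.
move=> hh; apply: (le_trans hh); rewrite /t nmM nmV nr exprMn.
by rewrite le_eqVlt; apply/orP; left; apply/eqP; field; rewrite gt_eqF.
Qed.

(** By [unit_disc_taylor] f now satisfies the hypotheses of [cauchy_quad], after
rescaling the disc to radius 1. *)
Lemma cauchy_formula f rho M r w : (forall z, nm z < rho -> exists c, hasder f z c) ->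
  (forall z, nm z < rho -> nm (f z) <= M) -> r < rho / 4 -> nm w < r ->
  cmean (fun z => f (r%:C * z) * (r%:C * z / (r%:C * z - w))) = f w.
Proof.
move=> hf fM rr wr; have rp : 0 < r by exact: le_lt_trans (nm_ge0 w) wr.
have r0 : 0 < rho by lra.
have rC : rho%:C != 0 :> C by rewrite -nm_gt0 nm_real gtr0_norm.
have nr : nm (rho%:C : C) = rho by rewrite nm_real gtr0_norm.
pose g z := f (rho%:C * z).
have gd z : nm z < 1 -> exists c', hasder g z c'.
  move=> z1; have [|c' hc'] := hf (rho%:C * z).
    by rewrite nmM nr gtr_pMr.
  by exists (rho%:C * c'); exact: hasder_scale.
have gM z : nm z < 1 -> nm (g z) <= M by move=> z1; apply: fM; rewrite nmM nr gtr_pMr.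
have M0 : 0 <= M by apply: le_trans (nm_ge0 _) (fM 0 _); rewrite nm0.
have M16 : 0 <= tayK * M by rewrite mulr_ge0 ?tayK_ge0.
have [f1 [hq h1]] := unit_disc_taylor gd gM.
have gM' z : nm z < 4^-1 -> nm (g z) <= tayK * M.
  move=> z1; apply: (le_trans (gM z _)); first by lra.
  by rewrite ler_peMl// tayK_ge1.
pose v := w / rho%:C.
have vw : w = rho%:C * v by rewrite /v mulrC divfK.
have q1 : r / rho < 4^-1 by rewrite ltr_pdivrMr// mulrC.
have v1 : nm v < r / rho by rewrite nmM nmV nr ltr_pM2r ?invr_gt0.
have := cauchy_quad M16 hq gM' h1 q1 v1; rewrite {2}/g -vw => <-.
apply: cmean_ext => z z1; rewrite /g.
have E : rho%:C * ((r / rho)%:C * z) = r%:C * z.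
  by rewrite rmorphM fmorphV/=; field.
rewrite E; congr (_ * _).
have n1 := circle_neq0 wr z1; have n2 := circle_neq0 v1 z1.
by rewrite -E vw -mulrBr -mulf_div divff// mul1r.
Qed.

End Taylor.

(** * Differentiability in coordinates *)

Section DifferentiableCoordinates.
Variables (K : numFieldType) (k : nat).
Local Notation V := 'rV[K]_k.

(** The coordinate estimate is the definition of the differential, once the
linear form with coefficients L is known to be continuous. *)
Lemma coord_estimate_differentiable (h : V -> K) (t : V) (L : 'I_k -> K) :
  (forall e : K, 0 < e -> \forall v \near (0 : V),
     `|h (t + v) - h t - \sum_i L i * v 0 i| <= e * `|v|) -> differentiable h t.
Proof.
move=> hL; pose l (v : V) : K := \sum_i L i * v 0 i.
have lin : linear (l : V -> K^o).
  move=> c x y; rewrite /l scaler_sumr -big_split/=; apply: eq_bigr => i _.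
  by rewrite !mxE /GRing.scale/=; ring.
pose lM := GRing.isLinear.Build _ _ _ _ _ lin.
pose lL : {linear V -> K^o} := HB.pack (l : V -> K^o) lM.
have lc : continuous (lL : V -> K).
  move=> v; apply: differentiable_continuous.
  have -> : (lL : V -> K) = \sum_i (fun v : V => L i * v 0 i).
    by apply/funext => w; rewrite fct_sumE.
  apply: differentiable_sum => i; apply: differentiableM; first exact: differentiable_cst.
  exact: differentiable_coord.
have E : h \o shift t = cst (h t) + lL +o_ (0 : V) id.
  apply/eqaddoP => e e0; have := hL e e0; apply: filterS => v.
  by congr (`| _ | <= _); rewrite -[RHS]/(h (v + t) - (h t + l v)) opprD addrA [v + t]addrC.
have dE := diff_unique lc E.
by apply/diff_locallyP; rewrite dE.
Qed.

End DifferentiableCoordinates.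

Section SeveralVariables.
Variables (R : realType) (k : nat).
Local Notation C := (R[i] : numFieldType).
Local Notation V := 'rV[C]_k.
Implicit Types (h : V -> C) (t v p : V) (e r : R).

(** Real estimates in the maximum norm. *)
Definition vle (v : V) (s : R) := forall i, nm (v 0 i) <= s.

Lemma mnorm_le (v : V) (s : R) : 0 <= s -> vle v s -> `|v| <= s%:C.
Proof.
move=> s0 vs; have [E|] := eqVneq (mx_norm v) 0.
  by rewrite -[`|v|]/(mx_norm v) E lecR.
move=> /mx_norm_neq0[[i j] /= E]; rewrite -[`|v|]/(mx_norm v) E nmE lecR.
by rewrite ord1; exact: vs.
Qed.

Lemma coord_le_mnorm (v : V) i : `|v 0 i| <= `|v|.
Proof.
rewrite -[leRHS]/(mx_norm v) mx_normE -[leLHS]nngE num_le.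
exact: (le_bigmax _ (fun ij : 'I_1 * 'I_k => `|v ij.1 ij.2|%:nng) (0, i)).
Qed.

Lemma pos_complex (e : C) : 0 < e -> exists2 r : R, 0 < r & e = r%:C.
Proof. by case: e => a b; rewrite ltcE/= => /andP[/eqP -> a0]; exists a. Qed.

Lemma nearP_vle p (P : V -> Prop) :
  (\forall t \near p, P t) <-> exists2 d : R, 0 < d & forall t, vle (t - p) d -> P t.
Proof.
split=> [/nbhs_ballP[e /pos_complex[r r0 ->] hr]|[d d0 hd]].
  exists (r / 2); first by rewrite divr_gt0.
  move=> t tp; apply: hr; rewrite -ball_normE/= distrC.
  have r20 : 0 <= r / 2 by rewrite divr_ge0 ?ltW.
  by apply: le_lt_trans (mnorm_le r20 tp) _; rewrite ltcR ltr_pdivrMr// ltr_pMr// ltr1n.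
apply/nbhs_ballP; exists d%:C; first by rewrite /= ltcR.
move=> t; rewrite -ball_normE/= distrC => tp; apply: hd => i.
by rewrite -lecR -nmE; apply: ltW; apply: le_lt_trans tp; exact: coord_le_mnorm.
Qed.

(** Differentiability at t with partial derivatives L. The estimate is in terms
of any bound s of v, which makes it easy to apply to multiples of v. *)
Definition vder h t (L : 'I_k -> C) := forall e, 0 < e -> exists2 d : R, 0 < d &
  forall v s, s <= d -> vle v s -> 0 <= s -> nm (h (t + v) - h t - \sum_i L i * v 0 i) <= e * s.

Lemma differentiable_vder h t : differentiable h t -> exists L, vder h t L.
Proof.
move=> hd; have [_ /eqaddoP dh] := (diff_locallyP t h).1 hd.
exists (fun i => 'd h t (delta_mx 0 i)) => e e0.
have eC : 0 < e%:C :> C by rewrite ltcR.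
have := dh _ eC; move/nearP_vle => [d d0 hd'].
exists d => // v s sd vs s0.
have /hd' : vle (v - 0) d by rewrite subr0 => i; apply: le_trans (vs i) sd.
rewrite /= => hv.
have E : 'd h t v = \sum_i 'd h t (delta_mx 0 i) * v 0 i.
  rewrite {1}[v]row_sum_delta linear_sum; apply: eq_bigr => i _.
  by rewrite linearZ /= mulrC.
rewrite -lecR -nmE -E rmorphM /=.
have -> : h (t + v) - h t - 'd h t v = (h \o shift t - (cst (h t) + 'd h t)) v.
  by rewrite -[RHS]/(h (v + t) - (h t + 'd h t v)) opprD addrA [v + t]addrC.
apply: (le_trans hv); rewrite ler_wpM2l ?(ltW eC)//.
exact: mnorm_le.
Qed.

Lemma vder_differentiable h t L : vder h t L -> differentiable h t.
Proof.
move=> hL; apply: (coord_estimate_differentiable (L := L)) => e /pos_complex[r r0 ->].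
have [d d0 hd] := hL r r0.
apply/nearP_vle; exists d => // v; rewrite subr0 => vd.
have [s /= sE] : exists s : R, `|v| = s%:C.
  by exists (complex.Re `|v|); rewrite RRe_real// ger0_real.
rewrite sE -rmorphM /= nmE lecR.
have s0 : 0 <= s by rewrite -lecR -sE; exact: normr_ge0.
have [sd|ds] := leP s d.
  by apply: hd => // i; rewrite -lecR -sE -nmE coord_le_mnorm.
apply: (le_trans (hd v d (lexx d) vd (ltW d0))).
by rewrite ler_wpM2l ?ltW.
Qed.

End SeveralVariables.

(** * Holomorphic germs in several variables *)

Section HolomorphicGerms.
Variables (K : numFieldType) (k : nat).
Local Notation V := 'rV[K]_k.
Implicit Types (p t : V) (g h : V -> K).

Lemma hol_cst p (c : K) : holomorphic_at p (fun=> c).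
Proof. by apply: filterE => t; exact: differentiable_cst. Qed.

Lemma hol_coord p i : holomorphic_at p (fun t => t 0 i).
Proof. by apply: filterE => t; exact: differentiable_coord. Qed.

Lemma holD p g h : holomorphic_at p g -> holomorphic_at p h ->
  holomorphic_at p (fun t => g t + h t).
Proof. by apply: filterS2 => t; exact: differentiableD. Qed.

Lemma holM p g h : holomorphic_at p g -> holomorphic_at p h ->
  holomorphic_at p (fun t => g t * h t).
Proof. by apply: filterS2 => t; exact: differentiableM. Qed.

Lemma holN p h : holomorphic_at p h -> holomorphic_at p (fun t => - h t).
Proof. by apply: filterS => t; exact: differentiableN. Qed.

Lemma holB p g h : holomorphic_at p g -> holomorphic_at p h ->
  holomorphic_at p (fun t => g t - h t).
Proof. by move=> hg hh; apply: holD => //; exact: holN. Qed.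

Lemma hol_sum p (I : Type) (r : seq I) (P : pred I) (F : I -> V -> K) :
  (forall i, P i -> holomorphic_at p (F i)) ->
  holomorphic_at p (fun t => \sum_(i <- r | P i) F i t).
Proof.
move=> hF; elim: r => [|i r IH].
  by under eq_fun do rewrite big_nil; exact: hol_cst.
under eq_fun do rewrite big_cons; case Pi: (P i) => //.
by apply: holD => //; exact: hF.
Qed.

Lemma hol_prod p (I : Type) (r : seq I) (P : pred I) (F : I -> V -> K) :
  (forall i, P i -> holomorphic_at p (F i)) ->
  holomorphic_at p (fun t => \prod_(i <- r | P i) F i t).
Proof.
move=> hF; elim: r => [|i r IH].
  by under eq_fun do rewrite big_nil; exact: hol_cst.
under eq_fun do rewrite big_cons; case Pi: (P i) => //.
by apply: holM => //; exact: hF.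
Qed.

Lemma hol_det p n (M : 'I_n -> 'I_n -> V -> K) :
  (forall i j, holomorphic_at p (M i j)) ->
  holomorphic_at p (fun t => \det (\matrix_(i, j) M i j t)).
Proof.
move=> hM; apply: hol_sum => s _; apply: holM; first exact: hol_cst.
apply: hol_prod => i _; rewrite (_ : (fun t => _) = M i (s i)); first exact: hM.
by apply/funext => t; rewrite mxE.
Qed.

Lemma hol_continuous p h : holomorphic_at p h -> \forall t \near p, {for t, continuous h}.
Proof. by apply: filterS => t; exact: differentiable_continuous. Qed.

Lemma hol_neq0 p h : holomorphic_at p h -> h p != 0 -> \forall t \near p, h t != 0.
Proof.
move=> /hol_continuous/nbhs_singleton hc hp.
exact: cvgr_neq0 hc hp.
Qed.

Lemma holV p h : holomorphic_at p h -> h p != 0 -> holomorphic_at p (fun t => (h t)^-1).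
Proof.
move=> hh hp; have := hol_neq0 hh hp; move: hh; apply: filterS2 => t hd ht.
exact: differentiableV.
Qed.

End HolomorphicGerms.

(** * Division by a coordinate *)

Section Division.
Variables (R : realType) (k : nat).
Local Notation C := (R[i] : numFieldType).
Local Notation V := 'rV[C]_k.
Implicit Types (h : V -> C) (t v p : V) (e r rho M : R).

Definition upd (t : V) (i : 'I_k) (w : C) : V :=
  \row_j (if j == i then w else t 0 j).

Lemma upd_id t i : upd t i (t 0 i) = t.
Proof. by apply/rowP => j; rewrite mxE; case: eqP => [->|]. Qed.

Lemma updD t i w v w' : upd (t + v) i (w + w') = upd t i w + upd v i w'.
Proof. by apply/rowP => j; rewrite !mxE; case: eqP. Qed.

Lemma vle0 (s : R) : 0 <= s -> vle (0 : V) s.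
Proof. by move=> s0 i; rewrite mxE nm0. Qed.

Lemma vleD v v' (s s' : R) : vle v s -> vle v' s' -> vle (v + v') (s + s').
Proof. by move=> h h' i; rewrite mxE; apply: (le_trans (nmD _ _)); rewrite lerD. Qed.

Lemma vleZ (c : C) v (s : R) : vle v s -> vle (c *: v) (nm c * s).
Proof. by move=> h i; rewrite mxE nmM ler_wpM2l ?nm_ge0. Qed.

Lemma vle_trans v (s s' : R) : s <= s' -> vle v s -> vle v s'.
Proof. by move=> ss h i; exact: le_trans (h i) ss. Qed.

Lemma vder_line h t v (z : C) L (s : R) : 0 < s -> vle v s -> vder h (t + z *: v) L ->
  hasder (fun w => h (t + w *: v)) z (\sum_i L i * v 0 i).
Proof.
move=> s0 vs hL e e0; have [d d0 hd] := hL (e / s) (divr_gt0 e0 s0).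
exists (d / s); first by rewrite divr_gt0.
move=> w wd; rewrite ler_pdivlMr// in wd.
have := hd ((w - z) *: v) (nm (w - z) * s) wd (vleZ _ vs).
rewrite mulr_ge0 ?nm_ge0 ?(ltW s0)// => /(_ isT).
have -> : t + z *: v + (w - z) *: v = t + w *: v.
  by rewrite -addrA -scalerDl; congr (_ + _ *: _); ring.
rewrite (_ : \sum_i L i * ((w - z) *: v) 0 i = (\sum_i L i * v 0 i) * (w - z)); last first.
  by rewrite mulr_suml; apply: eq_bigr => i _; rewrite mxE mulrCA mulrC.
move=> hh; apply: (le_trans hh); by rewrite [_ * s]mulrC mulrA divfK ?gt_eqF.
Qed.

(** [disc_taylor] on all complex lines through t, with constants that depend on
h only through the bound M. *)
Lemma vder_taylor h t L rho M : 0 < rho ->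
  (forall v, vle v rho -> exists L', vder h (t + v) L') ->
  (forall v, vle v rho -> nm (h (t + v)) <= M) -> vder h t L ->
  (forall i, nm (L i) <= tayK R * M / rho) /\
  forall v s, 0 < s -> s < rho / 4 -> vle v s ->
    nm (h (t + v) - h t - \sum_i L i * v 0 i) <= tayK R * M / rho ^+ 2 * s ^+ 2.
Proof.
move=> r0 hd hM hL.
have key y : vle y 1 -> nm (\sum_i L i * y 0 i) <= tayK R * M / rho /\
   forall s : C, nm s < rho / 4 -> nm (h (t + s *: y) - h t - (\sum_i L i * y 0 i) * s) <=
      tayK R * M / rho ^+ 2 * nm s ^+ 2.
  move=> y1.
  have hy (z : C) : nm z < rho -> vle (z *: y) rho.
    move=> zr; apply: (vle_trans (s := nm z * 1)); first by rewrite mulr1 ltW.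
    exact: vleZ.
  have [z zr|z zr||] := @disc_taylor R (fun w => h (t + w *: y)) rho M r0 _ _ (\sum_i L i * y 0 i).
  - have [L' hL'] := hd _ (hy z zr).
    by exists (\sum_i L' i * y 0 i); apply: (vder_line ltr01 y1).
  - by apply: hM; exact: hy.
  - by apply: (vder_line ltr01 y1); rewrite scale0r addr0.
  move=> h1 h2; split=> // s sr; have := h2 s sr; by rewrite scale0r addr0.
split=> [i|v s s0 sr vs].
  have [|h1 _] := key (delta_mx 0 i).
    by move=> j; rewrite mxE; case: (_ && _); rewrite ?nm1 ?nm0 ?ler01.
  move: h1; rewrite (bigD1 i)//= big1 ?addr0 => [|j ji]; rewrite mxE eqxx/=.
    by rewrite eqxx mulr1.
  by rewrite (negPf ji) mulr0.
have sC : s%:C != 0 :> C by rewrite -nm_gt0 nm_real gtr0_norm.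
have [|_ h2] := key (s%:C^-1 *: v).
  apply: (vle_trans (s := nm (s%:C^-1 : C) * s)); last exact: vleZ.
  by rewrite nmV nm_real gtr0_norm// mulVf ?gt_eqF.
have := h2 s%:C; rewrite nm_real gtr0_norm// => /(_ sr).
rewrite scalerA divff// scale1r; congr (nm (_ - _) <= _).
rewrite mulr_suml; apply: eq_bigr => i _; rewrite mxE; field; exact: sC.
Qed.

Lemma cmean_sum (I : Type) (r : seq I) (F : I -> C -> C) : (forall i, cbdd (F i)) ->
  cmean (fun z => \sum_(i <- r) F i z) = \sum_(i <- r) cmean (F i) /\
  cbdd (fun z => \sum_(i <- r) F i z).
Proof.
move=> bF; elim: r => [|i r [IH bIH]].
  by under eq_fun do rewrite big_nil; rewrite big_nil cmean_cst; split=> //; exact: cbdd_cst.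
under eq_fun do rewrite big_cons -[\sum_(j <- r) _]mul1r.
split; last exact: cbdd_lin.
by rewrite cmean_lin// mul1r big_cons IH.
Qed.

(** Differentiation under the mean: the remainder of [vder_taylor] is uniform
over the circle. *)
Lemma cmean_vder (Theta : C -> V -> C) t rho M : 0 < rho ->
  (forall z v, nm z = 1 -> vle v rho -> exists L, vder (Theta z) (t + v) L) ->
  (forall z v, nm z = 1 -> vle v rho -> nm (Theta z (t + v)) <= M) ->
  exists L, vder (fun t => cmean (fun z => Theta z t)) t L.
Proof.
move=> r0 hd hM.
have M0 : 0 <= M.
  by apply: le_trans (nm_ge0 _) (hM 1 0 (nm1 _) _); apply: vle0; exact: ltW.
have /choice[L hL] : forall z : C, exists L, nm z = 1 -> vder (Theta z) t L.
  move=> z; case: (pselect (nm z = 1)) => [z1|nz]; last by exists (fun=> 0).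
  by have [|L hL] := hd z 0 z1; [apply: vle0; exact: ltW|exists L => _; rewrite addr0 in hL].
have Lb i : cbdd (fun z => L z i).
  exists (tayK R * M / rho) => z z1.
  by have [|||h1 _] := @vder_taylor (Theta z) t (L z) rho M r0 => [v|v||//]; [exact: hd|exact: hM|exact: hL].
have Lq z v s : nm z = 1 -> 0 < s -> s < rho / 4 -> vle v s ->
    nm (Theta z (t + v) - Theta z t - \sum_i L z i * v 0 i) <= tayK R * M / rho ^+ 2 * s ^+ 2.
  move=> z1.
  have [|||_ h1] := @vder_taylor (Theta z) t (L z) rho M r0 => [v'|v'||].
  - exact: hd.
  - exact: hM.
  - exact: hL.
  - exact: h1.
have TB v : vle v rho -> cbdd (fun z => Theta z (t + v)) by move=> vr; exists M => z z1; exact: hM.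
exists (fun i => cmean (fun z => L z i)) => e e0.
pose Q := tayK R * M / rho ^+ 2.
have Q0 : 0 <= Q by rewrite divr_ge0 ?exprn_ge0 ?(ltW r0)// mulr_ge0// tayK_ge0.
exists (Num.min (rho / 8) (e / (Q + 1))); first by rewrite lt_min !divr_gt0//; lra.
move=> v s; rewrite le_min => /andP[s1 s2] vs; rewrite le_eqVlt => /orP[/eqP s0|s0].
  have -> : v = 0.
    by apply/rowP => i; rewrite mxE; apply: nm_le0; rewrite s0; exact: vs.
  rewrite addr0 subrr big1 => [|i _]; last by rewrite mxE mulr0.
  by rewrite subr0 nm0 -s0 mulr0.
have vr : vle v rho by apply: vle_trans vs; lra.
have bL i : cbdd (fun z => v 0 i * L z i).
  by have [B hB] := Lb i; exists (nm (v 0 i) * B) => z z1; rewrite nmM ler_wpM2l ?nm_ge0 ?hB.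
have [E bE] := cmean_sum (index_enum 'I_k) bL.
have E2 : \sum_i cmean (fun z => L z i) * v 0 i = cmean (fun z => \sum_i v 0 i * L z i).
  by rewrite E; apply: eq_bigr => i _; rewrite cmean_scale// mulrC.
have TB0 : cbdd (fun z => Theta z t) by have := TB 0 (vle0 (ltW r0)); under eq_fun do rewrite addr0.
rewrite E2 -cmeanB; [|exact: TB|exact: TB0].
rewrite -cmeanB//; last first.
  have := cbdd_lin (-1) (TB v vr) TB0.
  by under eq_fun do rewrite mulN1r.
apply: (@le_trans _ _ (Q * s ^+ 2)); last first.
  rewrite expr2 mulrA ler_wpM2r ?(ltW s0)//.
  move: s2; rewrite ler_pdivlMr; last by lra.
  by lra.
apply: cmean_le => z z1.
rewrite (eq_bigr (fun i => L z i * v 0 i)); last by move=> i _; rewrite mulrC.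
by apply: Lq => //; lra.
Qed.

Lemma vder_upd h t i w L : vder h (upd t i w) L ->
  vder (fun t => h (upd t i w)) t (fun j => if j == i then 0 else L j).
Proof.
move=> hL e e0; have [d d0 hd] := hL e e0; exists d => // v s sd vs s0.
have := hd (upd v i 0) s sd; rewrite -updD addr0.
rewrite (eq_bigr (fun j => (if j == i then 0 else L j) * v 0 j)); last first.
  by move=> j _; rewrite mxE; case: eqP => _; rewrite ?mulr0 ?mul0r.
by apply=> // j; rewrite mxE; case: eqP => // _; rewrite nm0.
Qed.

Lemma vder_bounded h t L : vder h t L ->
  exists M (d : R), 0 < d /\ forall v, vle v d -> nm (h (t + v)) <= M.
Proof.
move=> hL; have [d d0 hd] := hL 1 ltr01.
exists (d + nm (h t) + \sum_i nm (L i) * d), d; split=> // v vd.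
rewrite (_ : h (t + v) = (h (t + v) - h t - \sum_i L i * v 0 i) + h t + \sum_i L i * v 0 i); last by ring.
apply: (le_trans (nmD _ _)); apply: lerD.
  apply: (le_trans (nmD _ _)); rewrite lerD2r.
  by have := hd v d (lexx _) vd (ltW d0); rewrite mul1r.
apply: (le_trans (nm_sum _ _ _)); apply: ler_sum => i _.
by rewrite nmM ler_wpM2l ?nm_ge0.
Qed.

(** The quotient is the mean over the circle |zeta| = r of
h(t with t_i := p_i + zeta) / (zeta - (t_i - p_i)). This has a meaning and is
holomorphic in t also where t_i = p_i, by [cmean_vder]. The identity is the
difference of two instances of Cauchy's formula in the i-th variable, at t_i
and at p_i. *)
Lemma divide_coord h p i : holomorphic_at p h -> exists2 u, holomorphic_at p u &
  \forall t \near p, h t = h (upd t i (p 0 i)) + (t 0 i - p 0 i) * u t.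
Proof.
move=> /nearP_vle[d1 d10 hd1].
have [L0 hL0] : exists L, vder h p L.
  by apply: differentiable_vder; apply: hd1; rewrite subrr; apply: vle0; exact: ltW.
have [M [d2 [d20 hM]]] := vder_bounded hL0.
pose rho := Num.min d1 d2; have rho0 : 0 < rho by rewrite lt_min d10.
have hd v : vle v rho -> exists L, vder h (p + v) L.
  move=> vr; apply: differentiable_vder; apply: hd1; rewrite addrC addKr.
  by apply: vle_trans vr; rewrite ge_min lexx.
have {}hM v : vle v rho -> nm (h (p + v)) <= M.
  by move=> vr; apply: hM; apply: vle_trans vr; rewrite ge_min lexx orbT.
have M0 : 0 <= M.
  by apply: le_trans (nm_ge0 _) (hM 0 _); apply: vle0; exact: ltW.
pose r := rho / 8; have r0 : 0 < r by rewrite divr_gt0.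
have hupd t (w : C) : vle (t - p) rho -> nm w <= rho ->
    exists2 v, upd t i (p 0 i + w) = p + v & vle v rho.
  move=> tp wr; exists (upd (t - p) i w); last by move=> j; rewrite mxE; case: eqP.
  by rewrite -[X in _ = X + _](upd_id p i) -updD [p + _]addrC subrK.
pose Theta (z : C) (t : V) : C := h (upd t i (p 0 i + r%:C * z)) * (r%:C * z - (t 0 i - p 0 i))^-1.
exists (fun t => cmean (fun z => Theta z t)).
  apply/nearP_vle; exists (r / 4); first by rewrite divr_gt0.
  move=> t0 ht0.
  have near_t v : vle v (r / 4) -> vle (t0 + v - p) (r / 2).
    by move=> vr; rewrite addrAC; apply: vle_trans (vleD ht0 vr); lra.
  have [|||L hL] := @cmean_vder Theta t0 (r / 4) (M * (r / 2)^-1) _ _ _.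
  - by rewrite divr_gt0.
  - move=> z v z1 vr; have tv := near_t v vr.
    have tvi := tv i; rewrite !mxE in tvi.
    have [v' E v'r] : exists2 v', upd (t0 + v) i (p 0 i + r%:C * z) = p + v' & vle v' rho.
      apply: hupd; first by apply: vle_trans tv; rewrite /r; lra.
      by rewrite nmM z1 mulr1 nm_real gtr0_norm// /r; lra.
    apply: differentiable_vder; apply: differentiableM.
      have [L' hL'] := hd v' v'r; rewrite -E in hL'.
      exact: vder_differentiable (vder_upd hL').
    apply: differentiableV.
      apply: differentiableB; first exact: differentiable_cst.
      by apply: differentiableB; [exact: differentiable_coord|exact: differentiable_cst].
    by rewrite !mxE; apply: circle_neq0 z1; lra.
  - move=> z v z1 vr; have tv := near_t v vr.
    have tvi := tv i; rewrite !mxE in tvi.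
    have [v' E v'r] : exists2 v', upd (t0 + v) i (p 0 i + r%:C * z) = p + v' & vle v' rho.
      apply: hupd; first by apply: vle_trans tv; rewrite /r; lra.
      by rewrite nmM z1 mulr1 nm_real gtr0_norm// /r; lra.
    rewrite /Theta E nmM; apply: ler_pM; rewrite ?nm_ge0 ?hM//.
    apply: nm_inv_le; first by rewrite divr_gt0.
    by apply: le_trans (nm_circle _ r0 z1); rewrite !mxE; lra.
  - exact: vder_differentiable hL.
apply/nearP_vle; exists (r / 2); first by rewrite divr_gt0.
move=> t tp; have tpi := tp i; rewrite !mxE in tpi.
set w := t 0 i - p 0 i in tpi *.
have tprho : vle (t - p) rho by apply: vle_trans tp; rewrite /r; lra.
pose F (w : C) := h (upd t i (p 0 i + w)).
have hF z : nm z < rho -> exists c, hasder F z c.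
  move=> zr; have [v E vr] := hupd t z tprho (ltW zr).
  have [L hL] := hd v vr; rewrite -E in hL.
  pose t' := upd t i (p 0 i).
  have FE w' : F w' = h (t' + w' *: delta_mx 0 i).
    congr h; apply/rowP => j; rewrite !mxE eqxx/= [j == i]eq_sym.
    by case: (i == j); rewrite ?mulr1 ?mulr0 ?addr0.
  exists (\sum_j L j * (delta_mx 0 i : V) 0 j).
  have -> : F = (fun w' => h (t' + w' *: delta_mx 0 i)) by apply/funext.
  apply: (vder_line ltr01).
    by move=> j; rewrite mxE; case: (_ && _); rewrite ?nm1 ?nm0 ?ler01.
  congr (vder h _ L): hL; apply/rowP => j; rewrite !mxE eqxx/= [j == i]eq_sym.
  by case: (i == j); rewrite ?mulr1 ?mulr0 ?addr0.
have FM z : nm z < rho -> nm (F z) <= M.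
  by move=> zr; have [v E vr] := hupd t z tprho (ltW zr); rewrite /F E; exact: hM.
have rr : r < rho / 4 by rewrite /r; lra.
have wr : nm w < r by rewrite /r in tpi *; lra.
have n0r : nm (0 : C) < r by rewrite nm0.
have c1 := cauchy_formula hF FM rr wr; have c0 := cauchy_formula hF FM rr n0r.
have FB (w' : C) : nm w' < r -> cbdd (fun z => F (r%:C * z) * (r%:C * z / (r%:C * z - w'))).
  move=> w'r; exists (M * (r * (r - nm w')^-1)) => z z1.
  rewrite nmM; apply: ler_pM; rewrite ?nm_ge0//.
    by apply: FM; rewrite nmM z1 mulr1 nm_real gtr0_norm// /r; lra.
  rewrite !nmM z1 mulr1 nm_real gtr0_norm// ler_wpM2l ?(ltW r0)//.
  by apply: nm_inv_le; [rewrite subr_gt0|exact: nm_circle].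
have Fw : F w = h t by rewrite /F /w addrC subrK upd_id.
have F0 : F 0 = h (upd t i (p 0 i)) by rewrite /F addr0.
apply/eqP; rewrite addrC -subr_eq -Fw -F0 -c1 -c0 -cmeanB; [|exact: FB|exact: FB].
rewrite -cmean_scale; last first.
  exists (M * (r - nm w)^-1) => z z1; rewrite nmM; apply: ler_pM; rewrite ?nm_ge0//.
    by apply: FM; rewrite nmM z1 mulr1 nm_real gtr0_norm// /r; lra.
  by apply: nm_inv_le; [rewrite subr_gt0|exact: nm_circle].
apply/eqP/cmean_ext => z z1; rewrite /Theta -/w -/(F _).
have n1 := circle_neq0 wr z1; have n2 := circle_neq0 n0r z1.
rewrite subr0 in n2 *; field; rewrite n1/=.
by move: n2; rewrite mulf_eq0 negb_or andbC.
Qed.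

End Division.

(** * Determinants and ideals of germs *)

Section GermIdeals.
Variables (R : realType) (k : nat).
Local Notation C := (R[i] : numFieldType).
Local Notation V := 'rV[C]_k.
Variable p : V.
Implicit Types (g h : V -> C) (t : V) (beta : 'I_k -> nat).

Local Notation O := (holomorphic_at p).

Definition crd (l : 'I_k) t : C := t 0 l - p 0 l.

Lemma hol_crd l : O (crd l).
Proof. by apply: holB; [exact: hol_coord|exact: hol_cst]. Qed.

Lemma crd_p l : crd l p = 0. Proof. exact: subrr. Qed.

Lemma holX h n : O h -> O (fun t => h t ^+ n).
Proof.
move=> hh; elim: n => [|n IH]; first by under eq_fun do rewrite expr0; exact: hol_cst.
by under eq_fun do rewrite exprS; exact: holM.
Qed.

Lemma near_upd (P : V -> Prop) i : (\forall t \near p, P t) ->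
  \forall t \near p, P (upd t i (p 0 i)).
Proof.
move=> /nearP_vle[d d0 hd]; apply/nearP_vle; exists d => // t tp; apply: hd => j.
rewrite !mxE; case: eqP => [->|_]; first by rewrite subrr nm0 ltW.
by have := tp j; rewrite !mxE.
Qed.

Lemma hol_upd h i : O h -> O (fun t => h (upd t i (p 0 i))).
Proof.
move=> /(near_upd i); apply: filterS => t /differentiable_vder[L hL].
exact: vder_differentiable (vder_upd hL).
Qed.

(** Coordinates are not zero divisors: where t_i = p_i, the value of h is a
limit of values at points with another i-th coordinate, by continuity. *)
Lemma crd_regular h i : O h -> (\forall t \near p, crd i t * h t = 0) ->
  \forall t \near p, h t = 0.
Proof.
move=> hh h0.
have /nearP_vle[d d0 hd] : \forall t \near p, differentiable h t /\ crd i t * h t = 0.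
  exact: filterI.
apply/nearP_vle; exists (d / 2); first by rewrite divr_gt0.
move=> t tp; have tpd : vle (t - p) d by apply: vle_trans tp; lra.
have [/differentiable_vder[L hL] th] := hd t tpd.
have [xi0|xi] := eqVneq (crd i t) 0; last first.
  by move/eqP: th; rewrite mulf_eq0 (negPf xi) => /eqP.
have [d' d0' hd'] := hL 1 ltr01.
apply: nm_small => e e0; have c0 : 0 < 1 + nm (L i) by have := nm_ge0 (L i); lra.
pose s : R := Num.min (Num.min d' (d / 2)) (e / (1 + nm (L i))).
have s0 : 0 < s by rewrite !lt_min d0' !divr_gt0.
have [sd' sd se] : [/\ s <= d', s <= d / 2 & s <= e / (1 + nm (L i))].
  by rewrite /s !ge_min !lexx ?orbT.
pose v : V := s%:C *: delta_mx 0 i.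
have vs : vle v s.
  move=> j; rewrite !mxE eqxx/=; case: eqP => _.
    by rewrite mulr1 nm_real gtr0_norm.
  by rewrite mulr0 nm0 ltW.
have [_ hv] : differentiable h (t + v) /\ crd i (t + v) * h (t + v) = 0.
  by apply: hd; rewrite addrAC; apply: vle_trans (vleD tp vs); lra.
have cv : crd i (t + v) = s%:C.
  by rewrite /crd !mxE !eqxx/= mulr1 addrAC -/(crd i t) xi0 add0r.
have sC : s%:C != 0 :> C by rewrite -nm_gt0 nm_real gtr0_norm.
move/eqP: hv; rewrite cv mulf_eq0 (negPf sC) => /eqP hv.
have := hd' v s sd' vs (ltW s0); rewrite hv (bigD1 i)//= big1 ?addr0; last first.
  by move=> j ji; rewrite !mxE eqxx/= (negPf ji) mulr0 mulr0.
rewrite !mxE !eqxx/= mulr1 => hh1.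
rewrite -nmN (_ : - h t = (0 - h t - L i * s%:C) + L i * s%:C); last by ring.
apply: (le_trans (nmD _ _)); rewrite nmM nm_real gtr0_norm//.
by move: se; rewrite ler_pdivlMr//; move: hh1; lra.
Qed.

Lemma near_forall_ord n (P : 'I_n -> V -> Prop) :
  (forall l, \forall t \near p, P l t) -> \forall t \near p, forall l, P l t.
Proof. by move=> hP; apply: (@filter_forall V 'I_n P (nbhs p)). Qed.

(** For the partial derivatives of the master function this is [critical_ideal]. *)
Definition ideal_at (phi : 'I_k -> V -> C) h := exists2 u : 'I_k -> V -> C, forall l, O (u l) &
  \forall t \near p, h t = \sum_(j < k) u j t * phi j t.

Section IdealAt.
Variable phi : 'I_k -> V -> C.

Lemma idealD g h : ideal_at phi g -> ideal_at phi h -> ideal_at phi (fun t => g t + h t).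
Proof.
move=> [u hu eu] [v hv ev]; exists (fun l t => u l t + v l t) => [l|].
  exact: holD.
move: eu ev; apply: filterS2 => t -> ->; rewrite -big_split/=.
by apply: eq_bigr => l _; rewrite mulrDl.
Qed.

Lemma idealM g h : O g -> ideal_at phi h -> ideal_at phi (fun t => g t * h t).
Proof.
move=> hg [u hu eu]; exists (fun l t => g t * u l t) => [l|]; first exact: holM.
by move: eu; apply: filterS => t ->; rewrite mulr_sumr; apply: eq_bigr => l _; rewrite mulrA.
Qed.

Lemma ideal0 : ideal_at phi (fun=> 0).
Proof.
exists (fun _ _ => 0) => [l|]; first exact: hol_cst.
by apply: filterE => t; rewrite big1// => l _; rewrite mul0r.
Qed.

Lemma ideal_sum (I : Type) (r : seq I) (P : pred I) (F : I -> V -> C) :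
  (forall i, P i -> ideal_at phi (F i)) -> ideal_at phi (fun t => \sum_(i <- r | P i) F i t).
Proof.
move=> hF; elim: r => [|i r IH].
  by under eq_fun do rewrite big_nil; exact: ideal0.
under eq_fun do rewrite big_cons; case Pi: (P i) => //.
by apply: idealD => //; exact: hF.
Qed.

Lemma ideal_gen l : ideal_at phi (phi l).
Proof.
exists (fun j t => (j == l)%:R) => [j|]; first exact: hol_cst.
apply: filterE => t; rewrite (bigD1 l)//= eqxx mul1r big1 ?addr0// => j /negPf ->.
by rewrite mul0r.
Qed.

Lemma ideal_near g h : (\forall t \near p, g t = h t) -> ideal_at phi g -> ideal_at phi h.
Proof.
by move=> gh [u hu eu]; exists u => //; move: gh eu; apply: filterS2 => t <-.
Qed.

End IdealAt.

Definition mono_ideal beta := ideal_at (fun l t => crd l t ^+ beta l).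

(** The coordinates form a regular sequence. In an expression of x_i h, split
the coefficient of each x_l ^ beta_l with l <> i into its value at t_i = p_i and
a multiple of x_i. The former cancel out, as one sees on setting t_i = p_i, and
x_i can be removed from the rest. *)
Lemma mono_ideal_colon beta i h : O h ->
  mono_ideal (fun l => beta l + (l == i))%N (fun t => crd i t * h t) -> mono_ideal beta h.
Proof.
move=> hh [u hu eu0].
have eu : \forall t \near p, crd i t * h t = \sum_l crd l t ^+ (beta l + (l == i)) * u l t.
  by move: eu0; apply: filterS => t ->; apply: eq_bigr => l _; rewrite mulrC.
have /choice[w hw] : forall l, exists w, O w /\ \forall t \near p,
    u l t = u l (upd t i (p 0 i)) + crd i t * w t.
  by move=> l; have [w h1 h2] := divide_coord i (hu l); exists w.
pose v l := if l == i then u l else w l.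
exists v => [l|]; first by rewrite /v; case: eqP => _ //; have [] := hw l.
have hv l : O (v l) by rewrite /v; case: eqP => _ //; have [] := hw l.
pose g t := h t - \sum_l crd l t ^+ beta l * v l t.
have hg : O g.
  apply: holB => //; apply: hol_sum => l _; apply: holM => //; apply: holX; exact: hol_crd.
have : \forall t \near p, g t = 0.
  apply: (crd_regular (i := i)) => //.
  have ew : \forall t \near p, forall l, u l t = u l (upd t i (p 0 i)) + crd i t * w l t.
    by apply: near_forall_ord => l; have [] := hw l.
  have := near_upd i eu; move: eu ew; apply: filterS3 => t e1 e2 e3.
  have cu l : l != i -> crd l (upd t i (p 0 i)) = crd l t.
    by move=> li; rewrite /crd mxE (negPf li).
  have ci : crd i (upd t i (p 0 i)) = 0 by rewrite /crd mxE eqxx subrr.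
  move: e3; rewrite ci mul0r (bigD1 i)//= eqxx addn1 exprS ci !mul0r add0r => e3.
  rewrite /g mulrBr e1 (bigD1 i)//= [X in _ - _ * X](bigD1 i)//= eqxx addn1 exprS.
  have -> : v i t = u i t by rewrite /v eqxx.
  rewrite mulrDr !mulrA opprD addrACA subrr add0r.
  rewrite (eq_bigr (fun l => crd l (upd t i (p 0 i)) ^+ (beta l + (l == i)) * u l (upd t i (p 0 i))
     + crd i t * (crd l t ^+ beta l * v l t))).
    by rewrite big_split/= -e3 add0r mulr_sumr subrr.
  by move=> l li; rewrite /v (negPf li) (cu l li) addn0 (e2 l); ring.
apply: filterS => t /eqP; rewrite subr_eq0 => /eqP ->.
by apply: eq_bigr => l _; rewrite mulrC.
Qed.

(** By [mono_ideal_colon] the coordinates of the product can be removed one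
by one, until 1 would be in an ideal of functions that vanish at p. *)
Lemma mono_ideal_top (n : nat) (gam : 'I_k -> nat) : (\sum_l gam l = n)%N ->
  ~ mono_ideal (fun l => (gam l).+1) (fun t => \prod_l crd l t ^+ gam l).
Proof.
elim: n gam => [|n IH] gam hn.
  move=> [u hu /nbhs_singleton].
  rewrite big1 => [|l _]; last first.
    by move/eqP: hn; rewrite sum_nat_eq0 => /forallP/(_ l)/eqP ->.
  rewrite big1 => [/eqP|l _]; first by rewrite oner_eq0.
  by rewrite crd_p expr0n mulr0.
have [i gi] : exists i, (0 < gam i)%N.
  apply/existsP; apply: contraT => /existsPn nex.
  move: hn; rewrite big1 // => i _; apply/eqP; rewrite -leqn0 leqNgt; exact: nex.
pose gam' l := (gam l - (l == i))%N.
have gE l : gam l = (gam' l + (l == i))%N.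
  by rewrite /gam' subnK//; case: eqP => [->|].
have hn' : (\sum_l gam' l = n)%N.
  apply: (@addIn 1); rewrite [RHS]addn1 -hn.
  rewrite [RHS](eq_bigr (fun l => gam' l + (l == i))%N); last by move=> l _; exact: gE.
  rewrite big_split/=; congr addn; rewrite (bigD1 i)//= eqxx big1// => l /negPf.
  by move=> ->.
move=> hm; apply: (IH gam' hn'); apply: (@mono_ideal_colon _ i).
  by apply: hol_prod => l _; apply: holX; exact: hol_crd.
have -> : (fun l => (gam' l).+1 + (l == i))%N = (fun l => (gam l).+1).
  by apply/funext => l; rewrite addSn -gE.
apply: ideal_near hm; apply: filterE => t.
rewrite (bigD1 i)//= [in RHS](bigD1 i)//= mulrA -exprS; congr (_ ^+ _ * _).
  by rewrite gE eqxx addn1.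
by apply: eq_bigr => l /negPf li; rewrite gE li addn0.
Qed.

Lemma hol_adj n (A : 'I_n -> 'I_n -> V -> C) i j : (forall i j, O (A i j)) ->
  O (fun t => (\adj (\matrix_(i, j) A i j t)) i j).
Proof.
case: n A i j => [A []//|n] A i j hA.
under eq_fun do rewrite mxE /cofactor.
apply: holM; first exact: hol_cst.
rewrite (_ : (fun t => _) = (fun t => \det (\matrix_(i', j') A (lift j i') (lift i j') t))).
  by apply: hol_det => i' j'.
by apply/funext => t; congr (\det _); apply/matrixP => i' j'; rewrite !mxE.
Qed.

(** Cramer's rule. *)
Lemma adj_row_sum n (A : 'M[C]_n) (x : 'I_n -> C) i :
  \det A * x i = \sum_l (\adj A) i l * \sum_m A l m * x m.
Proof.
transitivity ((\adj A *m A *m \col_m x m) i 0).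
  by rewrite mul_adj_mx mul_scalar_mx !mxE.
rewrite -mulmxA mxE; apply: eq_bigr => l _; congr (_ * _).
by rewrite mxE; apply: eq_bigr => m _; rewrite mxE.
Qed.

(** By Cramer's rule x_i times the determinant is a combination of the x_l ^ N
with l <> i, and x_i can be removed by [mono_ideal_colon]. *)
Lemma det_mono_ideal (N : nat) i (A : 'I_k -> 'I_k -> V -> C) : (forall i j, O (A i j)) ->
  (\forall t \near p, forall l, \sum_m A l m t * crd m t = if l == i then 0 else crd l t ^+ N) ->
  mono_ideal (fun=> N) (fun t => \det (\matrix_(l, m) A l m t)).
Proof.
move=> hA eA; apply: (@mono_ideal_colon _ i); first exact: hol_det.
pose F l t := if l == i then 0 else (\adj (\matrix_(l, m) A l m t)) i l * crd l t ^+ N.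
apply: (@ideal_near _ (fun t => \sum_l F l t)).
  move: eA; apply: filterS => t e; rewrite mulrC (adj_row_sum _ (fun m => crd m t)).
  apply: eq_bigr => l _; rewrite /F; under [in RHS]eq_bigr do rewrite mxE.
  by rewrite e; case: ifP => _ //; rewrite mulr0.
apply: ideal_sum => l _; rewrite /F; case: (eqVneq l i) => li; first exact: ideal0.
apply: idealM; first exact: hol_adj.
by have := ideal_gen (fun l' t => crd l' t ^+ (N + (l' == i))) l; rewrite (negPf li) addn0.
Qed.

(** Write x_l ^ (N + 1) as the sum of the M'_lj phi_j and put D = M' M. If det M
were in the ideal of the phi_j, then det D would be in that of the
x_l ^ (N + 1), since det(M') phi_j is, by Cramer's rule. As D x is the vector of
the x_l ^ (N + 1), like diag(x_l ^ N) x, the rows of D can be replaced one at a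
time by those of diag(x_l ^ N) without leaving the ideal, by [det_mono_ideal].
At the end the product of the x_l ^ N is in the ideal, against
[mono_ideal_top]. *)
Lemma transition_det_notin (N : nat) (phi : 'I_k -> V -> C) (M : 'I_k -> 'I_k -> V -> C) :
  (forall j l, O (M j l)) ->
  (\forall t \near p, forall j, phi j t = \sum_l M j l t * crd l t) ->
  (forall l, ideal_at phi (fun t => crd l t ^+ N.+1)) ->
  ~ ideal_at phi (fun t => \det (\matrix_(j, l) M j l t)).
Proof.
move=> hM eM hN [u hu eu].
have /choice[M' hM'] : forall l, exists M' : 'I_k -> V -> C, (forall j, O (M' j)) /\
    \forall t \near p, crd l t ^+ N.+1 = \sum_j M' j t * phi j t.
  by move=> l; have [M' h1 h2] := hN l; exists M'.
have hM1 l j : O (M' l j) by have [] := hM' l.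
have eM1 : \forall t \near p, forall l, crd l t ^+ N.+1 = \sum_j M' l j t * phi j t.
  by apply: near_forall_ord => l; have [] := hM' l.
pose D l m t := \sum_j M' l j t * M j m t.
have hD l m : O (D l m) by apply: hol_sum => j _; exact: holM.
have eD : \forall t \near p, forall l, \sum_m D l m t * crd m t = crd l t ^+ N.+1.
  move: eM eM1; apply: filterS2 => t e1 e2 l; rewrite e2.
  under eq_bigr do rewrite mulr_suml; rewrite exchange_big/=.
  by apply: eq_bigr => j _; rewrite e1 mulr_sumr; apply: eq_bigr => m _; rewrite mulrA.
(* D with its first q rows replaced by those of diag(x_l ^ N) *)
pose Z (q : nat) (l m : 'I_k) t := if (l < q)%N then (if l == m then crd l t ^+ N else 0) else D l m t.
have hZ q l m : O (Z q l m).
  rewrite /Z; case: (l < q)%N => //; case: (l == m); last exact: hol_cst.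
  by apply: holX; exact: hol_crd.
have Z0 : mono_ideal (fun=> N.+1) (fun t => \det (\matrix_(l, m) Z 0 l m t)).
  pose G j t := u j t * \sum_l (\adj (\matrix_(l, j) M' l j t)) j l * crd l t ^+ N.+1.
  apply: (@ideal_near _ (fun t => \sum_j G j t)).
    move: eu eM1; apply: filterS2 => t e1 e2.
    have -> : \matrix_(l, m) Z 0%N l m t = (\matrix_(l, j) M' l j t) *m (\matrix_(j, m) M j m t).
      by apply/matrixP => l m; rewrite !mxE; apply: eq_bigr => j _; rewrite !mxE.
    rewrite det_mulmx e1 mulr_sumr; apply: eq_bigr => j _; rewrite /G mulrCA; congr (_ * _).
    rewrite (adj_row_sum _ (fun j => phi j t)); apply: eq_bigr => l _; rewrite e2.
    by congr (_ * _); apply: eq_bigr => m _; rewrite mxE.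
  apply: ideal_sum => j _; apply: idealM => //.
  apply: ideal_sum => l _; apply: idealM; first exact: hol_adj.
  exact: (ideal_gen (fun l t => crd l t ^+ N.+1)).
have Zq q : (q <= k)%N -> mono_ideal (fun=> N.+1) (fun t => \det (\matrix_(l, m) Z q l m t)).
  elim: q => [//|q IH] qk; pose i := Ordinal qk.
  (* row i of A is the difference of the old and the new row i, killed by x *)
  pose A (l m : 'I_k) t := if l == i then D i m t - (if i == m then crd i t ^+ N else 0) else Z q l m t.
  have hA l m : O (A l m).
    rewrite /A; case: (l == i) => //; apply: holB => //; case: (i == m); last exact: hol_cst.
    by apply: holX; exact: hol_crd.
  have dA : mono_ideal (fun=> N.+1) (fun t => \det (\matrix_(l, m) A l m t)).
    apply: (det_mono_ideal (i := i)) => //; move: eD; apply: filterS => t e l.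
    rewrite /A; have [_|li] := eqVneq l i.
      under eq_bigr do rewrite mulrBl; rewrite sumrB e (bigD1 i)//= eqxx big1 ?addr0.
        by rewrite -exprSr subrr.
      by move=> m; rewrite eq_sym => /negPf ->; rewrite mul0r.
    rewrite /Z; case: (l < q)%N; last by rewrite e.
    rewrite (bigD1 l)//= eqxx big1 ?addr0; first by rewrite exprSr.
    by move=> m; rewrite eq_sym => /negPf ->; rewrite mul0r.
  have := idealD (IH (ltnW qk)) (idealM (hol_cst p (-1)) dA).
  apply: ideal_near; apply: filterE => t.
  rewrite mulN1r; apply/eqP; rewrite subr_eq; apply/eqP.
  rewrite -[RHS]addrC -[X in X + _]mul1r -[X in _ + X]mul1r.
  apply: (determinant_multilinear (i0 := i)).
  - apply/rowP => m; rewrite !mxE /A eqxx /Z ltnn ltnS leqnn !mul1r.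
    by rewrite addrC; case: eqP => _; ring.
  - by apply/matrixP => l m; rewrite !mxE /A eq_sym (negPf (neq_lift _ _)).
  - apply/matrixP => l m; rewrite !mxE /Z ltnS leq_eqVlt; congr (if _ then _ else _).
    have : lift i l != i by rewrite eq_sym neq_lift.
    by rewrite -val_eqE/= => /negPf ->.
apply: (@mono_ideal_top (\sum_(l < k) N) (fun=> N)) => //.
apply: ideal_near (Zq k (leqnn k)); apply: filterE => t.
rewrite (_ : \matrix_(l, m) _ = diag_mx (\row_l crd l t ^+ N)).
  by rewrite det_diag; apply: eq_bigr => l _; rewrite mxE.
apply/matrixP => l m; rewrite !mxE /Z ltn_ord; case: eqP => _; rewrite ?mulr1n//.
Qed.

End GermIdeals.

(** * Local algebras of finite length *)

Section QuotientDimension.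
Variables (K : fieldType) (T : Type) (E I : set (T -> K)).

(** A spanning family of minimal size is a basis. *)
Lemma quotient_dim_exists (F : finType) (e : F -> T -> K) :
  (forall c g h, I g -> I h -> I (fun t => g t + c * h t)) ->
  (forall f, E (e f)) ->
  (forall h, E h -> exists c : F -> K, I (fun t => h t - \sum_f c f * e f t)) ->
  exists d, has_quotient_dim E I d.
Proof.
move=> Ilin Ee hspan.
pose P d := `[< exists e : 'I_d -> T -> K, (forall i, E (e i)) /\
  forall h, E h -> exists c : 'I_d -> K, I (fun t => h t - \sum_i c i * e i t) >].
have exP : exists d, P d.
  exists #|F|; apply/asboolP; exists (fun i => e (enum_val i)); split=> // h /hspan[c hc].
  exists (fun i => c (enum_val i)); congr I: hc; apply/funext => t; congr (_ - _).
  by rewrite (reindex_onto (@enum_val F _) enum_rank)/=; [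
    apply: eq_bigl => i; rewrite enum_valK eqxx | move=> f _; rewrite enum_rankK].
case: (ex_minnP exP) => d /asboolP[e' [Ee' hspan']] mind; exists d; exists e' => // h Eh.
have [c hc] := hspan' h Eh; exists (\row_i c i); split.
  by congr I: hc; apply/funext => t; congr (_ - _); apply: eq_bigr => i _; rewrite mxE.
move=> c' hc'; apply/rowP => i0; rewrite mxE; apply/eqP; apply: contraT => neq.
case: d e' Ee' hspan' mind c hc c' hc' i0 neq => [|d] e' Ee' hspan' mind c hc c' hc' i0 neq.
  by case: i0 neq.
suff /mind : P d by rewrite ltnn.
apply/asboolP; exists (fun i => e' (lift i0 i)); split=> // g Eg.
have [cg hg] := hspan' g Eg.
pose dl i := c' 0 i - c i.
have d0 : dl i0 != 0 by rewrite subr_eq0 eq_sym.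
have hd : I (fun t => \sum_i dl i * e' i t).
  have := Ilin (-1) _ _ hc hc'; congr I; apply/funext => t.
  rewrite mulN1r opprB addrC addrA subrK -sumrB.
  by apply: eq_bigr => i _; rewrite -mulrBl.
exists (fun i => cg (lift i0 i) - cg i0 / dl i0 * dl (lift i0 i)).
have := Ilin (cg i0 / dl i0) _ _ hg hd; congr I; apply/funext => t.
rewrite !(bigD1_ord i0)//=.
rewrite [in RHS](eq_bigr (fun i => cg (lift i0 i) * e' (lift i0 i) t -
  cg i0 / dl i0 * (dl (lift i0 i) * e' (lift i0 i) t))); last first.
  by move=> i _; ring.
by rewrite sumrB -mulr_sumr; field.
Qed.

End QuotientDimension.

Section FiniteLength.
Variables (R : realType) (k : nat).
Local Notation C := (R[i] : numFieldType).
Local Notation V := 'rV[C]_k.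
Variable p : V.
Variable phi : 'I_k -> V -> C.
Implicit Types (g h : V -> C) (t : V).

Local Notation O := (holomorphic_at p).
Local Notation J := (ideal_at p phi).
Local Notation x := (crd p).

Definition reset (r : seq 'I_k) t : V := \row_j (if j \in r then p 0 j else t 0 j).

Lemma reset_cons l r t : reset r (upd t l (p 0 l)) = reset (l :: r) t.
Proof. by apply/rowP => j; rewrite !mxE inE; case: eqP => [->|_]; case: ifP. Qed.

Lemma hol_reset h r : O h -> O (fun t => h (reset r t)).
Proof.
move=> hh; elim: r => [|l r IH].
  by rewrite (_ : (fun t => _) = h)//; apply/funext => t; congr h; apply/rowP => j; rewrite mxE.
by under eq_fun do rewrite -reset_cons; exact: (hol_upd l IH).
Qed.

(** Hadamard's lemma, from [divide_coord] for one coordinate after the other. *)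
Lemma hol_expand h : O h -> exists2 u : 'I_k -> V -> C, forall l, O (u l) &
  \forall t \near p, h t = h p + \sum_l x l t * u l t.
Proof.
move=> hh.
have [u hu eu] : exists2 u : 'I_k -> V -> C, forall l, O (u l) &
    \forall t \near p, h t = h (reset (enum 'I_k) t) + \sum_(l <- enum 'I_k) x l t * u l t.
  elim: (enum 'I_k) (enum_uniq 'I_k) => [_|l r IH /= /andP[lr ur]].
    exists (fun _ _ => 0) => [l|]; first exact: hol_cst.
    apply: filterE => t; rewrite big_nil addr0; congr h.
    by apply/rowP => j; rewrite mxE.
  have [u hu eu] := IH ur.
  have [w hw ew] := divide_coord l (hol_reset r hh).
  exists (fun j => if j == l then w else u j) => [j|]; first by case: (j == l).
  move: eu ew; apply: filterS2 => t -> ->; rewrite reset_cons big_cons eqxx -addrA.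
  congr (_ + (_ + _)); apply: eq_big_seq => j jr.
  by have /negPf -> : j != l by apply: contraNneq lr => <-.
exists u => //; move: eu; apply: filterS => t ->; rewrite big_enum/=; congr (h _ + _).
by apply/rowP => j; rewrite mxE mem_enum.
Qed.

Lemma prod_count (F : 'I_k -> C) (s : seq 'I_k) :
  \prod_(l <- s) F l = \prod_l F l ^+ count_mem l s.
Proof.
elim: s => [|a s IH]; first by rewrite big_nil big1.
rewrite big_cons IH; under [in RHS]eq_bigr do rewrite /= exprD.
rewrite big_split/=; congr (_ * _); rewrite (bigD1 a)//= eqxx expr1 big1 ?mulr1// => l.
by rewrite eq_sym => /negPf ->.
Qed.

Lemma size_count (s : seq 'I_k) : size s = (\sum_l count_mem l s)%N.
Proof.
elim: s => [|a s IH]; first by rewrite big1.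
rewrite /= big_split/= -IH -add1n; congr addn; rewrite (bigD1 a)//= eqxx big1 ?addn0// => l.
by rewrite eq_sym => /negPf ->.
Qed.

(** By the pigeonhole principle some coordinate occurs at least m times. *)
Lemma long_prod_in_ideal m (s : seq 'I_k) : (forall l, J (fun t => x l t ^+ m)) ->
  (k * m < size s)%N -> J (fun t => \prod_(l <- s) x l t).
Proof.
move=> hx ks; have [l lm] : exists l, (m <= count_mem l s)%N.
  apply/existsP; apply: contraT => /existsPn nex.
  move: ks; rewrite size_count ltnNge => /negP; case.
  have -> : (k * m = \sum_(l < k) m)%N by rewrite sum_nat_const card_ord.
  by apply: leq_sum => l _; rewrite ltnW// ltnNge; exact: nex.
apply: (@ideal_near _ _ _ _ (fun t => (x l t ^+ (count_mem l s - m) *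
    \prod_(j | j != l) x j t ^+ count_mem j s) * x l t ^+ m)).
  by apply: filterE => t; rewrite prod_count [RHS](bigD1 l)//= mulrAC -exprD subnK.
apply: idealM => //; apply: holM; first by apply: holX; exact: hol_crd.
by apply: hol_prod => j _; apply: holX; exact: hol_crd.
Qed.

Definition spanned_by_products N h := exists c : {n : 'I_N & (n : nat).-tuple 'I_k} -> C,
  J (fun t => h t - \sum_f c f * \prod_(l <- tagged f) x l t).

Lemma spannedD N g h : spanned_by_products N g -> spanned_by_products N h ->
  spanned_by_products N (fun t => g t + h t).
Proof.
move=> [c hc] [c' hc']; exists (fun f => c f + c' f).
apply: ideal_near (idealD hc hc'); apply: filterE => t.
rewrite [X in _ = _ - X](eq_bigr (fun f => c f * (\prod_(l <- tagged f) x l t)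
   + c' f * (\prod_(l <- tagged f) x l t))); last by move=> f _; rewrite mulrDl.
by rewrite big_split/=; ring.
Qed.

Lemma spanned_ideal N h : J h -> spanned_by_products N h.
Proof.
move=> Jh; exists (fun=> 0); apply: ideal_near Jh; apply: filterE => t.
by rewrite big1 ?subr0// => f _; rewrite mul0r.
Qed.

Lemma spanned_near N g h : (\forall t \near p, g t = h t) ->
  spanned_by_products N g -> spanned_by_products N h.
Proof.
move=> gh [c hc]; exists c; apply: ideal_near hc; move: gh; apply: filterS => t ->.
by [].
Qed.

(** Expanding repeatedly by [hol_expand] leaves a remainder made of products of
N coordinates. *)
Lemma spanned_all N : (forall s : seq 'I_k, size s = N -> J (fun t => \prod_(l <- s) x l t)) ->
  forall h, O h -> spanned_by_products N h.
Proof.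
move=> hN h Oh.
suff key j s u : (size s + j)%N = N -> O u ->
    spanned_by_products N (fun t => (\prod_(l <- s) x l t) * u t).
  apply: spanned_near (key N [::] h (add0n _) Oh); apply: filterE => t.
  by rewrite big_nil mul1r.
elim: j s u => [|j IH] s u hs Ou.
  rewrite addn0 in hs; apply: spanned_ideal.
  apply: ideal_near (idealM Ou (hN s hs)); apply: filterE => t.
  by rewrite mulrC.
have sN : (size s < N)%N by rewrite -hs -addn1 leq_add2l.
have [w hw ew] := hol_expand Ou.
have h1 : spanned_by_products N (fun t => (\prod_(l <- s) x l t) * u p).
  pose f0 : {n : 'I_N & (n : nat).-tuple 'I_k} :=
    existT (fun n : 'I_N => (n : nat).-tuple 'I_k) (Ordinal sN) (in_tuple s).
  exists (fun f => if f == f0 then u p else 0).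
  apply: (@ideal_near _ _ _ _ (fun=> 0)); last exact: ideal0.
  apply: filterE => t; rewrite (bigD1 f0)//= eqxx [X in _ - (_ + X)]big1 ?addr0.
    by rewrite [u p * _]mulrC subrr.
  by move=> f /negPf ->; rewrite mul0r.
have h2 (r : seq 'I_k) : spanned_by_products N
    (fun t => \sum_(l <- r) (\prod_(l' <- l :: s) x l' t) * w l t).
  elim: r => [|l r IHr].
    by apply: spanned_ideal; under eq_fun do rewrite big_nil; exact: ideal0.
  apply: (spanned_near _ (spannedD (IH (l :: s) (w l) _ (hw l)) IHr)).
    by apply: filterE => t; rewrite [RHS]big_cons.
  by rewrite /= addSnnS.
apply: (spanned_near _ (spannedD h1 (h2 (index_enum 'I_k)))).
move: ew; apply: filterS => t ->; rewrite mulrDr mulr_sumr; congr (_ + _).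
by apply: eq_bigr => l _; rewrite big_cons mulrA; congr (_ * _); rewrite mulrC.
Qed.

Lemma finite_length m : (forall l, J (fun t => x l t ^+ m)) ->
  exists mu, has_quotient_dim O J mu.
Proof.
move=> hx; pose N := (k * m).+1.
apply: (@quotient_dim_exists _ _ _ _ {n : 'I_N & (n : nat).-tuple 'I_k}
  (fun f t => \prod_(l <- tagged f) x l t)).
- by move=> c g h Jg Jh; apply: idealD => //; apply: idealM => //; exact: hol_cst.
- by move=> f; apply: hol_prod => l _; exact: hol_crd.
- move=> h Oh; apply: (@spanned_all N) => // s sN.
  by apply: (long_prod_in_ideal hx); rewrite sN.
Qed.

Definition nilgerm u := O u /\ exists m, J (fun t => u t ^+ m).

Lemma nilgermM g u : O g -> nilgerm u -> nilgerm (fun t => g t * u t).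
Proof.
move=> Og [Ou [m hm]]; split; first exact: holM.
exists m; apply: ideal_near (idealM (holX m Og) hm).
by apply: filterE => t; rewrite exprMn.
Qed.

Lemma nilgerm_pow u m : O u -> J (fun t => u t ^+ m) -> forall n, (m <= n)%N -> J (fun t => u t ^+ n).
Proof.
move=> Ou hm n mn; apply: ideal_near (idealM (holX (n - m) Ou) hm).
by apply: filterE => t; rewrite -exprD subnK.
Qed.

Lemma nilgermD u v : nilgerm u -> nilgerm v -> nilgerm (fun t => u t + v t).
Proof.
move=> [Ou [m hm]] [Ov [n hn]]; split; first exact: holD.
exists (m + n)%N.
apply: (@ideal_near _ _ _ _ (fun t => \sum_(i < (m + n).+1) (u t ^+ (m + n - i) * v t ^+ i) *+ 'C(m + n, i))).
  by apply: filterE => t; rewrite exprDn.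
apply: ideal_sum => i _.
have [ni|ni] := leqP n i.
  apply: (@ideal_near _ _ _ _ (fun t => ('C(m + n, i)%:R * u t ^+ (m + n - i)) * v t ^+ i)).
    by apply: filterE => t; rewrite -mulr_natl; ring.
  apply: idealM; first by apply: holM; [exact: hol_cst|exact: holX].
  exact: nilgerm_pow hn _ ni.
apply: (@ideal_near _ _ _ _ (fun t => ('C(m + n, i)%:R * v t ^+ i) * u t ^+ (m + n - i))).
  by apply: filterE => t; rewrite -mulr_natl; ring.
apply: idealM; first by apply: holM; [exact: hol_cst|exact: holX].
by apply: (nilgerm_pow Ou hm); rewrite -addnBA ?leq_addr// ltnW.
Qed.

Lemma nilgerm_near u v : (\forall t \near p, u t = v t) -> O v -> nilgerm u -> nilgerm v.
Proof.
move=> uv Ov [_ [m hm]]; split=> //; exists m; apply: ideal_near hm.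
by move: uv; apply: filterS => t ->.
Qed.

Lemma nilgerm_sum (I : Type) (r : seq I) (F : I -> V -> C) :
  (forall i, nilgerm (F i)) -> nilgerm (fun t => \sum_(i <- r) F i t).
Proof.
move=> hF; elim: r => [|i r IH].
  under eq_fun do rewrite big_nil; split; first exact: hol_cst.
  by exists 1; under eq_fun do rewrite expr1; exact: ideal0.
by under eq_fun do rewrite big_cons; exact: nilgermD.
Qed.

(** Modulo the ideal, the germs eps_i form an eigenvector of X for the eigenvalue
y, so that the characteristic polynomial of X at y kills them. Its factors
y - c with c <> y(p), and one of the eps_i, are units, and a power of y - y(p)
remains. *)
Lemma eigen_nilgerm m (X : 'M[C]_m) (eps : 'I_m -> V -> C) (y : V -> C) : O y ->
  (forall i, O (eps i)) ->
  (forall i, J (fun t => y t * eps i t - \sum_j X i j * eps j t)) ->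
  (exists i, eps i p != 0) -> nilgerm (fun t => y t - y p).
Proof.
move=> Oy Oe hX [i0 ei0]; split; first by apply: holB => //; exact: hol_cst.
pose A i j t : C := y t *+ (i == j) - X i j.
have OA i j : O (A i j).
  apply: holB; last exact: hol_cst.
  by case: (i == j); [exact: Oy|exact: hol_cst].
have h1 : J (fun t => \det (\matrix_(i, j) A i j t) * eps i0 t).
  apply: (@ideal_near _ _ _ _ (fun t => \sum_l (\adj (\matrix_(i, j) A i j t)) i0 l *
     (y t * eps l t - \sum_j X l j * eps j t))).
    apply: filterE => t; rewrite (adj_row_sum _ (fun j => eps j t)).
    apply: eq_bigr => l _; congr (_ * _).
    rewrite [RHS](eq_bigr (fun j => (y t *+ (l == j)) * eps j t - X l j * eps j t)); last first.
      by move=> j _; rewrite mxE mulrBl.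
    rewrite sumrB [X in _ = X - _](bigD1 l)//= eqxx [X in _ = _ + X - _]big1 ?addr0// => j.
    by rewrite eq_sym => /negPf ->; rewrite mul0r.
  by apply: ideal_sum => l _; apply: idealM => //; exact: hol_adj.
have [r hr] := closed_field_poly_normal (char_poly X).
rewrite (monicP (char_poly_monic X)) scale1r in hr.
have dE t : \det (\matrix_(i, j) A i j t) = \prod_(c <- r) (y t - c).
  transitivity (char_poly X).[y t].
    rewrite /char_poly -horner_evalE -det_map_mx; congr (\det _).
    apply/matrixP => i j; rewrite [LHS]mxE.
    transitivity ((char_poly_mx X i j).[y t]); last by rewrite [RHS]mxE.
    by rewrite !mxE hornerD hornerN hornerMn hornerX hornerC.
  by rewrite hr horner_prod; apply: eq_bigr => c _; rewrite hornerXsubC.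
pose unit_part t := \prod_(c <- r | c != y p) (y t - c).
have Ou : O unit_part by apply: hol_prod => c _; apply: holB => //; exact: hol_cst.
have u0 : unit_part p * eps i0 p != 0.
  rewrite mulf_neq0// prodf_seq_neq0; apply/allP => c _; apply/implyP.
  by rewrite subr_eq0 eq_sym.
have Oue : O (fun t => unit_part t * eps i0 t) by exact: holM.
(* the multiplicity of y p as an eigenvalue of X *)
exists (count_mem (y p) r).
apply: ideal_near (idealM (holV Oue u0) h1).
have := hol_neq0 Oue u0; apply: filterS => t nt.
rewrite dE (bigID (fun c => c != y p))/= -/(unit_part t).
have -> : \prod_(c <- r | ~~ (c != y p)) (y t - c) = (y t - y p) ^+ count_mem (y p) r.
  rewrite (eq_bigl (fun c => c == y p)); last by move=> c; rewrite negbK.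
  rewrite (eq_bigr (fun=> y t - y p)); last by move=> c /eqP ->.
  by rewrite big_const_seq iter_mulr mulr1.
by rewrite mulrAC mulrA mulVf// mul1r.
Qed.

End FiniteLength.

(** * Bases of linear forms and circuits *)

Section Bases.
Variables (K : numFieldType) (n k : nat) (b : 'M[K]_(n, k)).
Implicit Types (f : {ffun 'I_k -> 'I_n}) (j : 'I_n).

(** Ordered bases, so that exchanging an element is a change of value. *)
Definition isbasis f := rowsub f b \in unitmx.

Lemma row_rowsub f (i : 'I_k) : row i (rowsub f b) = row (f i) b.
Proof. by apply/rowP => l; rewrite !mxE. Qed.

Lemma basis_free f (mu : 'I_k -> K) : isbasis f ->
  \sum_i mu i *: row (f i) b = 0 -> forall i, mu i = 0.
Proof.
move=> fb h i; have : (\row_i mu i) *m rowsub f b = 0.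
  by rewrite mulmx_sum_row -[RHS]h; apply: eq_bigr => l _; rewrite mxE row_rowsub.
move=> /(congr1 (mulmxr (invmx (rowsub f b)))) /=; rewrite mulmxK// mul0mx.
by move=> /rowP/(_ i); rewrite !mxE.
Qed.

Lemma basis_inj f : isbasis f -> injective f.
Proof.
move=> fb i i' ff; apply/eqP; apply: contraT => ii'.
have := @basis_free f (fun l => (l == i)%:R - (l == i')%:R) fb _ i.
rewrite eqxx (negPf ii') subr0 => h; have /h/eqP : \sum_l ((l == i)%:R - (l == i')%:R) *: row (f l) b = 0.
  under eq_bigr do rewrite scalerBl; rewrite sumrB (bigD1 i)//= eqxx big1.
    rewrite (bigD1 i')//= eqxx big1 ?addr0 ?ff ?subrr// => l /negPf ->.
    by rewrite scale0r.
  by move=> l /negPf ->; rewrite scale0r.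
by rewrite oner_eq0.
Qed.

Definition coords f j : 'I_k -> K := fun i => (row j b *m invmx (rowsub f b)) 0 i.

Lemma coordsE f j : isbasis f -> row j b = \sum_i coords f j i *: row (f i) b.
Proof.
move=> fb; rewrite -[LHS](mulmxKV fb) mulmx_sum_row.
by apply: eq_bigr => i _; rewrite row_rowsub.
Qed.

Lemma unitmx_ker (A : 'M[K]_k) : (forall u : 'rV_k, u *m A = 0 -> u = 0) -> A \in unitmx.
Proof.
move=> h; rewrite -row_free_unit -kermx_eq0; apply/rowV0P => u /sub_kermxP.
exact: h.
Qed.

Definition exchange f (i : 'I_k) j : {ffun 'I_k -> 'I_n} :=
  [ffun i' => if i' == i then j else f i'].

Lemma exchange_basis f i j : isbasis f -> coords f j i != 0 -> isbasis (exchange f i j).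
Proof.
move=> fb ci; apply: unitmx_ker => u.
rewrite mulmx_sum_row => hu.
have h2 : \sum_l (u 0 i * coords f j l + (if l == i then 0 else u 0 l)) *: row (f l) b = 0.
  rewrite -[RHS]hu; under eq_bigr do rewrite scalerDl.
  rewrite big_split/= [in RHS](bigD1 i)//= row_rowsub ffunE eqxx; congr (_ + _).
    by rewrite (coordsE j fb) scaler_sumr; apply: eq_bigr => l _; rewrite scalerA.
  rewrite [LHS](bigD1 i)//= eqxx scale0r add0r; apply: eq_bigr => l li.
  by rewrite row_rowsub ffunE (negPf li).
have h3 := basis_free fb h2.
have ui : u 0 i = 0.
  by have /eqP := h3 i; rewrite eqxx addr0 mulf_eq0 (negPf ci) orbF => /eqP.
apply/rowP => l; rewrite mxE; have := h3 l; rewrite ui mul0r add0r.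
by case: eqP => [->|].
Qed.

Lemma spanning_basis : <<[seq row j b | j <- enum 'I_n]>>%VS = fullv -> exists f, isbasis f.
Proof.
move=> hspan; have fA : row_full b.
  rewrite -sub1mx; apply/row_subP => i.
  have : row i 1%:M \in <<[tuple of [seq row j b | j <- enum 'I_n]]>>%VS.
    by rewrite hspan memvf.
  move=> /coord_span ->; apply: summx_sub => l _; apply: scalemx_sub.
  by rewrite (nth_map (enum_default l)) -?cardE//; exact: row_sub.
by exists (fullrankfun fA); rewrite /isbasis -row_full_unit fullrowsub_full.
Qed.

Lemma indep_enumP (D : {set 'I_n}) :
  reflect (forall mu : 'I_n -> K, \sum_(j in D) mu j *: row j b = 0 ->
     forall j, j \in D -> mu j = 0) (indep_family b (enum D)).
Proof.
have nthE (i : 'I_#|D|) : [tuple of [seq row j b | j <- enum D]]`_i = row (enum_val i) b.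
  by rewrite (nth_map (enum_default i)) -?cardE.
apply: (iffP idP) => [fr mu hmu j jD|h].
  have := elimT (@freeP _ _ #|D| [tuple of [seq row j b | j <- enum D]]) fr (fun i => mu (enum_val i)).
  under eq_bigr do rewrite nthE.
  rewrite -(big_enum_val (fun j => mu j *: row j b)) => /(_ hmu (enum_rank_in jD j)).
  by rewrite enum_rankK_in.
apply: (introT (@freeP _ _ #|D| [tuple of [seq row j b | j <- enum D]])) => mu hmu i.
pose nu j := if insub (index j (enum D)) is Some i' then mu i' else 0.
have nuE i' : nu (enum_val i') = mu i'.
  rewrite /nu index_uniq ?enum_uniq -?cardE//.
  by rewrite insubT ?ltn_ord// => hi; congr mu; apply: val_inj.
rewrite -nuE; apply: h (enum_valP i).
rewrite (big_enum_val (fun j => nu j *: row j b)) -[RHS]hmu.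
by apply: eq_bigr => i' _; rewrite nuE nthE.
Qed.

Lemma relation_rows (D : {set 'I_n}) (mu : 'I_n -> K) :
  (forall t, \sum_(i in D) mu i * glin b i t = 0) -> \sum_(i in D) mu i *: row i b = 0.
Proof.
move=> h; apply/rowP => l; rewrite summxE mxE -[RHS](h (delta_mx 0 l)).
apply: eq_bigr => i _; rewrite !mxE; congr (_ * _).
rewrite /glin (bigD1 l)//= mxE !eqxx mulr1 big1 ?addr0// => l' /negPf l'l.
by rewrite mxE l'l andbF mulr0.
Qed.

(** This number is the constant f_j - sum_i c_i f_(f i), where the c_i are the
coordinates of g_j in the basis. The set of j and of the f i with c_i <> 0 is a
circuit, whose relation is unique up to a factor, so f_C(z) is a multiple of
this number. *)
Lemma offset_neq0 (lam : {set 'I_n} -> 'I_n -> K) (z : 'rV[K]_n) f j :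
  circuit_relations b lam -> ~ discriminant b lam z -> isbasis f -> j \notin codom f ->
  z 0 j - \sum_i coords f j i * z 0 (f i) != 0.
Proof.
move=> hlam hz fb jf; apply/negP => /eqP k0; apply: hz.
pose c := coords f j; have finj := basis_inj fb.
pose C := j |: (f @: [set i | c i != 0]%SET).
have jn : j \notin f @: [set i | c i != 0]%SET.
  by apply: contra jf => /imsetP[i _ ->]; exact: codom_f.
have sumC (W : lmodType K) (F : 'I_n -> W) : \sum_(l in C) F l = F j + \sum_(i | c i != 0) F (f i).
  rewrite big_setU1//= big_imset/=; last by move=> i i' _ _; exact: finj.
  by congr (_ + _); apply: eq_bigl => i; rewrite inE.
have rel (mu : 'I_n -> K) : \sum_(l in C) mu l *: row l b = 0 ->
    forall i, c i != 0 -> mu (f i) = - mu j * c i.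
  rewrite sumC {1}(coordsE j fb) => h i ci.
  have : \sum_l (mu j * c l + (if c l != 0 then mu (f l) else 0)) *: row (f l) b = 0.
    rewrite -[RHS]h scaler_sumr; under eq_bigr do rewrite scalerDl.
    rewrite big_split/=; congr (_ + _); first by apply: eq_bigr => l _; rewrite scalerA.
    by rewrite [RHS]big_mkcond/=; apply: eq_bigr => l _; case: ifP; rewrite ?scale0r.
  move=> /(basis_free fb)/(_ i); rewrite ci => /eqP.
  by rewrite addrC addr_eq0 mulNr => /eqP.
have circC : is_circuit b C.
  apply/andP; split.
    apply/negP => /indep_enumP h.
    have /h/(_ j) : \sum_(l in C) ((l == j)%:R - \sum_(i | f i == l) c i) *: row l b = 0.
      rewrite sumC eqxx big_pred0 ?subr0 ?scale1r; last first.
        by move=> i; apply/eqP => e; move: jf; rewrite -e codom_f.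
      rewrite {1}(coordsE j fb) (bigID (fun i => c i != 0))/= [X in _ + X + _]big1 ?addr0; last first.
        by move=> i; rewrite negbK -/(c i) => /eqP ->; rewrite scale0r.
      rewrite -big_split/= big1// => i ci.
      rewrite (big_pred1 i) => [|i']; last by rewrite /= (inj_eq finj).
      have /negPf -> : f i != j by apply: contraNneq jf => <-; exact: codom_f.
      by rewrite sub0r scaleNr subrr.
    rewrite setU11 eqxx big_pred0 => [|i]; last first.
      by apply/eqP => e; move: jf; rewrite -e codom_f.
    by move=> /(_ isT)/eqP; rewrite subr0 oner_eq0.
  apply/forallP => D; apply/implyP => /properP[DC [l0 l0C l0D]].
  apply/indep_enumP => mu hmu l lD.
  pose mu' l := if l \in D then mu l else 0.
  have hmu' : \sum_(l in C) mu' l *: row l b = 0.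
    rewrite -[RHS]hmu (big_setID D)/= [X in _ + X]big1 ?addr0; last first.
      by move=> l'; rewrite inE => /andP[/negPf l'D _]; rewrite /mu' l'D scale0r.
    rewrite (finset.setIidPr DC); apply: eq_bigr => l' l'D; by rewrite /mu' l'D.
  have r := rel mu' hmu'.
  have mj : mu' j = 0.
    case/setU1P: l0C => [e|/imsetP[i ci e]].
      by rewrite /mu' -e (negPf l0D).
    rewrite inE in ci; have := r i ci; rewrite -e {1}/mu' (negPf l0D) => /eqP.
    by rewrite eq_sym mulf_eq0 (negPf ci) orbF oppr_eq0 => /eqP.
  have : mu' l = 0.
    case/setU1P: (fintype.subsetP DC l lD) => [-> //|/imsetP[i ci ->]].
    by rewrite inE in ci; rewrite r// mj oppr0 mul0r.
  by rewrite /mu' lD.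
exists C => //; have [[l lC ll] /relation_rows hl] := hlam C circC.
have r := rel _ hl.
have := @sumC K^o (fun l => lam C l * z 0 l) => ->.
rewrite (eq_bigr (fun i => - lam C j * (c i * z 0 (f i)))); last first.
  by move=> i ci; rewrite r// mulrA.
rewrite -mulr_sumr mulNr -mulrBr.
suff -> : \sum_(i | c i != 0) c i * z 0 (f i) = \sum_i coords f j i * z 0 (f i).
  by rewrite k0 mulr0.
rewrite [RHS](bigID (fun i => c i != 0))/= [X in _ = _ + X]big1 ?addr0// => i.
by rewrite negbK -/(c i) => /eqP ->; rewrite mul0r.
Qed.

Lemma derive_faff (z : 'rV[K]_n) j (i : 'I_k) (t : 'rV[K]_k) :
  'D_(delta_mx 0 i) (faff b j z) t = b j i.
Proof.
apply: lim_near_cst => //; near=> h.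
have h0 : h != 0 by near: h; exact: nbhs_dnbhs_neq.
rewrite /= /faff /glin opprD addrACA subrr add0r -sumrB (bigD1 i)//= big1 => [|l li].
  by rewrite !mxE !eqxx mulr1 addr0 -mulrBr addrK mulrC scalerA mulVf ?scale1r.
by rewrite !mxE (negPf li) andbF mulr0 add0r subrr.
Unshelve. all: by end_near. Qed.

Lemma dmasterE (a : 'I_n -> K) z i t :
  dmaster b a z i t = \sum_j a j * (b j i / faff b j z t).
Proof. by apply: eq_bigr => j _; rewrite derive_faff. Qed.

End Bases.

(** * The critical ideal contains a power of the maximal ideal *)

Section CriticalPoints.
Variables (R : realType) (n k : nat).
Local Notation C := (R[i] : numFieldType).
Local Notation V := 'rV[C]_k.
Variables (b : 'M[C]_(n, k)) (a : 'I_n -> C) (z : 'rV[C]_n).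
Implicit Types (f : {ffun 'I_k -> 'I_n}) (j : 'I_n) (g h : V -> C) (t p : V).

Definition yinv j t : C := (faff b j z t)^-1.

Local Notation phi := (dmaster b a z).
Local Notation J := (fun p => ideal_at p phi).

Lemma complement_neq0 p j : in_complement b z p -> faff b j z p != 0.
Proof. by move=> /forallP. Qed.

Lemma hol_faff p j : holomorphic_at p (faff b j z).
Proof.
apply: holD; first exact: hol_cst.
by apply: hol_sum => l _; apply: holM; [exact: hol_cst|exact: hol_coord].
Qed.

Lemma hol_yinv p j : in_complement b z p -> holomorphic_at p (yinv j).
Proof. by move=> /complement_neq0 h; apply: holV; [exact: hol_faff|exact: h]. Qed.

Lemma near_complement p : in_complement b z p -> \forall t \near p, in_complement b z t.
Proof.
move=> pc; have : \forall t \near p, forall j, faff b j z t != 0.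
  apply: near_forall_ord => j; apply: hol_neq0; first exact: hol_faff.
  exact: complement_neq0.
by apply: filterS => t h; apply/forallP.
Qed.

Lemma dmaster_yinv i t : phi i t = \sum_j a j * (b j i * yinv j t).
Proof. exact: dmasterE. Qed.

Lemma hol_dmaster p i : in_complement b z p -> holomorphic_at p (phi i).
Proof.
move=> pc; rewrite (_ : phi i = fun t => \sum_j a j * (b j i * yinv j t)); last first.
  by apply/funext => t; exact: dmaster_yinv.
apply: hol_sum => j _; apply: holM; first exact: hol_cst.
by apply: holM; [exact: hol_cst|exact: hol_yinv].
Qed.

Definition yprod f t := \prod_i yinv (f i) t.

Definition basis_span p h := exists c : {ffun 'I_k -> 'I_n} -> C,
  J p (fun t => h t - \sum_(f | isbasis b f) c f * yprod f t).

Lemma basis_spanD p g h : basis_span p g -> basis_span p h -> basis_span p (fun t => g t + h t).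
Proof.
move=> [c hc] [c' hc']; exists (fun f => c f + c' f).
apply: ideal_near (idealD hc hc'); apply: filterE => t.
rewrite [X in _ = _ - X](eq_bigr (fun f => c f * yprod f t + c' f * yprod f t)).
  by rewrite big_split/=; ring.
by move=> f _; rewrite mulrDl.
Qed.

Lemma basis_spanZ p c0 h : basis_span p h -> basis_span p (fun t => c0 * h t).
Proof.
move=> [c hc]; exists (fun f => c0 * c f).
apply: ideal_near (idealM (hol_cst p c0) hc); apply: filterE => t.
by rewrite mulrBr mulr_sumr; congr (_ - _); apply: eq_bigr => f _; rewrite mulrA.
Qed.

Lemma basis_span_ideal p h : J p h -> basis_span p h.
Proof.
move=> Jh; exists (fun=> 0); apply: ideal_near Jh; apply: filterE => t.
by rewrite big1 ?subr0// => f _; rewrite mul0r.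
Qed.

Lemma basis_span_near p g h : (\forall t \near p, g t = h t) -> basis_span p g -> basis_span p h.
Proof.
move=> gh [c hc]; exists c; apply: ideal_near hc; move: gh; apply: filterS => t ->.
by [].
Qed.

Lemma basis_span_sum p (I : Type) (r : seq I) (P : pred I) (F : I -> V -> C) :
  (forall i, P i -> basis_span p (F i)) ->
  basis_span p (fun t => \sum_(i <- r | P i) F i t).
Proof.
move=> hF; elim: r => [|i r IH].
  by under eq_fun do rewrite big_nil; apply: basis_span_ideal; exact: ideal0.
under eq_fun do rewrite big_cons; case Pi: (P i) => //.
by apply: basis_spanD => //; exact: hF.
Qed.

Lemma basis_span_yprod p f : isbasis b f -> basis_span p (yprod f).
Proof.
move=> fb; exists (fun f' => (f' == f)%:R).
apply: ideal_near (ideal0 p phi); apply: filterE => t.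
rewrite (bigD1 f)//= eqxx mul1r big1 ?addr0 ?subrr// => f' /andP[_ /negPf ->].
by rewrite mul0r.
Qed.

Lemma glin_coords f j t : isbasis b f -> glin b j t = \sum_i coords b f j i * glin b (f i) t.
Proof.
move=> fb; have E l : b j l = \sum_i coords b f j i * b (f i) l.
  have /rowP/(_ l) := coordsE j fb; rewrite mxE => ->.
  by rewrite summxE; apply: eq_bigr => i _; rewrite !mxE.
rewrite /glin; under eq_bigr do rewrite E mulr_suml.
rewrite exchange_big/=; apply: eq_bigr => i _; rewrite mulr_sumr.
by apply: eq_bigr => l _; rewrite mulrA.
Qed.

Lemma coords_basis f i i' : isbasis b f -> coords b f (f i) i' = (i == i')%:R.
Proof. by move=> fb; rewrite /coords -row_rowsub -row_mul mulmxV// !mxE. Qed.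

Lemma yprod_exchange f i j t : faff b (f i) z t != 0 ->
  yinv j t * yprod f t * faff b (f i) z t = yprod (exchange f i j) t.
Proof.
move=> h; rewrite /yprod (bigD1 i)//= [RHS](bigD1 i)//= ffunE eqxx.
rewrite [in RHS](eq_bigr (fun i => yinv (f i) t)); last first.
  by move=> i' ii'; rewrite ffunE (negPf ii').
by rewrite {2}/yinv; field.
Qed.

(** Partial fractions: multiply the constant kappa = f_j - sum_i c_i f_(f i) by
the product of y_j and of the y of the basis. In the i-th term of the sum, y_j
replaces the y of f i, and the exchanged family is again a basis. *)
Lemma basis_mul_out p f j : in_complement b z p -> isbasis b f ->
  z 0 j - \sum_i coords b f j i * z 0 (f i) != 0 ->
  basis_span p (fun t => yinv j t * yprod f t).
Proof.
move=> pc fb; set kappa := _ - _ => k0.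
have h1 : basis_span p (fun t => \sum_i - coords b f j i * yprod (exchange f i j) t).
  apply: basis_span_sum => i _; have [c0|c0] := eqVneq (coords b f j i) 0.
    apply: basis_span_ideal; apply: ideal_near (ideal0 p phi); apply: filterE => t.
    by rewrite c0 oppr0 mul0r.
  by apply: basis_spanZ; apply: basis_span_yprod; exact: exchange_basis.
apply: basis_span_near (basis_spanZ kappa^-1 (basis_spanD (basis_span_yprod p fb) h1)).
move: (near_complement pc); apply: filterS => t /forallP tc.
have kE : kappa = faff b j z t - \sum_i coords b f j i * faff b (f i) z t.
  rewrite /kappa /faff (glin_coords j t fb).
  rewrite [X in _ = _ - X](eq_bigr (fun i => coords b f j i * z 0 (f i) +
    coords b f j i * glin b (f i) t)); last by move=> i _; rewrite mulrDr.
  by rewrite big_split/=; ring.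
rewrite (eq_bigr (fun i => - (yinv j t * yprod f t) * (coords b f j i * faff b (f i) z t))).
  rewrite -mulr_sumr; apply: (mulfI k0); rewrite mulrA mulfV// mul1r [in RHS]kE.
  have := tc j; rewrite /yinv => fj; field; exact: fj.
by move=> i _; rewrite -yprod_exchange//; ring.
Qed.

(** For j in the basis, a combination of the critical equations expresses
a_j y_j through the y_m with m outside the basis, the case of
[basis_mul_out]. *)
Lemma basis_mul p f j (lam : {set 'I_n} -> 'I_n -> C) : circuit_relations b lam ->
  ~ discriminant b lam z -> (forall j, a j != 0) -> in_complement b z p ->
  isbasis b f -> basis_span p (fun t => yinv j t * yprod f t).
Proof.
move=> hlam hz ha pc fb.
have out m : m \notin codom f -> basis_span p (fun t => yinv m t * yprod f t).
  by move=> mf; apply: basis_mul_out => //; exact: (offset_neq0 hlam).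
have [/codomP[i0 ji0]|] := boolP (j \in codom f); last exact: out.
(* the combination of the critical equations along the dual basis vector of i0,
   which involves no other element of the basis *)
pose w l := invmx (rowsub f b) l i0.
have hw m : \sum_l w l * b m l = coords b f m i0.
  by rewrite /coords mxE; apply: eq_bigr => l _; rewrite !mxE mulrC.
have OY : holomorphic_at p (yprod f) by apply: hol_prod => i _; exact: hol_yinv.
have h1 : basis_span p (fun t => (a j)^-1 * \sum_l w l * (yprod f t * phi l t)).
  apply: basis_spanZ; apply: basis_span_sum => l _; apply: basis_spanZ.
  by apply: basis_span_ideal; apply: idealM => //; exact: ideal_gen.
have h2 : basis_span p (fun t => - (a j)^-1 * \sum_(m | m \notin codom f)
    a m * coords b f m i0 * (yinv m t * yprod f t)).
  apply: basis_spanZ; apply: basis_span_sum => m mf; apply: basis_spanZ; exact: out.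
apply: basis_span_near (basis_spanD h1 h2); apply: filterE => t.
have E : \sum_l w l * phi l t = a j * yinv j t + \sum_(m | m \notin codom f) a m * coords b f m i0 * yinv m t.
  transitivity (\sum_m a m * coords b f m i0 * yinv m t).
    under eq_bigr do rewrite dmaster_yinv mulr_sumr.
    rewrite exchange_big/=; apply: eq_bigr => m _; rewrite -hw mulr_sumr mulr_suml.
    by apply: eq_bigr => l _; ring.
  rewrite (bigD1 j)//= ji0 (coords_basis i0 i0 fb) eqxx mulr1; congr (_ + _).
  rewrite (bigID (fun m => m \in codom f))/= big1 ?add0r; last first.
    move=> m /andP[mj /codomP[i mi]]; rewrite mi coords_basis//.
    have /negPf -> : i != i0 by apply: contraNneq mj => <-; rewrite mi.
    by rewrite mulr0 mul0r.
  apply: eq_bigl => m; case: (boolP (m \in codom f)); rewrite ?andbF//= andbT.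
  by apply: contraNneq => ->; exact: codom_f.
have -> : \sum_l w l * (yprod f t * phi l t) = yprod f t * \sum_l w l * phi l t.
  by rewrite mulr_sumr; apply: eq_bigr => l _; ring.
have -> : \sum_(m | m \notin codom f) a m * coords b f m i0 * (yinv m t * yprod f t) =
   yprod f t * \sum_(m | m \notin codom f) a m * coords b f m i0 * yinv m t.
  by rewrite mulr_sumr; apply: eq_bigr => m _; ring.
have aj := ha j; rewrite E; set S := \sum_(m | _) _; clearbody S.
by field; rewrite aj.
Qed.

(** By [basis_mul] the products of the y over the bases are an eigenvector for
the eigenvalue y_j, as in [eigen_nilgerm]. *)
Lemma yinv_nilgerm p j (lam : {set 'I_n} -> 'I_n -> C) : circuit_relations b lam ->
  ~ discriminant b lam z -> (forall j, a j != 0) -> in_complement b z p ->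
  (exists f, isbasis b f) -> nilgerm p phi (fun t => yinv j t - yinv j p).
Proof.
move=> hlam hz ha pc [f0 f0b].
pose B : {set {ffun 'I_k -> 'I_n}} := [set f | isbasis b f]%SET.
have Bb (i : 'I_#|B|) : isbasis b (enum_val i) by have := enum_valP i; rewrite inE.
have /choice[X hX] : forall i : 'I_#|B|, exists c : {ffun 'I_k -> 'I_n} -> C,
    J p (fun t => yinv j t * yprod (enum_val i) t - \sum_(f | isbasis b f) c f * yprod f t).
  by move=> i; exact: (basis_mul j hlam hz ha pc (Bb i)).
apply: (@eigen_nilgerm R k p phi #|B| (\matrix_(i, i') X i (enum_val i'))
   (fun i => yprod (enum_val i))).
- exact: hol_yinv.
- by move=> i; apply: hol_prod => l _; exact: hol_yinv.
- move=> i; apply: ideal_near (hX i); apply: filterE => t; congr (_ - _).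
  rewrite (eq_bigl (fun f => f \in B)); last by move=> f; rewrite inE.
  by rewrite (big_enum_val (fun f => X i f * yprod f t)); apply: eq_bigr => i' _; rewrite mxE.
have f0B : f0 \in B by rewrite inE.
exists (enum_rank_in f0B f0); rewrite enum_rankK_in//.
by apply/prodf_neq0 => i _; rewrite invr_eq0; exact: complement_neq0.
Qed.

(** The coordinates are combinations of the differences
f_j - f_j(p) = - f_j f_j(p) (y_j - y_j(p)) for j in a basis. *)
Lemma crd_nilgerm p l (lam : {set 'I_n} -> 'I_n -> C) : circuit_relations b lam ->
  ~ discriminant b lam z -> (forall j, a j != 0) -> in_complement b z p ->
  (exists f, isbasis b f) -> nilgerm p phi (crd p l).
Proof.
move=> hlam hz ha pc fex; have [f fb] := fex.
have h : nilgerm p phi (fun t => \sum_i (- invmx (rowsub f b) l i *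
    (faff b (f i) z t * faff b (f i) z p)) * (yinv (f i) t - yinv (f i) p)).
  apply: nilgerm_sum => i; apply: nilgermM; last exact: (yinv_nilgerm (f i) hlam).
  by apply: holM; [exact: hol_cst|apply: holM; [exact: hol_faff|exact: hol_cst]].
apply: nilgerm_near h; last exact: hol_crd.
move: (near_complement pc); apply: filterS => t tc.
have -> : crd p l t = (invmx (rowsub f b) *m (rowsub f b *m \col_l crd p l t)) l 0.
  by rewrite mulKmx// mxE.
rewrite mxE; apply: eq_bigr => i _.
have -> : (rowsub f b *m \col_l crd p l t) i 0 = faff b (f i) z t - faff b (f i) z p.
  rewrite mxE /faff /glin opprD addrACA subrr add0r -sumrB; apply: eq_bigr => m _.
  by rewrite !mxE mulrBr.
have n1 := complement_neq0 (f i) pc; have n2 := complement_neq0 (f i) tc.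
by rewrite /yinv; field; rewrite n1 n2.
Qed.

Lemma max_ideal_pow p (lam : {set 'I_n} -> 'I_n -> C) : circuit_relations b lam ->
  ~ discriminant b lam z -> (forall j, a j != 0) -> in_complement b z p ->
  (exists f, isbasis b f) -> exists m, forall l, J p (fun t => crd p l t ^+ m.+1).
Proof.
move=> hlam hz ha pc fex.
have /choice[m hm] : forall l, exists m, J p (fun t => crd p l t ^+ m).
  by move=> l; have [_ h] := crd_nilgerm l hlam hz ha pc fex.
exists (\max_l m l)%N => l; apply: nilgerm_pow (hm l) _ _; first exact: hol_crd.
by rewrite leqW// leq_bigmax.
Qed.

End CriticalPoints.

(** * The determinant of a weighted Gram matrix *)

Section CauchyBinet.
Variables (K : numFieldType) (n k : nat) (b : 'M[K]_(n, k)).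

Definition tuple_mx (s : k.-tuple 'I_n) : 'M[K]_k := \matrix_(i, l) b (tnth s i) l.

(** Multilinearity of the determinant in its rows. *)
Lemma det_gram_ffun (w : 'I_n -> K) :
  \det (\matrix_(j, l) \sum_m w m * b m j * b m l) =
  \sum_(f : {ffun 'I_k -> 'I_n}) (\prod_i (w (f i) * b (f i) i)) * \det (rowsub f b).
Proof.
rewrite /determinant.
under eq_bigr do [under eq_bigr do rewrite mxE; rewrite bigA_distr_bigA/= mulr_sumr].
rewrite exchange_big/=; apply: eq_bigr => f _; rewrite mulr_sumr.
apply: eq_bigr => s _; rewrite big_split/= mulrCA; congr (_ * (_ * _)).
by apply: eq_bigr => i _; rewrite mxE.
Qed.

Lemma det_rowsub_perm (I : k.-tuple 'I_n) (s : 'S_k) :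
  \det (rowsub (fun i => tnth I (s i)) b) = (-1) ^+ s * \det (tuple_mx I).
Proof.
rewrite -det_perm -det_mulmx -row_permE; congr (\det _).
by apply/matrixP => i l; rewrite !mxE.
Qed.

Lemma det_rowsub_noninj (f : {ffun 'I_k -> 'I_n}) : ~~ injectiveb f ->
  \det (rowsub f b) = 0.
Proof.
case/injectivePn => i [i' ii' ff]; apply: (determinant_alternate ii') => l.
by rewrite !mxE ff.
Qed.

Definition sort_ffun (f : {ffun 'I_k -> 'I_n}) : k.-tuple 'I_n :=
  sort_tuple (fun i j : 'I_n => (i <= j)%N) [tuple f i | i < k].

Lemma sort_ffun_perm (f : {ffun 'I_k -> 'I_n}) : perm_eq [tuple f i | i < k] (sort_ffun f).
Proof. by rewrite perm_sym /= perm_sort. Qed.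

(** Only injective maps contribute, and an injective map is an increasing tuple
composed with a permutation. Collecting the permutations gives a second
determinant. *)
Lemma det_gram_tuple (w : 'I_n -> K) :
  \det (\matrix_(j, l) \sum_m w m * b m j * b m l) =
  \sum_(I : k.-tuple 'I_n | sorted ltn [seq val j | j <- I])
     (\prod_i w (tnth I i)) * \det (tuple_mx I) ^+ 2.
Proof.
rewrite det_gram_ffun (bigID (fun f : {ffun 'I_k -> 'I_n} => injectiveb f))/=.
rewrite [X in _ + X]big1 ?addr0; last first.
  by move=> f nf; rewrite det_rowsub_noninj// mulr0.
have srt (f : {ffun 'I_k -> 'I_n}) : injectiveb f -> sorted ltn [seq val j | j <- sort_ffun f].
  move=> /injectiveP finj; rewrite ltn_sorted_uniq_leq; apply/andP; split.
    rewrite map_inj_uniq; last exact: val_inj.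
    rewrite -(perm_uniq (sort_ffun_perm f)) map_inj_uniq ?enum_uniq//.
  by rewrite sorted_map; apply: sort_sorted => i j; exact: leq_total.
rewrite (partition_big sort_ffun (fun I => sorted ltn [seq val j | j <- I]))//=.
apply: eq_bigr => I sI.
have uI : uniq I.
  by rewrite -(map_inj_uniq val_inj); apply: sorted_uniq sI; [exact: ltn_trans|exact: ltnn].
have tI : injective (tnth I) by apply/tuple_uniqP.
pose h (s : 'S_k) : {ffun 'I_k -> 'I_n} := [ffun i => tnth I (s i)].
pose h' (f : {ffun 'I_k -> 'I_n}) : 'S_k := odflt 1%g [pick s : 'S_k | [forall i, f i == tnth I (s i)]].
have hs s : sort_ffun (h s) = I.
  apply: val_inj => /=.
  apply: (@sorted_eq _ (fun i j : 'I_n => (i <= j)%N)).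
  - by move=> x y z; exact: leq_trans.
  - by move=> x y; rewrite -eqn_leq => /eqP/val_inj.
  - by apply: sort_sorted => i j; exact: leq_total.
  - have := sI; rewrite ltn_sorted_uniq_leq => /andP[_]; by rewrite sorted_map.
  rewrite perm_sort; apply/tuple_permP; exists s.
  by rewrite /=; apply: eq_map => i; rewrite ffunE.
rewrite (reindex_onto h h'); last first.
  move=> f /andP[_ /eqP fI]; apply/ffunP => i; rewrite ffunE /h'.
  have := sort_ffun_perm f; rewrite fI => /tuple_permP[s /= es].
  have es' i' : f i' = tnth I (s i').
    by have /eq_in_map/(_ i') := es; apply; rewrite mem_enum.
  case: pickP => [s' /forallP/(_ i)/eqP //|/(_ s)].
  by move=> /negP; case; apply/forallP => i'; rewrite es'.
rewrite (eq_bigl predT) => [|s]; last first.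
  rewrite hs eqxx andbT; apply/andP; split.
    by apply/injectiveP => i i'; rewrite !ffunE => /tI /perm_inj.
  rewrite /h'; case: pickP => [s' /forallP e|/(_ s)/negP[]].
    by apply/eqP/permP => i; apply: tI; have /eqP := e i; rewrite ffunE => <-.
  by apply/forallP => i; rewrite ffunE.
have E s : (\prod_i (w (h s i) * b (h s i) i)) * \det (rowsub (h s) b) =
    (\prod_i w (tnth I i)) * \det (tuple_mx I) * ((-1) ^+ s * \prod_i (tuple_mx I)^T i (s i)).
  rewrite (_ : rowsub (h s) b = rowsub (fun i => tnth I (s i)) b); last first.
    by apply/matrixP => i l; rewrite !mxE ffunE.
  rewrite det_rowsub_perm big_split/=.
  rewrite (reindex_inj (@perm_inj _ s) (op := *%R) (F := fun i => w (tnth I i)))/=.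
  under eq_bigr do rewrite ffunE.
  have -> : \prod_i b (h s i) i = \prod_i (tuple_mx I)^T i (s i).
    by apply: eq_bigr => i _; rewrite !mxE ffunE.
  by rewrite -!mulrA; congr (_ * _); rewrite mulrC mulrAC mulrC mulrA.
rewrite (eq_bigr _ (fun s _ => E s)) -mulr_sumr -/(\det _) det_tr.
by rewrite expr2 mulrA.
Qed.

Lemma tuple_mx_indep (I : k.-tuple 'I_n) : \det (tuple_mx I) != 0 -> indep_family b I.
Proof.
move=> dI; have uI : tuple_mx I \in unitmx by rewrite unitmxE unitfE.
apply: (introT (@freeP _ _ k [tuple of [seq row j b | j <- I]])) => mu hmu i.
have : (\row_i mu i) *m tuple_mx I = 0.
  rewrite mulmx_sum_row -[RHS]hmu; apply: eq_bigr => l _; rewrite mxE; congr (_ *: _).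
  apply/rowP => m; rewrite !mxE -tnth_nth tnth_map mxE.
  by [].
move=> /(congr1 (mulmxr (invmx (tuple_mx I)))) /=; rewrite mulmxK// mul0mx.
by move=> /rowP/(_ i); rewrite !mxE.
Qed.

Lemma cauchy_binet_gram (w : 'I_n -> K) :
  \det (\matrix_(j, l) \sum_m w m * b m j * b m l) =
  \sum_(I : indep_set b) (\prod_i w (tnth (val I) i)) * \det (tuple_mx (val I)) ^+ 2.
Proof.
rewrite det_gram_tuple (bigID (fun I : k.-tuple 'I_n => indep_family b I))/=.
rewrite [X in _ + X]big1 ?addr0; last first.
  move=> I /andP[_]; have [->|/tuple_mx_indep ->//] := eqVneq (\det (tuple_mx I)) 0.
  by rewrite expr0n mulr0.
rewrite (reindex_omap (val : indep_set b -> _) insub)/=; last first.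
  by move=> I PI; rewrite insubT.
by apply: eq_bigl => I; rewrite valK eqxx andbT; exact: (valP I).
Qed.

End CauchyBinet.

(** * Functionals on local algebras *)

Section Functionals.
Variables (R : realType) (k : nat).
Local Notation C := (R[i] : numFieldType).
Local Notation V := 'rV[C]_k.
Variable phi : 'I_k -> V -> C.
Implicit Types (g h : V -> C) (t p q : V) (ell : (V -> C) -> C).

(** Functionals on the quotient of the holomorphic germs at p by the ideal of the
phi, given by their values on representatives. *)
Definition functional_at p ell :=
  (forall c g h, holomorphic_at p g -> holomorphic_at p h ->
     ell (fun t => c * g t + h t) = c * ell g + ell h) /\
  (forall h, holomorphic_at p h -> ideal_at p phi h -> ell h = 0).

Section OnePoint.
Variables (p : V) (ell : (V -> C) -> C).
Hypothesis ellp : functional_at p ell.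
Local Notation O := (holomorphic_at p).

Lemma functional_near g h : O g -> O h -> (\forall t \near p, g t = h t) -> ell g = ell h.
Proof.
move=> Og Oh gh; have [lin van] := ellp.
have -> : g = fun t => 1 * (g t - h t) + h t by apply/funext => t; rewrite mul1r subrK.
rewrite lin//; last exact: holB.
rewrite van ?mulr0 ?add0r//; [exact: holB|]; apply: ideal_near (ideal0 p phi).
by move: gh; apply: filterS => t ->; rewrite subrr.
Qed.

Lemma functionalZ c h : O h -> ell (fun t => c * h t) = c * ell h.
Proof.
move=> Oh; have [lin van] := ellp; have := lin c h (fun=> 0) Oh (hol_cst p 0).
rewrite (van (fun=> 0) (hol_cst p 0) (ideal0 p phi)) addr0 => <-; congr ell.
by apply/funext => t; rewrite addr0.
Qed.

Lemma functionalD g h : O g -> O h -> ell (fun t => g t + h t) = ell g + ell h.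
Proof.
move=> Og Oh; have [lin _] := ellp; rewrite -[in RHS](mul1r (ell g)) -lin//; congr ell.
by apply/funext => t; rewrite mul1r.
Qed.

Lemma functional_sum (I : Type) (r : seq I) (P : pred I) (c : I -> C) (F : I -> V -> C) :
  (forall i, O (F i)) ->
  ell (fun t => \sum_(i <- r | P i) c i * F i t) = \sum_(i <- r | P i) c i * ell (F i).
Proof.
move=> OF; elim: r => [|i r IH].
  rewrite big_nil; under eq_fun do rewrite big_nil.
  by have [_ van] := ellp; apply: van; [exact: hol_cst|exact: ideal0].
under eq_fun do rewrite big_cons.
rewrite big_cons; case Pi: (P i) => //; rewrite -IH -functionalZ// -functionalD//.
  by apply: holM; [exact: hol_cst|exact: OF].
by apply: hol_sum => j _; apply: holM; [exact: hol_cst|exact: OF].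
Qed.

End OnePoint.

(** The coordinates in a basis of the quotient. *)
Lemma quotient_functionals p mu : has_quotient_dim (holomorphic_at p) (ideal_at p phi) mu ->
  exists (e : 'I_mu -> V -> C) (c : 'I_mu -> (V -> C) -> C),
    [/\ forall i, holomorphic_at p (e i), forall i, functional_at p (c i),
        forall i j, c i (e j) = (i == j)%:R &
        forall h, holomorphic_at p h -> (forall i, c i h = 0) -> ideal_at p phi h].
Proof.
move=> [e Oe eq]; pose S h : set 'rV[C]_mu :=
  [set x | ideal_at p phi (fun t => h t - \sum_i x 0 i * e i t)].
pose X h := get (S h).
have XP h : holomorphic_at p h -> S h (X h).
  by move=> /eq[x [Sx _]]; apply: (@getI _ (S h) x).
have Xu h x : holomorphic_at p h -> S h x -> X h = x.
  by move=> Oh Sx; have [x' [_ hx']] := eq h Oh; rewrite -(hx' _ (XP _ Oh)) -(hx' _ Sx).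
pose c i h := X h 0 i.
have hX h : (forall i, c i h = 0) -> X h = 0 by move=> ch; apply/rowP => i; rewrite mxE -/(c i h).
exists e, c; split=> //.
- move=> i; split=> [c0 g h Og Oh|h Oh Jh].
    rewrite /c (Xu _ (c0 *: X g + X h)) ?mxE//.
      by apply: holD => //; apply: holM => //; exact: hol_cst.
    apply: ideal_near (idealD (idealM (hol_cst p c0) (XP _ Og)) (XP _ Oh)).
    apply: filterE => t; rewrite mulrBr addrACA; congr (_ + _).
    rewrite -opprD mulr_sumr -big_split/=; congr (- _); apply: eq_bigr => j _.
    by rewrite !mxE; ring.
  rewrite /c (Xu _ 0) ?mxE//.
  apply: ideal_near Jh; apply: filterE => t; rewrite big1 ?subr0// => j _.
  by rewrite mxE mul0r.
- move=> i j; rewrite /c (Xu _ (delta_mx 0 j)) ?mxE//; apply: ideal_near (ideal0 p phi).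
  apply: filterE => t; rewrite (bigD1 j)//= big1 ?addr0 => [|l lj].
    by rewrite mxE !eqxx mul1r subrr.
  by rewrite mxE (negPf lj) andbF mul0r.
- move=> h Oh /hX Xh; have := XP _ Oh; rewrite /S/= Xh; apply: ideal_near.
  by apply: filterE => t; rewrite big1 ?subr0// => j _; rewrite mxE mul0r.
Qed.

End Functionals.

(** * Singular vectors and the Bezoutian *)

Section Bezoutian.
Variables (R : realType) (n k : nat).
Local Notation C := (R[i] : numFieldType).
Local Notation V := 'rV[C]_k.
Variables (b : 'M[C]_(n, k)) (a : 'I_n -> C) (z : 'rV[C]_n).
Implicit Types (g h : V -> C) (s t p q : V) (ell : (V -> C) -> C) (I : indep_set b).

Local Notation y := (yinv b z).
Local Notation phi := (dmaster b a z).

(** Expansion of the determinant along the first column. *)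
Lemma wedge_det m (w : 'I_m -> Defs.form b z 1) (t : {t : V | in_complement b z t}) (v : 'M[C]_(m, k)) :
  wedge w t v = \det (\matrix_(i, l) w l t (row i v)).
Proof.
elim: m w v => [|m IH] w v; first by rewrite det_mx00.
rewrite /= /wedge1 (expand_det_col _ ord0); apply: eq_bigr => i _.
rewrite IH mxE /cofactor addn0 mulrCA mulrA; congr (_ * _ * \det _).
by apply/matrixP => i' l; rewrite !mxE; congr (w _ t _); apply/rowP => j; rewrite !mxE.
Qed.

(** The coefficient of omega_I on dt_1 ... dt_k. *)
Definition eps I t : C := \det (tuple_mx b (val I)) * \prod_i y (tnth (val I) i) t.

Lemma omega_row j (t : {t : V | in_complement b z t}) i (v : 'M[C]_(i, k)) i' :
  omega b z j t (row i' v) = (\sum_l b j l * v i' l) * y j (val t).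
Proof. by rewrite /omega /glin; under eq_bigr do rewrite mxE. Qed.

Lemma row1_sum j i : \sum_l b j l * (1%:M : 'M[C]_k) i l = b j i.
Proof.
rewrite (bigD1 i)//= mxE eqxx mulr1 big1 ?addr0// => l li.
by rewrite mxE eq_sym (negPf li) mulr0.
Qed.

Lemma omega_wedge_eps I (t : {t : V | in_complement b z t}) : omega_wedge (val I) t 1%:M = eps I (val t).
Proof.
rewrite /omega_wedge wedge_det.
rewrite (_ : \matrix_(i, l) _ = (tuple_mx b (val I))^T *m
    diag_mx (\row_i y (tnth (val I) i) (val t))).
  rewrite det_mulmx det_tr det_diag; congr (_ * _).
  by apply: eq_bigr => i _; rewrite mxE.
apply/matrixP => i l; rewrite mul_mx_diag !mxE omega_row row1_sum; reflexivity.
Qed.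

Lemma hol_eps p I : in_complement b z p -> holomorphic_at p (eps I).
Proof.
move=> pc; apply: holM; first exact: hol_cst.
by apply: hol_prod => i _; exact: hol_yinv.
Qed.

Lemma nu_row1 (t : {t : V | in_complement b z t}) i : nu b a z t (row i 1%:M) = phi i (val t).
Proof.
rewrite dmaster_yinv; apply: eq_bigr => j _; by rewrite omega_row row1_sum.
Qed.

(** On the vectors of the standard basis, nu /\ eta takes the value
sum_i (-1) ^ i phi_i H_i, where H_i is a value of eta and holomorphic. Such a
combination is in the ideal, so that ell kills it. *)
Lemma functional_Sing p ell : in_complement b z p -> functional_at phi p ell ->
  [ffun I => ell (eps I) : C^o] \in SingV b a z.
Proof.
move=> pc ellp; apply/mem_SingV => eta [ce ->] c heq.
under eq_bigr do rewrite ffunE.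
rewrite -(functional_sum ellp); last by move=> I; exact: hol_eps.
have [_ van] := ellp; apply: van.
  by apply: hol_sum => I _; apply: holM; [exact: hol_cst|exact: hol_eps].
pose H (i : 'I_k) (t : V) : C := \sum_s ce s *
   \det (\matrix_(i' < k.-1, l < k.-1) (b (tnth s l) (lift i i') * y (tnth s l) t)).
apply: (@ideal_near _ _ _ _ (fun t : V => \sum_(i < k) ((-1) ^+ i * H i t) * phi i t : C)).
  move: (near_complement pc); apply: filterS => t tc.
  have := congr1 (fun w : Defs.form b z k => w (exist _ t tc) 1%:M) heq.
  rewrite /wedge1 => e; transitivity (\sum_i c i * omega_wedge (val i) (exist _ t tc) 1%:M).
    rewrite -e; apply: eq_bigr => i _; rewrite nu_row1 -mulrA [in RHS]mulrAC -mulrA.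
    congr (_ * (_ * _)); apply: eq_bigr => s _; congr (_ * _).
    rewrite /omega_wedge wedge_det; congr (\det _); apply/matrixP => i' l.
    rewrite !mxE omega_row; congr (_ * _); rewrite -(row1_sum (tnth s l)).
    by apply: eq_bigr => l' _; rewrite !mxE.
  by apply: eq_bigr => I _; rewrite omega_wedge_eps.
apply: ideal_sum => i _; apply: idealM; last exact: ideal_gen.
apply: holM; first exact: hol_cst.
apply: hol_sum => s _; apply: holM; first exact: hol_cst.
by apply: hol_det => i' l; apply: holM; [exact: hol_cst|exact: hol_yinv].
Qed.

(** Divided differences of the partial derivatives, chosen symmetric in s and t. *)
Definition bez_mx s t : 'M[C]_k :=
  \matrix_(j, l) \sum_m (a m * y m s * y m t) * b m j * b m l.

(** 1 / f(s) - 1 / f(t) = (f(t) - f(s)) / (f(s) f(t)) for each of the f_m. *)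
Lemma bez_diff j s t : in_complement b z s -> in_complement b z t ->
  phi j s - phi j t = \sum_l bez_mx s t j l * (t 0 l - s 0 l).
Proof.
move=> sc tc; rewrite !dmaster_yinv -sumrB.
under [RHS]eq_bigr do rewrite mxE mulr_suml.
rewrite exchange_big/=; apply: eq_bigr => m _.
have -> : \sum_l a m * y m s * y m t * b m j * b m l * (t 0 l - s 0 l) =
   a m * y m s * y m t * b m j * (faff b m z t - faff b m z s).
  rewrite /faff opprD addrACA subrr add0r -sumrB mulr_sumr.
  by apply: eq_bigr => l _; ring.
have fs := complement_neq0 m sc; have ft := complement_neq0 m tc.
by rewrite /yinv; field; rewrite fs ft.
Qed.

Lemma bez_det s t :
  \det (bez_mx s t) = \sum_I (\prod_i a (tnth (val I) i)) * (eps I s * eps I t).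
Proof.
rewrite (cauchy_binet_gram b (fun m => a m * y m s * y m t)); apply: eq_bigr => I _.
rewrite !big_split/= /eps; set A := \prod_i a _; set B := \prod_i y _ s.
by set D := \prod_i y _ t; set E := \det _; clearbody A B D E; ring.
Qed.

(** Elements of the tensor product of two rings of germs. A functional can be
applied in the variable s and leaves a function that is holomorphic in t. *)
Definition separated p q (F : V -> V -> C) := exists (r : finType) (A B : r -> V -> C),
  [/\ forall i, holomorphic_at p (A i), forall i, holomorphic_at q (B i) &
      forall s t, F s t = \sum_i A i s * B i t].

Lemma separatedM p q F G : separated p q F -> separated p q G ->
  separated p q (fun s t => F s t * G s t).
Proof.
move=> [r [A [B [OA OB e]]]] [r' [A' [B' [OA' OB' e']]]].
exists (r * r')%type, (fun i s => A i.1 s * A' i.2 s), (fun i t => B i.1 t * B' i.2 t).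
split=> [i|i|s t]; try exact: holM.
rewrite e e' mulr_suml; under eq_bigr do rewrite mulr_sumr.
by rewrite pair_bigA/=; apply: eq_bigr => i _; rewrite mulrACA.
Qed.

Lemma separatedD p q F G : separated p q F -> separated p q G ->
  separated p q (fun s t => F s t + G s t).
Proof.
move=> [r [A [B [OA OB e]]]] [r' [A' [B' [OA' OB' e']]]].
exists (r + r')%type, (fun i => match i with inl j => A j | inr j => A' j end),
  (fun i => match i with inl j => B j | inr j => B' j end).
by split=> [[]|[]|s t] //; rewrite e e' big_sumType.
Qed.

Lemma separated1 p q g h : holomorphic_at p g -> holomorphic_at q h ->
  separated p q (fun s t => g s * h t).
Proof.
by move=> Og Oh; exists unit, (fun=> g), (fun=> h); split=> // s t; rewrite big_const card_unit/= addr0.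
Qed.

Lemma separated_cst p q c : separated p q (fun _ _ => c).
Proof.
have := separated1 (hol_cst p c) (hol_cst q 1).
by congr separated; apply/funext => s; apply/funext => t; rewrite mulr1.
Qed.

Lemma separated_sum p q (I : Type) (r : seq I) (P : pred I) F :
  (forall i, P i -> separated p q (F i)) -> separated p q (fun s t => \sum_(i <- r | P i) F i s t).
Proof.
move=> hF; elim: r => [|i r IH].
  have := separated_cst p q 0; congr separated.
  by apply/funext => s; apply/funext => t; rewrite big_nil.
have [Pi|Pi] := boolP (P i).
  have := separatedD (hF i Pi) IH; congr separated.
  by apply/funext => s; apply/funext => t; rewrite big_cons Pi.
congr separated: IH.
by apply/funext => s; apply/funext => t; rewrite big_cons (negPf Pi).
Qed.

Lemma separated_prod p q (I : Type) (r : seq I) (P : pred I) F :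
  (forall i, P i -> separated p q (F i)) -> separated p q (fun s t => \prod_(i <- r | P i) F i s t).
Proof.
move=> hF; elim: r => [|i r IH].
  have := separated_cst p q 1; congr separated.
  by apply/funext => s; apply/funext => t; rewrite big_nil.
have [Pi|Pi] := boolP (P i).
  have := separatedM (hF i Pi) IH; congr separated.
  by apply/funext => s; apply/funext => t; rewrite big_cons Pi.
congr separated: IH.
by apply/funext => s; apply/funext => t; rewrite big_cons (negPf Pi).
Qed.

Lemma separated_det p q m (F : 'I_m -> 'I_m -> V -> V -> C) :
  (forall i j, separated p q (F i j)) ->
  separated p q (fun s t => \det (\matrix_(i, j) F i j s t)).
Proof.
move=> hF; rewrite /determinant; apply: separated_sum => sg _.
apply: separatedM; first exact: separated_cst.
have := @separated_prod p q _ (index_enum _) predT _ (fun i _ => hF i (sg i)); congr separated.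
by apply/funext => s; apply/funext => t; apply: eq_bigr => i _; rewrite mxE.
Qed.

Lemma separated_bez_mx p q j l : in_complement b z p -> in_complement b z q ->
  separated p q (fun s t => bez_mx s t j l).
Proof.
move=> pc qc; have h m : predT m -> separated p q (fun s t => (a m * b m j * b m l * y m s) * y m t).
  move=> _; apply: separated1; last exact: hol_yinv.
  by apply: holM; [exact: hol_cst|exact: hol_yinv].
have := @separated_sum p q _ (index_enum _) predT _ h; congr separated.
apply/funext => s; apply/funext => t; rewrite mxE; apply: eq_bigr => m _; ring.
Qed.

Lemma separated_bez_adj p q j l : in_complement b z p -> in_complement b z q ->
  separated p q (fun s t => (\adj (bez_mx s t)) l j).
Proof.
move=> pc qc; have h1 := separated_det (m := k.-1) (fun i' l' =>
  separated_bez_mx (p := p) (q := q) (lift j i') (lift l l') pc qc).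
have := separatedM (separated_cst p q ((-1) ^+ (j + l))) h1; congr separated.
apply/funext => s; apply/funext => t; rewrite [in RHS]mxE /cofactor; congr (_ * \det _).
by apply/matrixP => i' l'; rewrite !mxE.
Qed.

Lemma separated_left p q F t : separated p q F -> holomorphic_at p (fun s => F s t).
Proof.
move=> [r [A [B [OA OB e]]]]; under eq_fun do rewrite e.
by apply: hol_sum => i _; apply: holM => //; exact: hol_cst.
Qed.

Lemma separated_right p q F s : separated p q F -> holomorphic_at q (F s).
Proof.
move=> [r [A [B [OA OB e]]]].
rewrite (_ : F s = fun t => \sum_i A i s * B i t); last by apply/funext => t; rewrite e.
by apply: hol_sum => i _; apply: holM => //; exact: hol_cst.
Qed.

Lemma separated_apply p q F ell : functional_at phi p ell -> separated p q F ->
  holomorphic_at q (fun t => ell (fun s => F s t)).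
Proof.
move=> ellp [r [A [B [OA OB e]]]].
rewrite (_ : (fun t => _) = fun t => \sum_i B i t * ell (A i)).
  by apply: hol_sum => i _; apply: holM => //; exact: hol_cst.
apply/funext => t; rewrite -(functional_sum ellp)//; congr ell.
by apply/funext => s; rewrite e; apply: eq_bigr => i _; rewrite mulrC.
Qed.

Lemma separated_bez_det p q : in_complement b z p -> in_complement b z q ->
  separated p q (fun s t => \det (bez_mx s t)).
Proof.
move=> pc qc; have := separated_det (fun i' l' =>
  separated_bez_mx (p := p) (q := q) i' l' pc qc); congr separated.
apply/funext => s; apply/funext => t; congr (\det _).
by apply/matrixP => i' l'; rewrite !mxE.
Qed.

(** By Cramer's rule (t_l - s_l) B(s, t) is a combination of the differences
phi_j(s) - phi_j(t). The functional kills what is in the ideal of the phi_j(s),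
and what is left is in the ideal of the phi_j(t). *)
Lemma bez_step p q ell h l c : functional_at phi p ell ->
  in_complement b z p -> in_complement b z q -> holomorphic_at p h ->
  ideal_at q phi (fun t => ell (fun s => h s * (s 0 l - c) * \det (bez_mx s t))
     - (t 0 l - c) * ell (fun s => h s * \det (bez_mx s t))).
Proof.
move=> ellp pc qc Oh; pose A j s t := h s * (\adj (bez_mx s t)) l j.
have sA j : separated p q (A j).
  apply: separatedM; last exact: separated_bez_adj.
  have := separated1 Oh (hol_cst q 1).
  by congr separated; apply/funext => s; apply/funext => t; rewrite mulr1.
apply: (@ideal_near _ _ _ _ (fun t => \sum_j ell (fun s => A j s t) * phi j t)); last first.
  apply: ideal_sum => j _; apply: idealM; last exact: ideal_gen.
  exact: separated_apply (sA j).
move: (near_complement qc); apply: filterS => t tc.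
have OD : holomorphic_at p (fun s => \det (bez_mx s t)).
  exact: separated_left (separated_bez_det pc qc).
have OhD : holomorphic_at p (fun s => h s * \det (bez_mx s t)) by exact: holM.
have Ol : holomorphic_at p (fun s => s 0 l - c).
  by apply: holB; [exact: hol_coord|exact: hol_cst].
have OhlD : holomorphic_at p (fun s => h s * (s 0 l - c) * \det (bez_mx s t)).
  by apply: holM => //; exact: holM.
have OA j : holomorphic_at p (fun s => A j s t) by exact: separated_left (sA j).
have [_ van] := ellp.
have -> : ell (fun s => h s * (s 0 l - c) * \det (bez_mx s t))
     - (t 0 l - c) * ell (fun s => h s * \det (bez_mx s t)) =
   ell (fun s => h s * (s 0 l - c) * \det (bez_mx s t) +
      (- (t 0 l - c)) * (h s * \det (bez_mx s t))).
  rewrite (functionalD ellp)//; last by apply: holM => //; exact: hol_cst.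
  by rewrite (functionalZ ellp)// mulNr.
have O0 : holomorphic_at p (fun s => \sum_j A j s t * phi j s).
  by apply: hol_sum => j _; apply: holM => //; exact: hol_dmaster.
have O1 : holomorphic_at p (fun s => \sum_j phi j t * A j s t).
  by apply: hol_sum => j _; apply: holM => //; exact: hol_cst.
transitivity (ell (fun s => (-1) * (\sum_j A j s t * phi j s) + \sum_j phi j t * A j s t)).
  rewrite (functionalD ellp) ?(functionalZ ellp)//; last by apply: holM => //; exact: hol_cst.
  rewrite (functional_sum ellp)// van//; last first.
    by apply: ideal_sum => j _; apply: idealM => //; exact: ideal_gen.
  by rewrite mulr0 add0r; apply: eq_bigr => j _; rewrite mulrC.
apply: (functional_near ellp).
- by apply: holD => //; apply: holM => //; exact: hol_cst.
- by apply: holD => //; apply: holM => //; exact: hol_cst.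
move: (near_complement pc); apply: filterS => s sc.
rewrite (_ : _ + _ * (_ * _) = - (h s * (\det (bez_mx s t) * (t 0 l - s 0 l)))); last by ring.
rewrite (adj_row_sum _ (fun l => t 0 l - s 0 l)).
under [in RHS]eq_bigr do rewrite -bez_diff//.
rewrite mulN1r mulr_sumr -sumrN -!big_split/= -sumrN; apply: eq_bigr => j _.
by rewrite /A; ring.
Qed.

End Bezoutian.

(** * Gram matrices and the rank of the form *)

Section GramRank.
Variables (K : numFieldType) (vT : vectType K) (B : vT -> vT -> K).
Hypothesis Bl : forall v c x y, B (c *: x + y) v = c * B x v + B y v.
Hypothesis Br : forall v c x y, B v (c *: x + y) = c * B v x + B v y.

Lemma form_suml (I : finType) (c : I -> K) (w : I -> vT) v :
  B (\sum_i c i *: w i) v = \sum_i c i * B (w i) v.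
Proof.
have B0 : B 0 v = 0.
  by have /esym/eqP := Bl v 1 0 0; rewrite scale1r addr0 mul1r -subr_eq0 addrK => /eqP.
elim: (index_enum I) => [|i r IH]; first by rewrite !big_nil.
by rewrite !big_cons Bl IH.
Qed.

Lemma form_sumr (I : finType) (c : I -> K) (w : I -> vT) v :
  B v (\sum_i c i *: w i) = \sum_i c i * B v (w i).
Proof.
have B0 : B v 0 = 0.
  by have /esym/eqP := Br v 1 0 0; rewrite scale1r addr0 mul1r -subr_eq0 addrK => /eqP.
elim: (index_enum I) => [|i r IH]; first by rewrite !big_nil.
by rewrite !big_cons Br IH.
Qed.

(** The Gram matrix of the w x is P Q P^T, where Q is the matrix of the form in a
basis of U, so its rank is at most that of Q. *)
Lemma card_le_form_rank (U : {vspace vT}) (X : finType) (w : X -> vT) :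
  (forall x, w x \in U) ->
  (forall gam : X -> K, (forall x, B (\sum_x' gam x' *: w x') (w x) = 0) -> forall x, gam x = 0) ->
  (#|X| <= form_rank B U)%N.
Proof.
move=> wU nd; pose P : 'M[K]_(#|X|, \dim U) :=
  \matrix_(i, j) coord (vbasis U) j (w (enum_val i)).
rewrite /form_rank; set Q := \matrix_(i, j) _.
have GE : P *m Q *m P^T = \matrix_(i, j) B (w (enum_val i)) (w (enum_val j)).
  apply/matrixP => i j; rewrite [RHS]mxE.
  rewrite [in RHS](coord_vbasis (wU (enum_val i))) [in RHS](coord_vbasis (wU (enum_val j))).
  rewrite form_sumr mxE; apply: eq_bigr => l _; rewrite form_suml mulrC !mxE; congr (_ * _).
  by apply: eq_bigr => l' _; rewrite !mxE.
have : P *m Q *m P^T \in unitmx.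
  apply: unitmx_ker => u; rewrite GE => u0.
  have g0 : forall x, u 0 (enum_rank x) = 0.
    apply: nd => x; rewrite form_suml.
    have /rowP/(_ (enum_rank x)) := u0; rewrite !mxE => e; rewrite -[RHS]e.
    rewrite (reindex_onto (@enum_val X _) enum_rank)/=; last by move=> i _; rewrite enum_rankK.
    by apply: eq_big => [i|i _]; [rewrite enum_valK eqxx|rewrite !mxE enum_valK enum_rankK].
  by apply/rowP => i; rewrite mxE -(g0 (enum_val i)) enum_valK.
move=> /mxrank_unit {1}<-; apply: (leq_trans (mxrankM_maxl _ _)).
exact: mxrankM_maxr.
Qed.

End GramRank.

Section ContravariantRank.
Variables (K : numFieldType) (n k : nat) (b : 'M[K]_(n, k)) (a : 'I_n -> K) (z : 'rV[K]_n).

(** The map from V to W is an isometry from Sing V onto Sing W. *)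
Lemma contravariant_gram_rank (X : finType) (x : X -> spaceV b) :
  (forall i, x i \in SingV b a z) ->
  (forall gam : X -> K, (forall i, contravariant b a (\sum_j gam j *: x j) (x i) = 0) ->
     forall i, gam i = 0) ->
  (#|X| <= form_rank (contravariantW b a) (SingW b a z))%N.
Proof.
move=> xS nd.
have Br v c x0 y0 : contravariantW b a v (c *: x0 + y0) =
    c * contravariantW b a v x0 + contravariantW b a v y0.
  by rewrite /contravariantW linearP contravariant_linear.
have sym u v : contravariantW b a u v = contravariantW b a v u by exact: contravariantC.
have Bl v c x0 y0 : contravariantW b a (c *: x0 + y0) v =
    c * contravariantW b a x0 v + contravariantW b a y0 v.
  by rewrite !(sym _ v) Br.
apply: (card_le_form_rank Bl Br (w := fun i => flat_lin b a (x i))) => [i|gam h].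
  exact: memv_img.
apply: nd => i; rewrite -(h i) -contravariantWE; congr contravariantW.
by rewrite linear_sum; apply: eq_bigr => j _; rewrite linearZ.
Qed.

End ContravariantRank.

(** * Nondegeneracy and the sum of the Milnor numbers *)

Section Nondegeneracy.
Variables (R : realType) (k : nat).
Local Notation C := (R[i] : numFieldType).
Local Notation V := 'rV[C]_k.
Variable phi : 'I_k -> V -> C.
Implicit Types (g h : V -> C) (s t p q : V) (ell : (V -> C) -> C).

Lemma functional_comb p (I : finType) (gam : I -> C) (c : I -> (V -> C) -> C) :
  (forall i, functional_at phi p (c i)) ->
  functional_at phi p (fun h => \sum_i gam i * c i h).
Proof.
move=> hc; split=> [c0 g h Og Oh|h Oh Jh].
  rewrite mulr_sumr -big_split/=; apply: eq_bigr => i _.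
  by have [-> // _] := hc i; ring.
by apply: big1 => i _; have [_ -> //] := hc i; rewrite mulr0.
Qed.

(** Take a product q of coordinates of maximal length such that ell(q g) is not
always 0; the length is bounded by [long_prod_in_ideal]. Then ell(q x_l g) = 0
for all l and g, and the expansion of g at p shows that only g p counts. *)
Lemma socle_product p ell m : functional_at phi p ell ->
  (forall l, ideal_at p phi (fun t => crd p l t ^+ m)) ->
  (exists2 g, holomorphic_at p g & ell g != 0) ->
  exists r : seq 'I_k, let q t := \prod_(l <- r) crd p l t in
    ell q != 0 /\ forall g, holomorphic_at p g -> ell (fun t => q t * g t) = g p * ell q.
Proof.
move=> ellp hm [g0 Og0 ng0]; have [_ van] := ellp.
have Oq r : holomorphic_at p (fun t => \prod_(l <- r) crd p l t).
  by apply: hol_prod => l _; exact: hol_crd.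
pose P N := `[< exists2 r : seq 'I_k, size r = N & exists2 g, holomorphic_at p g &
   ell (fun t => (\prod_(l <- r) crd p l t) * g t) != 0 >].
have exP : exists N, P N.
  exists 0%N; apply/asboolP; exists [::] => //; exists g0 => //.
  by under eq_fun do rewrite big_nil mul1r.
have bP N : P N -> (N <= k * m)%N.
  move=> /asboolP[r <- [g Og]]; rewrite leqNgt; apply: contraNN => kr.
  apply/eqP; apply: van; first exact: holM.
  under eq_fun do rewrite mulrC; apply: idealM => //; exact: long_prod_in_ideal kr.
case: (ex_maxnP exP bP) => N /asboolP[r rN [g1 Og1 ng1]] maxN.
have kill l g : holomorphic_at p g ->
    ell (fun t => (\prod_(l <- r) crd p l t) * (crd p l t * g t)) = 0.
  move=> Og; apply/eqP; apply: contraT => ng; have /maxN : P N.+1; last by rewrite ltnn.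
  apply/asboolP; exists (l :: r); rewrite /= ?rN//; exists g => //.
  by under eq_fun do rewrite big_cons -mulrA mulrCA.
have key g : holomorphic_at p g -> ell (fun t => (\prod_(l <- r) crd p l t) * g t) =
    g p * ell (fun t => \prod_(l <- r) crd p l t).
  move=> Og; have [u Ou eu] := hol_expand Og.
  have Ocu l : holomorphic_at p (fun t => (\prod_(l <- r) crd p l t) * (crd p l t * u l t)).
    by apply: holM => //; apply: holM => //; exact: hol_crd.
  have OS : holomorphic_at p (fun t => \sum_l 1 * ((\prod_(l <- r) crd p l t) * (crd p l t * u l t))).
    by apply: hol_sum => l _; apply: holM => //; exact: hol_cst.
  transitivity (ell (fun t => g p * \prod_(l <- r) crd p l t +
     \sum_l 1 * ((\prod_(l <- r) crd p l t) * (crd p l t * u l t)))).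
    apply: (functional_near ellp); first exact: holM.
      by apply: holD => //; apply: holM => //; exact: hol_cst.
    move: eu; apply: filterS => t ->; rewrite mulrDr mulrC mulr_sumr; congr (_ + _).
    by apply: eq_bigr => l _; rewrite mul1r.
  rewrite (functionalD ellp)//; last by apply: holM => //; exact: hol_cst.
  rewrite (functionalZ ellp)// (functional_sum ellp)// big1 ?addr0// => l _.
  by rewrite kill ?mulr0.
exists r => /=; split=> //.
by apply: contraNneq ng1 => q0; rewrite key// q0 mulr0.
Qed.

(** Products of linear factors instead of polynomials: they are what [bez_step]
can insert one factor at a time. *)
Definition linprod (r : seq ('I_k * C)) t : C := \prod_(x <- r) (t 0 x.1 - x.2).

Lemma hol_linprod p r : holomorphic_at p (linprod r).
Proof.
apply: hol_prod => x _; apply: holB; [exact: hol_coord|exact: hol_cst].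
Qed.

Lemma linprod_cat r r' t : linprod (r ++ r') t = linprod r t * linprod r' t.
Proof. exact: big_cat. Qed.

(** For each of the other points take a coordinate that separates it from p i,
to a power that is in the ideal at that point. *)
Lemma cutoff d (p : 'I_d -> V) m i (S : seq 'I_d) : injective p ->
  (forall i' l, ideal_at (p i') phi (fun t => crd (p i') l t ^+ m)) -> i \notin S ->
  exists r, linprod r (p i) != 0 /\ forall i', i' \in S -> ideal_at (p i') phi (linprod r).
Proof.
move=> pinj hm; elim: S => [_|i' S IH].
  by exists [::]; split=> //; rewrite /linprod big_nil oner_eq0.
rewrite inE negb_or => /andP[ii' /IH[r [nr Jr]]].
have [l nl] : exists l, p i 0 l != p i' 0 l.
  apply/existsP; apply: contraT => /existsPn h; move/negP: ii'; case.
  by apply/eqP/pinj/rowP => l; have := h l; rewrite negbK => /eqP.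
have E t : linprod (nseq m (l, p i' 0 l) ++ r) t = linprod r t * crd (p i') l t ^+ m.
  rewrite linprod_cat mulrC; congr (_ * _).
  by rewrite /linprod big_nseq /= -Monoid.iteropE.
exists (nseq m (l, p i' 0 l) ++ r); split.
  by rewrite E mulf_neq0// expf_neq0// subr_eq0.
move=> i''; rewrite inE => /orP[/eqP ->|/Jr J].
  apply: ideal_near (idealM (hol_linprod (p i') r) (hm i' l)).
  by apply: filterE => t; rewrite E.
have Oc : holomorphic_at (p i'') (fun t => crd (p i') l t ^+ m).
  by apply: holX; apply: holB; [exact: hol_coord|exact: hol_cst].
by apply: ideal_near (idealM Oc J); apply: filterE => t; rewrite E mulrC.
Qed.

End Nondegeneracy.

Section MilnorNumbers.
Variables (R : realType) (n k : nat).
Local Notation C := (R[i] : numFieldType).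
Local Notation V := 'rV[C]_k.
Variables (b : 'M[C]_(n, k)) (a : 'I_n -> C) (z : 'rV[C]_n).
Implicit Types (g h : V -> C) (s t : V).
Local Notation phi := (dmaster b a z).
Local Notation bez := (bez_mx b a z).

Variables (d : nat) (p : 'I_d -> V).
Hypothesis p_inj : injective p.
Hypothesis pcrit : forall i, critical b a z (p i).
Variable m : nat.
Hypothesis hm : forall i l, ideal_at (p i) phi (fun t => crd (p i) l t ^+ m.+1).

Lemma p_compl i : in_complement b z (p i). Proof. by have [] := pcrit i. Qed.

(** Induction with [bez_step]. The factor s_l - c becomes t_l - c modulo the
ideal. *)
Lemma bez_linprod (ell : 'I_d -> (V -> C) -> C) :
  (forall i, functional_at phi (p i) (ell i)) ->
  (forall i, ideal_at (p i) phi (fun t => \sum_i' ell i' (fun s => \det (bez s t)))) ->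
  forall r i, ideal_at (p i) phi
    (fun t => \sum_i' ell i' (fun s => linprod r s * \det (bez s t))).
Proof.
move=> hell hJ; elim=> [|[l c] r IH] i.
  apply: ideal_near (hJ i); apply: filterE => t; apply: eq_bigr => i' _; congr ell.
  by apply/funext => s; rewrite /linprod big_nil mul1r.
have h1 : ideal_at (p i) phi (fun t => \sum_i'
    (ell i' (fun s => linprod r s * (s 0 l - c) * \det (bez s t))
     - (t 0 l - c) * ell i' (fun s => linprod r s * \det (bez s t)))).
  apply: ideal_sum => i' _.
  by apply: (bez_step l c (hell i')); [exact: p_compl|exact: p_compl|exact: hol_linprod].
have Ol : holomorphic_at (p i) (fun t => t 0 l - c).
  by apply: holB; [exact: hol_coord|exact: hol_cst].
apply: ideal_near (idealD h1 (idealM Ol (IH i))); apply: filterE => t.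
rewrite sumrB mulr_sumr subrK; apply: eq_bigr => i' _; congr ell.
by apply/funext => s; rewrite /linprod big_cons/= [in RHS](mulrC (_ - _)).
Qed.

(** At a critical point the phi_j vanish, so that [bez_diff] expresses them
through the coordinates with the matrix - M(p_i, .), and
[transition_det_notin] applies. *)
Lemma bez_det_notin i : ~ ideal_at (p i) phi (fun t => \det (bez (p i) t)).
Proof.
move=> J; have pc := p_compl i.
apply: (@transition_det_notin R k (p i) m phi (fun j l t => - bez (p i) t j l)).
- move=> j l; apply: holN.
  exact: (separated_right (F := fun s t => bez s t j l) (p i) (separated_bez_mx a j l pc pc)).
- move: (near_complement pc); apply: filterS => t tc j.
  have := bez_diff a j pc tc; have [_ ->] := pcrit i; rewrite sub0r => /(congr1 -%R).
  by rewrite opprK -sumrN => ->; apply: eq_bigr => l _; rewrite mulNr.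
- exact: hm.
apply: ideal_near (idealM (hol_cst (p i) ((-1) ^+ k)) J); apply: filterE => t.
by rewrite -detZ; congr (\det _); apply/matrixP => j l; rewrite !mxE mulN1r.
Qed.

(** Otherwise some ell_i is not 0. Multiplying by the product q of
[socle_product] at p_i and by a cutoff, the sum of the functionals becomes a
nonzero multiple of the evaluation at p_i, and [bez_linprod] puts
det M(p_i, .) in the ideal, against [bez_det_notin]. *)
Lemma residue_nondegenerate (ell : 'I_d -> (V -> C) -> C) :
  (forall i, functional_at phi (p i) (ell i)) ->
  (forall i, ideal_at (p i) phi (fun t => \sum_i' ell i' (fun s => \det (bez s t)))) ->
  forall i h, holomorphic_at (p i) h -> ell i h = 0.
Proof.
move=> hell hJ i h Oh; apply/eqP; apply: contraT => nh.
have [r [/=]] := socle_product (hell i) (hm i) (ex_intro2 _ _ h Oh nh).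
set q := fun t => \prod_(l <- r) _ => nq qE.
have iS : i \notin [seq i' <- enum 'I_d | i' != i] by rewrite mem_filter eqxx.
have [r' [nr' Jr']] := cutoff p_inj hm iS.
have qL t : q t = linprod [seq (l, p i 0 l) | l <- r] t by rewrite /linprod big_map.
case: (@bez_det_notin i).
pose c0 := linprod r' (p i) * ell i q.
have c00 : c0 != 0 by rewrite mulf_neq0.
have := bez_linprod hell hJ ([seq (l, p i 0 l) | l <- r] ++ r') i.
move=> /(idealM (hol_cst (p i) c0^-1)); apply: ideal_near; apply: filterE => t.
have OD i' : holomorphic_at (p i') (fun s => \det (bez s t)).
  exact: separated_left (separated_bez_det a (p_compl i') (p_compl i')).
rewrite (bigD1 i)//= big1 ?addr0 => [|i' i'i]; last first.
  have [_ van] := hell i'; apply: van.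
    by apply: holM => //; exact: hol_linprod.
  under eq_fun do rewrite linprod_cat mulrAC; apply: idealM; last first.
    by apply: Jr'; rewrite mem_filter i'i mem_enum.
  by apply: holM => //; exact: hol_linprod.
rewrite (_ : (fun s => _) = fun s => q s * (linprod r' s * \det (bez s t))); last first.
  by apply/funext => s; rewrite linprod_cat -qL mulrA.
rewrite qE; last by apply: holM => //; exact: hol_linprod.
by rewrite mulrAC -/c0 mulKf.
Qed.

(** Index the coordinate functionals at all the points by pairs. A linear
relation gam between the rows of the Gram matrix says that the functional ell
with coefficients gam has ell(B(., t)) in the ideals at all the points, so that
ell = 0 by [residue_nondegenerate] and gam = 0. *)
Lemma milnor_sum_le (mu : 'I_d -> nat) : (forall i, has_milnor_number b a z (p i) (mu i)) ->
  (\sum_i mu i <= form_rank (contravariantW b a) (SingW b a z))%N.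
Proof.
move=> hmu.
pose F i := cid (quotient_functionals (hmu i)).
pose e i := projT1 (F i); pose G i := cid (projT2 (F i)).
pose c i := projT1 (G i).
have H i := projT2 (G i).
have cF i r : functional_at phi (p i) (c i r) by case: (H i) => _ hf _ _; exact: hf.
pose X : finType := {i : 'I_d & 'I_(mu i)}.
pose x (u : X) : spaceV b := [ffun I => c (tag u) (tagged u) (eps z I) : C^o].
have -> : (\sum_i mu i = #|X|)%N.
  transitivity (\sum_i \sum_(r < mu i) 1)%N.
    by apply: eq_bigr => i _; rewrite sum1_card card_ord.
  by rewrite sig_big_dep/= sum1_card.
apply: (contravariant_gram_rank (x := x)).
  by move=> u; apply: functional_Sing (cF _ _); exact: p_compl.
move=> gam h0 [i r].
pose tag_ord i' (r' : 'I_(mu i')) : X := Tagged (fun i => 'I_(mu i)) r'.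
pose ell i' h := \sum_r' gam (tag_ord i' r') * c i' r' h.
have hell i' : functional_at phi (p i') (ell i') by exact: functional_comb.
have xE I : (\sum_u gam u *: x u) I = \sum_i' ell i' (eps z I).
  rewrite sum_ffunE /ell sig_big_dep/=.
  by apply: eq_bigr => -[i' r'] _; rewrite !ffunE.
have hJ i' : ideal_at (p i') phi (fun t => \sum_i'' ell i'' (fun s => \det (bez s t))).
  apply: (@ideal_near _ _ _ _ (fun t => \sum_(I : indep_set b) ((\prod_l a (tnth (val I) l)) *
    (\sum_u gam u *: x u) I) * eps z I t)).
    apply: filterE => t.
    transitivity (\sum_i'' \sum_(I : indep_set b)
        ((\prod_l a (tnth (val I) l)) * eps z I t) * ell i'' (eps z I)).
      rewrite exchange_big/=; apply: eq_bigr => I _; rewrite xE -mulr_sumr; ring.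
    apply: eq_bigr => i'' _; rewrite -(functional_sum (hell i'')); last first.
      by move=> I; apply: hol_eps; exact: p_compl.
    congr (ell i''); apply/funext => s; rewrite bez_det; apply: eq_bigr => I _; ring.
  case: (H i') => _ _ _; apply.
    apply: hol_sum => I _; apply: holM; first exact: hol_cst.
    by apply: hol_eps; exact: p_compl.
  move=> r'; rewrite -/(c i') (functional_sum (cF i' r')); last first.
    by move=> I; apply: hol_eps; exact: p_compl.
  rewrite -[RHS](h0 (tag_ord i' r')) /contravariant; apply: eq_bigr => I _.
  by rewrite [in RHS]/x !ffunE mulrA.
have Oe : holomorphic_at (p i) (e i r) by case: (H i) => h _ _ _; exact: h.
have [_ _ ce _] := H i.
rewrite -(residue_nondegenerate hell hJ Oe) /ell (bigD1 r)//= big1 ?addr0 => [|r' r'r].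
  by rewrite /c ce eqxx mulr1.
by rewrite /c ce (negPf r'r) mulr0.
Qed.

End MilnorNumbers.

Theorem corollary8p15 (R : realType) (n k : nat) (hk : (0 < k)%N) (hkn : (k < n)%N)
    (b : 'M[R[i]]_(n, k)) (a : 'I_n -> R[i])
    (hb : forall j, exists t, glin b j t != 0)
    (hspan : <<[seq row j b | j <- enum 'I_n]>>%VS = fullv)
    (ha : forall j, a j != 0)
    (lam : {set 'I_n} -> 'I_n -> R[i]) (hlam : circuit_relations b lam)
    (z : 'rV[R[i]]_n) (hz : ~ discriminant b lam z)
    (d : nat) (p : 'I_d -> 'rV[R[i]]_k) (p_inj : injective p)
    (hp : forall t, isolated_critical b a z t <-> exists i, t = p i) :
  exists2 mu : 'I_d -> nat,
    forall i, has_milnor_number b a z (p i) (mu i) &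
    (\sum_(i < d) mu i <= form_rank (contravariantW b a) (SingW b a z))%N.
Proof.
have pcrit i : critical b a z (p i) by have [] : isolated_critical b a z (p i) by apply/hp; exists i.
have pc i : in_complement b z (p i) by have [] := pcrit i.
have fex := spanning_basis hspan.
have /choice[m hm] : forall i, exists m, forall l,
    ideal_at (p i) (dmaster b a z) (fun t => crd (p i) l t ^+ m.+1).
  by move=> i; exact: (max_ideal_pow hlam hz ha (pc i) fex).
pose M := (\max_i m i)%N.
have hM i l : ideal_at (p i) (dmaster b a z) (fun t => crd (p i) l t ^+ M.+1).
  apply: nilgerm_pow (hm i l) _ _; first exact: hol_crd.
  by rewrite ltnS leq_bigmax.
have /choice[mu hmu] : forall i, exists mu, has_milnor_number b a z (p i) mu.
  by move=> i; exact: finite_length (hM i).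
by exists mu => //; exact: (milnor_sum_le p_inj pcrit hM).
Qed.
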